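(* Let $f\in\mathcal{K}_S$, and let $T_{2,1}(F_{f^{-1}}/2)=\Gamma_1^2-\Gamma_2^2$, where $\Gamma_1,\Gamma_2$ are the first two logarithmic coefficients of the inverse function $f^{-1}$. Then $$|T_{2,1}(F_{f^{-1}}/2)|\leq \frac{145}{2304}.$$ The inequality is sharp, with the extremal function $$h_7(z)=\frac{\sqrt{6}}{\sqrt{3\sqrt{145}}}\log\left(\frac{1+\left(\frac{\sqrt{3\sqrt{145}}}{2\sqrt{6}}\right)z}{1-\left(\frac{\sqrt{3\sqrt{145}}}{2\sqrt{6}}\right)z}\right)=z+\frac{\sqrt{145}}{24}z^3+\frac{29}{64}z^5+\cdots,\qquad z\in\mathbb{D}.$$
   Context: Let $\mathbb{D}=\{z\in\mathbb{C}:|z|<1\}$, and let $\mathcal{A}$ be the class of holomorphic functions $f$ on $\mathbb{D}$ with $f(0)=0$ and $f'(0)=1$, so that $f(z)=z+\sum_{n=2}^\infty a_nz^n$. The class $\mathcal{K}_S$ of functions convex with respect to symmetric points consists of all $f\in\mathcal{A}$ such that $$\mathrm{Re}\left(\frac{(zf'(z))'}{(f(z)-f(-z))'}\right)>0,\qquad z\in\mathbb{D}.$$ For such $f$, let $F=f^{-1}$ be its inverse function, defined in a neighborhood of the origin (one may take $|w|<1/4$), with $F(w)=w+\sum_{n\ge2}A_nw^n$. The logarithmic coefficients $\Gamma_n=\Gamma_n(F)$ of the inverse function are defined by $$F_{f^{-1}}(w)=\log\left(\frac{F(w)}{w}\right)=2\sum_{n=1}^\infty \Gamma_n w^n,\quad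 |w|<1/4,\qquad \log 1:=0.$$ The second Toeplitz determinant of these coefficients is $$T_{2,1}(F_{f^{-1}}/2)=\begin{vmatrix}\Gamma_1&\Gamma_2\\ \Gamma_2&\Gamma_1\end{vmatrix}=\Gamma_1^2-\Gamma_2^2 .$$
   Formalization: h_7 has a pole inside the unit disc and is not in K_S, so sharpness is proved by existence of some f in K_S attaining equality, while the expansion of h_7 and the value 145/2304 for it are stated only for its germ at 0 rather than for all z in D. *)

(* Defs.v *)
From Stdlib Require Import Reals.
From Coquelicot Require Import Coquelicot.
Open Scope C_scope.

(* [ex_derive] on [C -> C] is over the field [C], i.e. complex
   differentiability. *)
Definition class_A (f : C -> C) : Prop :=
  (forall z : C, (Cmod z < 1)%R -> ex_derive f z) /\
  f 0 = 0 /\ C_derive f 0 = 1.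

(* Division by zero gives 0 in Coquelicot, so the strict inequality also forces
   the denominator (f(z) - f(-z))' to be nonzero throughout the disc. *)
Definition class_KS (f : C -> C) : Prop :=
  class_A f /\
  forall z : C, (Cmod z < 1)%R ->
    (0 < Re (C_derive (fun u => u * C_derive f u) z /
             C_derive (fun u => f u - f (- u)) z)%C)%R.

(* Principal branch: Carg z lies in (-PI, PI] for z <> 0. *)
Definition Carg (z : C) : R :=
  if Rle_dec 0 (Im z) then acos (Re z / Cmod z) else (- acos (Re z / Cmod z))%R.

Definition Clog (z : C) : C := (ln (Cmod z), Carg z).

(* F represents the germ at 0 of the inverse of f, for f with f 0 = 0. *)
Definition local_inverse (f F : C -> C) : Prop :=
  F 0 = 0 /\
  exists r : R, (0 < r)%R /\
    forall z : C, (Cmod z < r)%R -> F (f z) = z /\ f (F z) = z.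

(* log (F(w)/w) = 2 * sum_(n >= 1) Gamma_n w^n near 0; the value Gamma 0 is
   irrelevant. Since F(w)/w -> 1, on a small disc the branch with log 1 = 0 is
   the principal one. *)
Definition log_coeffs (F : C -> C) (Gamma : nat -> C) : Prop :=
  exists r : R, (0 < r)%R /\
    forall w : C, w <> 0 -> (Cmod w < r)%R ->
      is_series (fun n : nat => 2 * (Gamma (S n) * w ^ (S n))) (Clog (F w / w)).

Definition inverse_log_coeffs (f : C -> C) (Gamma : nat -> C) : Prop :=
  exists F : C -> C, local_inverse f F /\ log_coeffs F Gamma.

Definition toeplitz2 (Gamma : nat -> C) : C :=
  Gamma 1%nat ^ 2 - Gamma 2%nat ^ 2.

(* The constant c below exceeds 1, so h7 has a pole at 1/c inside the unit disc
   and does not satisfy class_A; its expansion and its inverse logarithmic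
   coefficients are those of its germ at 0. *)
Definition h7 (z : C) : C :=
  let c : R := (sqrt (3 * sqrt 145) / (2 * sqrt 6))%R in
  RtoC (sqrt 6 / sqrt (3 * sqrt 145)) * Clog ((1 + c * z) / (1 - c * z)).

(* Main.v *)
Require Import Defs.
From Stdlib Require Import Reals Lra Lia.
From Coquelicot Require Import Coquelicot.
Open Scope C_scope.

(** Let f(z) = z + a2 z^2 + a3 z^3 + ... belong to the class. The quotient
    p(z) = 2 (z f'(z))' / (f(z) - f(-z))' has positive real part and expands as
    1 + 4 a2 z + 6 a3 z^2 + ..., so with c = 2 a2 and b = 3 a3 the classical
    bound for functions of positive real part reads |b - c^2| <= 1 - |c|^2
    ([caratheodory_second], [class_KS_expansion]). On the other side,
    comparing coefficients in f(F(w)) = w gives Gamma_1 = - a2 / 2 and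
    Gamma_2 = 3 a2^2 / 4 - a3 / 2 ([local_inverse_log_coeffs]), that is
    Gamma_1 = - c / 4 and Gamma_2 = c^2 / 48 - (b - c^2) / 6. Hence
    |Gamma_1^2 - Gamma_2^2| <= t / 16 + (t / 48 + (1 - t) / 6)^2, t = |c|^2.
    This is convex in t on [0, 1], with values 1 / 36 and 145 / 2304 at the
    ends ([toeplitz_bound]).

    Equality requires |c| = 1 and Gamma_1^2, - Gamma_2^2 of the same argument,
    which happens for c = i, where p(z) = (1 + i z) / (1 - i z). Solving the
    defining equation for this p gives f(z) = i log(1 - i z)
    ([f_ext_class_KS], [f_ext_sharp]). The germ h7 is artanh(c z) / c for
    a constant c with c^2 = sqrt 145 / 8; it has a2 = 0 and a3 = c^2 / 3,
    which gives the same modulus 145 / 2304 ([h7_sharp]).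

    A member f of the class is only assumed complex differentiable, whereas the
    argument differentiates f twice and takes means of p over circles. So
    Cauchy's theory is developed from Goursat's bisection: the bisection is
    applied to the homotopy t |-> z + t (w - z) that contracts a circle to an
    interior point z ([goursat_homotopy], [cauchy_formula]). Cauchy integrals
    are then differentiated by hand, which yields that f' is holomorphic
    ([Hol_derive]), that (f(z) - f(0)) / z extends holomorphically
    ([Hol_slope_at_0]), and the Taylor series ([taylor_series]). *)

(** * Continuity and complex derivatives *)

Lemma RtoC_neq_0 (x : R) : x <> 0%R -> RtoC x <> 0.
Proof. intros H E. apply H, RtoC_inj, E. Qed.

Lemma Cconj_RtoC (x : R) : Cconj (RtoC x) = RtoC x.
Proof. unfold Cconj, RtoC; simpl. f_equal. ring. Qed.

Lemma Cmod_sub_sym (a b : C) : Cmod (a - b) = Cmod (b - a).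
Proof. rewrite <- Cmod_opp. f_equal. ring. Qed.

Lemma Cmod_sub_le (a b : C) : (Cmod (a - b) <= Cmod a + Cmod b)%R.
Proof. rewrite <- (Cmod_opp b). apply Cmod_triangle. Qed.

Lemma Cmod_sub_ge (a b : C) : (Cmod a - Cmod b <= Cmod (a - b))%R.
Proof.
  replace a with ((a - b) + b) at 1 by ring.
  generalize (Cmod_triangle (a - b) b). lra.
Qed.

Lemma locally_C_Cmod (z : C) (P : C -> Prop) :
  locally (T := C_UniformSpace) z P <->
  exists d : R, (0 < d)%R /\ forall y, (Cmod (y - z) < d)%R -> P y.
Proof.
  split.
  - intros H. apply locally_C in H. destruct H as [d Hd].
    exists d; split; [apply cond_pos|]. intros y Hy. apply Hd. exact Hy.
  - intros [d [Hd H]]. apply locally_C. exists (mkposreal d Hd). intros y Hy. apply H. exact Hy.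
Qed.

Lemma filterlim_C_Cmod {T : Type} (F : (T -> Prop) -> Prop) {FF : Filter F} (f : T -> C) (l : C) :
  filterlim f F (locally (T := C_UniformSpace) l) <->
  forall eps : R, (0 < eps)%R -> F (fun x => (Cmod (f x - l) < eps)%R).
Proof.
  split.
  - intros H eps He. apply (H (fun y => (Cmod (y - l) < eps)%R)).
    apply locally_C_Cmod. exists eps; auto.
  - intros H P HP. apply locally_C_Cmod in HP. destruct HP as [d [Hd HP]].
    unfold filtermap. eapply filter_imp; [|apply (H d Hd)]. intros x Hx. apply HP, Hx.
Qed.

Lemma filterlim_Cmult {T : Type} (F : (T -> Prop) -> Prop) {FF : Filter F} (f g : T -> C) (a b : C) :
  filterlim f F (locally (T := C_UniformSpace) a) ->
  filterlim g F (locally (T := C_UniformSpace) b) ->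
  filterlim (fun x => f x * g x) F (locally (T := C_UniformSpace) (a * b)).
Proof.
  intros Hf Hg P HP. apply locally_C in HP.
  assert (Hf' : filterlim f F (locally (T := AbsRing_UniformSpace C_AbsRing) a)).
  { intros Q HQ. apply Hf. apply locally_C. exact HQ. }
  assert (Hg' : filterlim g F (locally (T := AbsRing_UniformSpace C_AbsRing) b)).
  { intros Q HQ. apply Hg. apply locally_C. exact HQ. }
  exact (filterlim_comp_2 f g Cmult Hf' Hg' (filterlim_mult (K := C_AbsRing) a b) P HP).
Qed.

Notation contC f x := (continuous (U := C_UniformSpace) f x).

Lemma contC_eps {U : UniformSpace} (f : U -> C) (x : U) :
  contC f x <-> forall eps : R, (0 < eps)%R -> locally x (fun y => (Cmod (f y - f x) < eps)%R).
Proof. apply filterlim_C_Cmod. apply _. Qed.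

Lemma contC_at (f : C -> C) (z : C) :
  continuous (T := C_UniformSpace) (U := C_UniformSpace) f z <->
  forall eps : R, (0 < eps)%R ->
    exists d : R, (0 < d)%R /\ forall y, (Cmod (y - z) < d)%R -> (Cmod (f y - f z) < eps)%R.
Proof.
  rewrite contC_eps. split; intros H eps He.
  - apply locally_C_Cmod, H, He.
  - apply locally_C_Cmod, H, He.
Qed.

Lemma contC_mult {U : UniformSpace} (f g : U -> C) (x : U) :
  contC f x -> contC g x -> contC (fun y => f y * g y) x.
Proof. intros Hf Hg. apply filterlim_Cmult; auto. apply _. Qed.

Lemma contC_plus {U : UniformSpace} (f g : U -> C) (x : U) :
  contC f x -> contC g x -> contC (fun y => f y + g y) x.
Proof. intros Hf Hg. exact (continuous_plus (V := C_NormedModule) f g x Hf Hg). Qed.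

Lemma contC_const {U : UniformSpace} (c : C) (x : U) : contC (fun _ : U => c) x.
Proof. apply continuous_const. Qed.

Lemma contC_opp {U : UniformSpace} (f : U -> C) (x : U) :
  contC f x -> contC (fun y => - f y) x.
Proof. intros Hf. exact (continuous_opp (V := C_NormedModule) f x Hf). Qed.

Lemma contC_minus {U : UniformSpace} (f g : U -> C) (x : U) :
  contC f x -> contC g x -> contC (fun y => f y - g y) x.
Proof. intros Hf Hg. apply contC_plus; auto. apply contC_opp; auto. Qed.

Lemma contC_conj {U : UniformSpace} (f : U -> C) (x : U) :
  contC f x -> contC (fun y => Cconj (f y)) x.
Proof.
  rewrite !contC_eps. intros H eps He. generalize (H eps He). apply filter_imp.
  intros y Hy. rewrite <- Cminus_conj, Cmod_conj. exact Hy.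
Qed.

Lemma contC_inv {U : UniformSpace} (f : U -> C) (x : U) :
  f x <> 0 -> contC f x -> contC (fun y => / f y) x.
Proof.
  intros Hx. rewrite !contC_eps. intros H eps He.
  assert (Hm : (0 < Cmod (f x))%R) by (apply Cmod_gt_0; auto).
  set (m := Cmod (f x)) in *.
  assert (H1 : (0 < m / 2)%R) by lra.
  assert (H2 : (0 < eps * (m * m / 2))%R) by (apply Rmult_lt_0_compat; nra).
  generalize (filter_and _ _ (H _ H1) (H _ H2)). apply filter_imp. intros y [Hy1 Hy2].
  assert (Hy3 : (m / 2 < Cmod (f y))%R).
  { generalize (Cmod_sub_ge (f x) (f y)). rewrite (Cmod_sub_sym (f x)). fold m. lra. }
  assert (Hy0 : f y <> 0). { intros E. rewrite E, Cmod_0 in Hy3. lra. }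
  replace (/ f y - / f x) with ((f x - f y) / (f x * f y)) by (field; auto).
  rewrite Cmod_div by (apply Cmult_neq_0; auto).
  rewrite Cmod_mult, Cmod_sub_sym. fold m.
  apply Rmult_lt_reg_r with (m * Cmod (f y))%R; [apply Rmult_lt_0_compat; lra|].
  unfold Rdiv. rewrite Rmult_assoc, Rinv_l by nra. nra.
Qed.

Lemma contC_div {U : UniformSpace} (f g : U -> C) (x : U) :
  g x <> 0 -> contC f x -> contC g x -> contC (fun y => f y / g y) x.
Proof. intros H Hf Hg. apply contC_mult; auto. apply contC_inv; auto. Qed.

Lemma contC_pow {U : UniformSpace} (f : U -> C) (n : nat) (x : U) :
  contC f x -> contC (fun y => f y ^ n) x.
Proof.
  intros Hf. induction n as [|n IH].
  - apply contC_const.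
  - apply (continuous_ext (fun y => f y * f y ^ n)); [intros y; reflexivity|].
    apply contC_mult; auto.
Qed.

(** Differentiability as an estimate in [Cmod], the form in which the bounds on
    Cauchy integrals deliver it ([Cder_quadratic]) and which curves consume
    ([Rder_comp]). *)
Definition Cder (f : C -> C) (z l : C) : Prop :=
  forall eps : R, (0 < eps)%R ->
    exists d : R, (0 < d)%R /\ forall y, (Cmod (y - z) < d)%R ->
      (Cmod (f y - f z - l * (y - z)) <= eps * Cmod (y - z))%R.

Definition Cdiff (f : C -> C) (z : C) : Prop := exists l, Cder f z l.

Lemma Cder_is_derive (f : C -> C) (z l : C) : Cder f z l <-> is_derive f z l.
Proof.
  split.
  - intros H. split; [apply is_linear_scal_l|].
    intros x Hx eps.
    apply (@is_filter_lim_locally_unique C_AbsRing (AbsRing_NormedModule C_AbsRing)) in Hx. subst x.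
    destruct (H eps (cond_pos eps)) as [d [Hd Hy]].
    exists (mkposreal d Hd). intros y Hyd.
    specialize (Hy y Hyd). rewrite Cmult_comm in Hy. exact Hy.
  - intros [_ H] eps He.
    destruct (H z (fun P HP => HP) (mkposreal eps He)) as [d Hd].
    exists d; split; [apply cond_pos|]. intros y Hy.
    specialize (Hd y Hy). rewrite (Cmult_comm l). exact Hd.
Qed.

Lemma Cder_C_derive (f : C -> C) (z l : C) : Cder f z l -> C_derive f z = l.
Proof. intros H. apply is_C_derive_unique, Cder_is_derive, H. Qed.

Lemma Cder_unique (f : C -> C) (z l m : C) : Cder f z l -> Cder f z m -> l = m.
Proof. intros H1 H2. rewrite <- (Cder_C_derive _ _ _ H1). apply Cder_C_derive, H2. Qed.

Lemma Cdiff_ex_derive (f : C -> C) (z : C) : Cdiff f z <-> ex_derive f z.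
Proof.
  split; intros [l H]; exists l; apply Cder_is_derive; exact H.
Qed.

Lemma Cdiff_Cder (f : C -> C) (z : C) : Cdiff f z -> Cder f z (C_derive f z).
Proof. intros [l H]. rewrite (Cder_C_derive _ _ _ H). exact H. Qed.

(** Caratheodory's form of the derivative: the difference quotient extends
    continuously to z. It reduces the product, inverse and chain rules to the
    corresponding rules for continuity. *)
Lemma Cder_factor (f : C -> C) (z l : C) :
  Cder f z l <->
  exists q : C -> C, contC q z /\ q z = l /\ forall y, f y = f z + q y * (y - z).
Proof.
  split.
  - intros H.
    exists (fun y => if Ceq_dec y z then l else (f y - f z) / (y - z)).
    split; [|split].
    + apply contC_at. intros eps He.
      assert (He2 : (0 < eps / 2)%R) by lra.
      destruct (H _ He2) as [d [Hd Hy]]. exists d; split; auto.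
      intros y Hyd. destruct (Ceq_dec z z) as [_|N]; [|tauto].
      destruct (Ceq_dec y z) as [E|N].
      * replace (l - l) with (RtoC 0) by ring. rewrite Cmod_0. exact He.
      * specialize (Hy y Hyd).
        assert (Hn : y - z <> 0) by (apply Cminus_eq_contra; auto).
        assert (Hp := proj1 (Cmod_gt_0 _) Hn).
        replace ((f y - f z) / (y - z) - l) with ((f y - f z - l * (y - z)) / (y - z)) by (field; auto).
        rewrite Cmod_div by auto.
        apply Rle_lt_trans with (eps / 2)%R; [|lra].
        apply Rmult_le_reg_r with (Cmod (y - z)); auto.
        unfold Rdiv at 1. rewrite Rmult_assoc, Rinv_l by lra. lra.
    + destruct (Ceq_dec z z) as [_|N]; tauto.
    + intros y. destruct (Ceq_dec y z) as [E|N].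
      * subst. ring.
      * field. apply Cminus_eq_contra; auto.
  - intros [q [Hc [Hl Hf]]] eps He.
    destruct (proj1 (contC_at _ _) Hc eps He) as [d [Hd Hy]].
    exists d; split; auto. intros y Hyd.
    replace (f y - f z - l * (y - z)) with ((q y - q z) * (y - z)) by (rewrite (Hf y), Hl; ring).
    rewrite Cmod_mult. apply Rmult_le_compat_r; [apply Cmod_ge_0|].
    left; auto.
Qed.

Lemma Cder_cont (f : C -> C) (z l : C) : Cder f z l -> contC f z.
Proof.
  intros H. apply Cder_factor in H. destruct H as [q [Hc [_ Hf]]].
  apply (continuous_ext (fun y => f z + q y * (y - z))); [intros y; symmetry; apply Hf|].
  apply contC_plus; [apply contC_const|]. apply contC_mult; auto.
  apply contC_minus; [apply continuous_id|apply contC_const].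
Qed.

Lemma Cdiff_cont (f : C -> C) (z : C) : Cdiff f z -> contC f z.
Proof. intros [l H]. eapply Cder_cont, H. Qed.

Lemma Cder_ext_loc (f g : C -> C) (z l : C) (d : R) :
  (0 < d)%R -> (forall y, (Cmod (y - z) < d)%R -> f y = g y) -> Cder f z l -> Cder g z l.
Proof.
  intros Hd E H eps He. destruct (H eps He) as [d' [Hd' Hy]].
  exists (Rmin d d'); split; [apply Rmin_pos; auto|]. intros y Hyd.
  rewrite <- !E; [apply Hy| |].
  - eapply Rlt_le_trans; [apply Hyd|apply Rmin_r].
  - replace (z - z) with (RtoC 0) by ring. rewrite Cmod_0; auto.
  - eapply Rlt_le_trans; [apply Hyd|apply Rmin_l].
Qed.

Lemma Cdiff_ext_loc (f g : C -> C) (z : C) (d : R) :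
  (0 < d)%R -> (forall y, (Cmod (y - z) < d)%R -> f y = g y) -> Cdiff f z -> Cdiff g z.
Proof. intros Hd E [l H]. exists l. eapply Cder_ext_loc; eauto. Qed.

Lemma Cder_eq (f : C -> C) (z l m : C) : Cder f z l -> l = m -> Cder f z m.
Proof. intros H <-. exact H. Qed.

Lemma Cder_const (c z : C) : Cder (fun _ => c) z 0.
Proof.
  apply Cder_factor. exists (fun _ => RtoC 0). repeat split; [apply contC_const|intros; ring].
Qed.

Lemma Cder_id (z : C) : Cder (fun y => y) z 1.
Proof.
  apply Cder_factor. exists (fun _ => RtoC 1). repeat split; [apply contC_const|intros; ring].
Qed.

Lemma Cder_plus (f g : C -> C) (z l m : C) :
  Cder f z l -> Cder g z m -> Cder (fun y => f y + g y) z (l + m).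
Proof.
  rewrite !Cder_factor. intros [q [Hq [El Ef]]] [p [Hp [Em Eg]]].
  exists (fun y => q y + p y). split; [apply contC_plus; auto|]. split; [congruence|].
  intros y. rewrite (Ef y), (Eg y). ring.
Qed.

Lemma Cder_mult (f g : C -> C) (z l m : C) :
  Cder f z l -> Cder g z m -> Cder (fun y => f y * g y) z (l * g z + f z * m).
Proof.
  intros Hf Hg. assert (Cg := Cder_cont _ _ _ Hg). revert Hf Hg.
  rewrite !Cder_factor. intros [q [Hq [El Ef]]] [p [Hp [Em Eg]]].
  exists (fun y => q y * g y + f z * p y). split; [|split; [congruence|]].
  - apply contC_plus; apply contC_mult; auto. apply contC_const.
  - intros y. rewrite (Ef y), (Eg y). ring.
Qed.

Lemma Cder_opp (f : C -> C) (z l : C) : Cder f z l -> Cder (fun y => - f y) z (- l).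
Proof.
  rewrite !Cder_factor. intros [q [Hq [El Ef]]].
  exists (fun y => - q y). split; [apply contC_opp; auto|]. split; [congruence|].
  intros y. rewrite (Ef y). ring.
Qed.

Lemma Cder_minus (f g : C -> C) (z l m : C) :
  Cder f z l -> Cder g z m -> Cder (fun y => f y - g y) z (l - m).
Proof. intros Hf Hg. apply Cder_plus; auto. apply Cder_opp; auto. Qed.

Lemma Cder_inv (f : C -> C) (z l : C) :
  f z <> 0 -> Cder f z l -> Cder (fun y => / f y) z (- l / (f z * f z)).
Proof.
  intros Hz H eps He. assert (Hc := Cder_cont _ _ _ H).
  destruct (proj1 (Cder_factor _ _ _) H) as [q [Hq [El Ef]]].
  assert (Hd : exists d, (0 < d)%R /\ forall y, (Cmod (y - z) < d)%R -> f y <> 0).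
  { assert (Hm := proj1 (Cmod_gt_0 _) Hz).
    destruct (proj1 (contC_at _ _) Hc _ Hm) as [d [Hd Hy]]. exists d; split; auto.
    intros y Hyd E. specialize (Hy y Hyd). rewrite E in Hy.
    replace (0 - f z) with (- f z) in Hy by ring. rewrite Cmod_opp in Hy. lra. }
  destruct Hd as [d [Hd Hn]].
  assert (Hk : contC (fun y => - q y / (f y * f z)) z).
  { apply contC_div; [apply Cmult_neq_0; auto| |].
    - apply contC_opp; auto.
    - apply contC_mult; auto. apply contC_const. }
  destruct (proj1 (contC_at _ _) Hk eps He) as [d' [Hd' Hy]].
  exists (Rmin d d'); split; [apply Rmin_pos; auto|]. intros y Hyd.
  assert (Hy0 : f y <> 0). { apply Hn. eapply Rlt_le_trans; [apply Hyd|apply Rmin_l]. }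
  replace (/ f y - / f z - - l / (f z * f z) * (y - z)) with
    ((- q y / (f y * f z) - - q z / (f z * f z)) * (y - z)).
  - rewrite Cmod_mult. apply Rmult_le_compat_r; [apply Cmod_ge_0|]. left. apply Hy.
    eapply Rlt_le_trans; [apply Hyd|apply Rmin_r].
  - rewrite El. replace (/ f y - / f z) with ((f z - f y) / (f y * f z)) by (field; auto).
    replace (f z - f y) with (- q y * (y - z)) by (rewrite (Ef y); ring). field; auto.
Qed.

Lemma Cder_comp (g f : C -> C) (z l m : C) :
  Cder f z l -> Cder g (f z) m -> Cder (fun y => g (f y)) z (m * l).
Proof.
  intros Hf Hg. assert (Cf := Cder_cont _ _ _ Hf). revert Hf Hg.
  rewrite !Cder_factor. intros [q [Hq [El Ef]]] [p [Hp [Em Eg]]].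
  exists (fun y => p (f y) * q y). split; [|split; [congruence|]].
  - apply contC_mult; auto. apply (continuous_comp f p); auto.
  - intros y. rewrite (Eg (f y)).
    replace (f y - f z) with (q y * (y - z)) by (rewrite (Ef y); ring). ring.
Qed.

Lemma Cdiff_const (c z : C) : Cdiff (fun _ => c) z.
Proof. eexists; apply Cder_const. Qed.
Lemma Cdiff_id (z : C) : Cdiff (fun y => y) z.
Proof. eexists; apply Cder_id. Qed.
Lemma Cdiff_plus (f g : C -> C) (z : C) : Cdiff f z -> Cdiff g z -> Cdiff (fun y => f y + g y) z.
Proof. intros [l Hl] [m Hm]. eexists; apply Cder_plus; eauto. Qed.
Lemma Cdiff_minus (f g : C -> C) (z : C) : Cdiff f z -> Cdiff g z -> Cdiff (fun y => f y - g y) z.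
Proof. intros [l Hl] [m Hm]. eexists; apply Cder_minus; eauto. Qed.
Lemma Cdiff_opp (f : C -> C) (z : C) : Cdiff f z -> Cdiff (fun y => - f y) z.
Proof. intros [l Hl]. eexists; apply Cder_opp; eauto. Qed.
Lemma Cdiff_mult (f g : C -> C) (z : C) : Cdiff f z -> Cdiff g z -> Cdiff (fun y => f y * g y) z.
Proof. intros [l Hl] [m Hm]. eexists; apply Cder_mult; eauto. Qed.
Lemma Cdiff_div (f g : C -> C) (z : C) : g z <> 0 -> Cdiff f z -> Cdiff g z -> Cdiff (fun y => f y / g y) z.
Proof. intros H [l Hl] [m Hm]. eexists. apply Cder_mult; [eauto|]. apply Cder_inv; eauto. Qed.
Lemma Cdiff_comp (g f : C -> C) (z : C) : Cdiff f z -> Cdiff g (f z) -> Cdiff (fun y => g (f y)) z.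
Proof. intros [l Hl] [m Hm]. eexists; eapply Cder_comp; eauto. Qed.

(** * Curves and complex-valued integrals *)

Notation CIs := (is_RInt (V := C_R_NormedModule)).
Notation CI := (RInt (V := C_R_CompleteNormedModule)).
Notation Rder := (is_derive (K := R_AbsRing) (V := C_R_NormedModule)).

Lemma Rder_eps (g : R -> C) (t : R) (m : C) :
  Rder g t m <-> forall eps : R, (0 < eps)%R -> exists d : R, (0 < d)%R /\
    forall s : R, (Rabs (s - t) < d)%R ->
      (Cmod (g s - g t - RtoC (s - t) * m) <= eps * Rabs (s - t))%R.
Proof.
  split.
  - intros [_ H] eps He.
    destruct (H t (fun P HP => HP) (mkposreal eps He)) as [d Hd].
    exists d; split; [apply cond_pos|]. intros y Hy.
    specialize (Hd y Hy). rewrite <- scal_R_Cmult, Cmod_norm. exact Hd.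
  - intros H. split; [apply is_linear_scal_l|].
    intros x Hx eps.
    apply (@is_filter_lim_locally_unique R_AbsRing (AbsRing_NormedModule R_AbsRing)) in Hx. subst x.
    destruct (H eps (cond_pos eps)) as [d [Hd Hy]].
    exists (mkposreal d Hd). intros y Hyd.
    specialize (Hy y Hyd). rewrite <- scal_R_Cmult, Cmod_norm in Hy. exact Hy.
Qed.

Lemma contC_R (g : R -> C) (t : R) :
  contC g t <-> forall eps : R, (0 < eps)%R -> exists d : R, (0 < d)%R /\
    forall s : R, (Rabs (s - t) < d)%R -> (Cmod (g s - g t) < eps)%R.
Proof.
  rewrite contC_eps. split; intros H eps He.
  - destruct (H eps He) as [d Hd]. exists d; split; [apply cond_pos|]. exact Hd.
  - destruct (H eps He) as [d [Hp Hd]]. exists (mkposreal d Hp). exact Hd.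
Qed.

Lemma Rder_cont (g : R -> C) (t : R) (m : C) : Rder g t m -> contC g t.
Proof.
  intros H. apply (ex_derive_continuous (V := C_R_NormedModule)). exists m; exact H.
Qed.

Lemma Rder_comp (H : C -> C) (g : R -> C) (t : R) (l m : C) :
  Cder H (g t) l -> Rder g t m -> Rder (fun s => H (g s)) t (l * m).
Proof.
  intros HH Hg. assert (Cg := Rder_cont _ _ _ Hg).
  apply Rder_eps. intros eps He.
  rewrite Rder_eps in Hg. rewrite contC_R in Cg.
  set (L := (Cmod l + 1)%R). set (N := (Cmod m + 1)%R).
  assert (HL : (0 < L)%R) by (unfold L; generalize (Cmod_ge_0 l); lra).
  assert (HN : (0 < N)%R) by (unfold N; generalize (Cmod_ge_0 m); lra).
  assert (E1 : (0 < eps / 2 / N)%R) by (repeat apply Rdiv_lt_0_compat; lra).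
  destruct (HH _ E1) as [d1 [Hd1 H1]].
  destruct (Cg _ Hd1) as [d2 [Hd2 H2]].
  assert (E3 : (0 < Rmin 1 (eps / 2 / L))%R).
  { apply Rmin_pos; [lra|]. repeat apply Rdiv_lt_0_compat; lra. }
  destruct (Hg _ E3) as [d3 [Hd3 H3]].
  exists (Rmin d2 d3); split; [apply Rmin_pos; auto|]. intros s Hs.
  assert (Hs2 : (Rabs (s - t) < d2)%R) by (eapply Rlt_le_trans; [apply Hs|apply Rmin_l]).
  assert (Hs3 : (Rabs (s - t) < d3)%R) by (eapply Rlt_le_trans; [apply Hs|apply Rmin_r]).
  specialize (H1 _ (H2 _ Hs2)). specialize (H3 _ Hs3). clear H2.
  set (D := g s - g t) in *. set (h := Rabs (s - t)) in *.
  assert (Hh : (0 <= h)%R) by apply Rabs_pos.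
  assert (HD : (Cmod D <= N * h)%R).
  { replace D with ((D - RtoC (s - t) * m) + RtoC (s - t) * m) by ring.
    eapply Rle_trans; [apply Cmod_triangle|]. rewrite Cmod_mult, Cmod_R. fold h.
    unfold N. generalize (Rmin_l 1 (eps / 2 / L)). nra. }
  replace (H (g s) - H (g t) - RtoC (s - t) * (l * m)) with
    ((H (g s) - H (g t) - l * D) + l * (D - RtoC (s - t) * m)) by ring.
  eapply Rle_trans; [apply Cmod_triangle|]. rewrite Cmod_mult.
  assert (A1 : (eps / 2 / N * Cmod D <= eps / 2 * h)%R).
  { apply Rle_trans with (eps / 2 / N * (N * h))%R.
    - apply Rmult_le_compat_l; lra.
    - right. field. lra. }
  assert (A2 : (Cmod l * Cmod (D - RtoC (s - t) * m) <= eps / 2 * h)%R).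
  { apply Rle_trans with (L * (eps / 2 / L * h))%R.
    - apply Rmult_le_compat; try apply Cmod_ge_0; [unfold L; lra|].
      eapply Rle_trans; [apply H3|]. apply Rmult_le_compat_r; auto. apply Rmin_r.
    - right. field. lra. }
  lra.
Qed.

Lemma Rder_affine (a b : C) (t : R) : Rder (fun s => a + RtoC s * b) t b.
Proof.
  apply Rder_eps. intros eps He. exists 1%R; split; [lra|]. intros s _.
  replace (a + s * b - (a + t * b) - (s - t)%R * b) with (RtoC 0) by (rewrite RtoC_minus; ring).
  rewrite Cmod_0. apply Rmult_le_pos; [lra|apply Rabs_pos].
Qed.

(** The integral over the real line is R-linear by construction; C-linearity
    has to be read off from the real and imaginary parts. *)
Lemma CIs_mult (c : C) (g : R -> C) (a b : R) (v : C) :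
  CIs g a b v -> CIs (fun t => c * g t) a b (c * v).
Proof.
  intros H.
  assert (H1 := is_RInt_fct_extend_fst (U := R_NormedModule) (V := R_NormedModule) g a b v H).
  assert (H2 := is_RInt_fct_extend_snd (U := R_NormedModule) (V := R_NormedModule) g a b v H).
  apply (is_RInt_fct_extend_pair (U := R_NormedModule) (V := R_NormedModule)).
  - apply (is_RInt_minus (V := R_NormedModule));
      apply (is_RInt_scal (V := R_NormedModule)); assumption.
  - apply (is_RInt_plus (V := R_NormedModule));
      apply (is_RInt_scal (V := R_NormedModule)); assumption.
Qed.

Lemma CIs_conj (g : R -> C) (a b : R) (v : C) :
  CIs g a b v -> CIs (fun t => Cconj (g t)) a b (Cconj v).
Proof.
  intros H.
  assert (H1 := is_RInt_fct_extend_fst (U := R_NormedModule) (V := R_NormedModule) g a b v H).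
  assert (H2 := is_RInt_fct_extend_snd (U := R_NormedModule) (V := R_NormedModule) g a b v H).
  apply (is_RInt_fct_extend_pair (U := R_NormedModule) (V := R_NormedModule)); [exact H1|].
  apply (is_RInt_opp (V := R_NormedModule)); assumption.
Qed.

Lemma CI_correct (g : R -> C) (a b : R) :
  (a <= b)%R -> (forall t, (a <= t <= b)%R -> contC g t) -> CIs g a b (CI g a b).
Proof.
  intros Hab H. apply (RInt_correct (V := C_R_CompleteNormedModule)).
  apply (ex_RInt_continuous (V := C_R_CompleteNormedModule)).
  intros t Ht. rewrite Rmin_left, Rmax_right in Ht by auto. apply H, Ht.
Qed.

Lemma CI_unique (g : R -> C) (a b : R) (v : C) : CIs g a b v -> CI g a b = v.
Proof. apply (is_RInt_unique (V := C_R_CompleteNormedModule)). Qed.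

Lemma CI_derive (g dg : R -> C) (a b : R) :
  (a <= b)%R -> (forall t, (a <= t <= b)%R -> Rder g t (dg t)) ->
  (forall t, (a <= t <= b)%R -> contC dg t) -> CIs dg a b (g b - g a).
Proof.
  intros Hab H1 H2.
  apply (is_RInt_derive (V := C_R_CompleteNormedModule) g dg a b); intros t Ht;
    rewrite Rmin_left, Rmax_right in Ht by auto; [apply H1|apply H2]; auto.
Qed.

Lemma norm_CR (z : C) : norm (V := C_R_NormedModule) z = Cmod z.
Proof. symmetry. apply Cmod_norm. Qed.

Lemma CIs_bound (g : R -> C) (a b B : R) (v : C) :
  (a <= b)%R -> (forall t, (a <= t <= b)%R -> (Cmod (g t) <= B)%R) ->
  CIs g a b v -> (Cmod v <= (b - a) * B)%R.
Proof.
  intros Hab H Hv. rewrite <- norm_CR.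
  refine (norm_RInt_le_const (V := C_R_NormedModule) g a b v B Hab _ Hv).
  intros t Ht. rewrite norm_CR. auto.
Qed.

Lemma Rder_lipschitz (g dg : R -> C) (a b K : R) :
  (a <= b)%R -> (forall t, (a <= t <= b)%R -> Rder g t (dg t)) ->
  (forall t, (a <= t <= b)%R -> contC dg t) ->
  (forall t, (a <= t <= b)%R -> (Cmod (dg t) <= K)%R) ->
  (Cmod (g b - g a) <= (b - a) * K)%R.
Proof.
  intros Hab H1 H2 H3. eapply CIs_bound; [exact Hab|exact H3|]. apply CI_derive; auto.
Qed.

(** * Goursat's theorem along a homotopy *)

Lemma nested_intervals_point (u v : nat -> R) :
  (forall n, u n <= u (S n))%R -> (forall n, v (S n) <= v n)%R -> (forall n, u n <= v n)%R ->
  exists x, forall n, (u n <= x <= v n)%R.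
Proof.
  intros Hu Hv Huv.
  assert (Hu' : forall n k, (u n <= u (n + k)%nat)%R).
  { intros n k. induction k; [rewrite Nat.add_0_r; lra|]. rewrite Nat.add_succ_r.
    generalize (Hu (n + k)%nat). lra. }
  assert (Hv' : forall n k, (v (n + k)%nat <= v n)%R).
  { intros n k. induction k; [rewrite Nat.add_0_r; lra|]. rewrite Nat.add_succ_r.
    generalize (Hv (n + k)%nat). lra. }
  assert (Hb : forall n m, (u n <= v m)%R).
  { intros n m. generalize (Hu' n m) (Huv (n + m)%nat) (Hv' m n). rewrite (Nat.add_comm m n). lra. }
  destruct (completeness (fun x => exists n, x = u n)) as [x [Hx1 Hx2]].
  - exists (v 0%nat). intros y [n ->]. apply Hb.
  - exists (u 0%nat). exists 0%nat. reflexivity.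
  - exists x. intros n. split.
    + apply Hx1. exists n; reflexivity.
    + apply Hx2. intros y [m ->]. apply Hb.
Qed.

(** One step of Goursat's bisection: the half on which nu keeps at least half
    of its modulus. *)
Definition keep_half (nu : R -> R -> C) (p : R * R) : R * R :=
  let m := ((fst p + snd p) / 2)%R in
  if Rle_dec (Cmod (nu (fst p) (snd p)) / 2) (Cmod (nu (fst p) m)) then (fst p, m) else (m, snd p).

Lemma keep_half_spec (nu : R -> R -> C) (p : R * R) :
  (fst p <= snd p)%R ->
  nu (fst p) (snd p) = nu (fst p) ((fst p + snd p) / 2)%R + nu ((fst p + snd p) / 2)%R (snd p) ->
  let q := keep_half nu p in
  (fst p <= fst q /\ fst q <= snd q /\ snd q <= snd p /\
   snd q - fst q = (snd p - fst p) / 2 /\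
   Cmod (nu (fst p) (snd p)) / 2 <= Cmod (nu (fst q) (snd q)))%R.
Proof.
  intros Hp E. unfold keep_half. destruct (Rle_dec _ _) as [H|H]; simpl.
  - repeat split; lra.
  - assert (H1 := Cmod_triangle (nu (fst p) ((fst p + snd p) / 2)%R) (nu ((fst p + snd p) / 2)%R (snd p))).
    rewrite <- E in H1. repeat split; lra.
Qed.

(** Goursat's argument, freed from integrals. If mu were nonzero on the whole
    rectangle, bisecting in both variables would produce nested rectangles of
    sides 2^-n times the original ones on which |mu| decreases at most like
    4^-n; the quadratic estimate with a small eps at their common point
    contradicts this. *)
Lemma additive_rectangle_zero (mu : R -> R -> R -> R -> C) (a b c d : R) :
  (a <= b)%R -> (c <= d)%R ->
  (forall x1 xm x2 y1 y2, (a <= x1 <= xm)%R -> (xm <= x2 <= b)%R -> (c <= y1)%R -> (y1 <= y2 <= d)%R ->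
     mu x1 x2 y1 y2 = mu x1 xm y1 y2 + mu xm x2 y1 y2) ->
  (forall x1 x2 y1 ym y2, (a <= x1)%R -> (x1 <= x2 <= b)%R -> (c <= y1 <= ym)%R -> (ym <= y2 <= d)%R ->
     mu x1 x2 y1 y2 = mu x1 x2 y1 ym + mu x1 x2 ym y2) ->
  (forall x y eps, (a <= x <= b)%R -> (c <= y <= d)%R -> (0 < eps)%R -> exists del, (0 < del)%R /\
     forall x1 x2 y1 y2, (a <= x1 <= x)%R -> (x <= x2 <= b)%R -> (c <= y1 <= y)%R -> (y <= y2 <= d)%R ->
       (x2 - x1 < del)%R -> (y2 - y1 < del)%R ->
       (Cmod (mu x1 x2 y1 y2) <= eps * ((x2 - x1) + (y2 - y1)) ^ 2)%R) ->
  mu a b c d = 0.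
Proof.
  intros Hab Hcd Hx Hy Hl.
  set (step := fun s : (R * R) * (R * R) =>
    let p := keep_half (fun u v => mu u v (fst (snd s)) (snd (snd s))) (fst s) in
    (p, keep_half (fun u v => mu (fst p) (snd p) u v) (snd s))).
  set (s := fix s n := match n with O => ((a, b), (c, d)) | S n => step (s n) end).
  set (X1 := fun n => fst (fst (s n))). set (X2 := fun n => snd (fst (s n))).
  set (Y1 := fun n => fst (snd (s n))). set (Y2 := fun n => snd (snd (s n))).
  set (N := fun n => Cmod (mu (X1 n) (X2 n) (Y1 n) (Y2 n))).
  assert (Hs : forall n, (a <= X1 n /\ X1 n <= X2 n /\ X2 n <= b /\ c <= Y1 n /\ Y1 n <= Y2 n /\ Y2 n <= d)%R ->
    ((X1 n <= X1 (S n) /\ X1 (S n) <= X2 (S n) /\ X2 (S n) <= X2 n /\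
     Y1 n <= Y1 (S n) /\ Y1 (S n) <= Y2 (S n) /\ Y2 (S n) <= Y2 n) /\
     X2 (S n) - X1 (S n) = (X2 n - X1 n) / 2 /\ Y2 (S n) - Y1 (S n) = (Y2 n - Y1 n) / 2 /\
     N n / 4 <= N (S n))%R).
  { intros n [A1 [A2 [A3 [A4 [A5 A6]]]]].
    destruct (keep_half_spec (fun u v => mu u v (Y1 n) (Y2 n)) (fst (s n))) as [B1 [B2 [B3 [B4 B5]]]].
    { exact A2. }
    { unfold X1, X2 in *. apply Hx; lra. }
    change (keep_half (fun u v => mu u v (Y1 n) (Y2 n)) (fst (s n))) with (fst (s (S n))) in *.
    fold (X1 (S n)) (X2 (S n)) (X1 n) (X2 n) in *.
    destruct (keep_half_spec (fun u v => mu (X1 (S n)) (X2 (S n)) u v) (snd (s n))) as [C1 [C2 [C3 [C4 C5]]]].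
    { exact A5. }
    { unfold Y1, Y2 in *. apply Hy; lra. }
    change (keep_half (fun u v => mu (X1 (S n)) (X2 (S n)) u v) (snd (s n))) with (snd (s (S n))) in *.
    fold (Y1 (S n)) (Y2 (S n)) (Y1 n) (Y2 n) in *.
    fold (N (S n)) in *. fold (N n) in *. repeat split; try lra. }
  assert (Hin : forall n, (a <= X1 n /\ X1 n <= X2 n /\ X2 n <= b /\ c <= Y1 n /\ Y1 n <= Y2 n /\ Y2 n <= d)%R).
  { induction n as [|n IH]; [unfold X1, X2, Y1, Y2; simpl; lra|].
    destruct (Hs n IH) as [H _]. lra. }
  assert (Hsize : forall n, (X2 n - X1 n = (b - a) / 2 ^ n /\ Y2 n - Y1 n = (d - c) / 2 ^ n /\ N 0%nat / 4 ^ n <= N n)%R).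
  { induction n as [|n [I1 [I2 I3]]].
    - unfold X1, X2, Y1, Y2; simpl. repeat split; lra.
    - destruct (Hs n (Hin n)) as [_ [E1 [E2 E3]]]. rewrite E1, E2, I1, I2.
      assert (P2 : (2 ^ n <> 0)%R) by (apply pow_nonzero; lra).
      assert (P4 : (4 ^ n <> 0)%R) by (apply pow_nonzero; lra).
      simpl pow. repeat split; try (field; auto).
      eapply Rle_trans; [|apply E3].
      replace (N 0%nat / (4 * 4 ^ n))%R with (N 0%nat / 4 ^ n / 4)%R by (field; auto). lra. }
  destruct (nested_intervals_point X1 X2) as [x Hxx]; try (intros n; destruct (Hs n (Hin n)) as [H _]; lra).
  destruct (nested_intervals_point Y1 Y2) as [y Hyy]; try (intros n; destruct (Hs n (Hin n)) as [H _]; lra).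
  destruct (Ceq_dec (mu a b c d) 0) as [E|E]; [exact E|exfalso].
  assert (HN : (0 < N 0%nat)%R) by (apply Cmod_gt_0; exact E).
  set (T := ((b - a) + (d - c) + 1)%R).
  assert (HT : (0 < T)%R) by (unfold T; lra).
  assert (He : (0 < N 0%nat / 2 / T ^ 2)%R).
  { apply Rdiv_lt_0_compat; [lra|]. apply pow_lt; auto. }
  destruct (Hl x y _ (conj (Rle_trans _ _ _ (proj1 (Hin 0%nat)) (proj1 (Hxx 0%nat))) (proj2 (Hxx 0%nat)))
     (conj (proj1 (Hyy 0%nat)) (proj2 (Hyy 0%nat))) He) as [del [Hdel Hm]].
  assert (Hn : exists n, (T / 2 ^ n < del)%R).
  { destruct (pow_lt_1_zero (/ 2) ltac:(rewrite Rabs_pos_eq; lra) (del / T)) as [n Hn].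
    { apply Rdiv_lt_0_compat; auto. }
    exists n. specialize (Hn n (Nat.le_refl n)). rewrite Rabs_pos_eq in Hn by (apply pow_le; lra).
    rewrite pow_inv in Hn. unfold Rdiv. apply Rmult_lt_reg_r with (/ T)%R; [apply Rinv_0_lt_compat; auto|].
    replace (T * / 2 ^ n * / T)%R with (/ 2 ^ n)%R; [exact Hn|]. field. split; first [lra | apply pow_nonzero; lra]. }
  destruct Hn as [n Hn].
  destruct (Hsize n) as [S1 [S2 S3]]. assert (Hi := Hin n).
  assert (P2 : (0 < / 2 ^ n)%R) by (apply Rinv_0_lt_compat, pow_lt; lra).
  assert (L1 : (X2 n - X1 n < del)%R).
  { rewrite S1. eapply Rle_lt_trans; [|apply Hn]. unfold Rdiv. apply Rmult_le_compat_r; unfold T; lra. }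
  assert (L2 : (Y2 n - Y1 n < del)%R).
  { rewrite S2. eapply Rle_lt_trans; [|apply Hn]. unfold Rdiv. apply Rmult_le_compat_r; unfold T; lra. }
  generalize (Hxx n) (Hyy n). intros Hxn Hyn.
  specialize (Hm (X1 n) (X2 n) (Y1 n) (Y2 n) ltac:(lra) ltac:(lra) ltac:(lra) ltac:(lra) L1 L2).
  fold (N n) in Hm. rewrite S1, S2 in Hm.
  assert (P4 : (0 < / 4 ^ n)%R) by (apply Rinv_0_lt_compat, pow_lt; lra).
  assert (Q : (N 0%nat / 2 / T ^ 2 * ((b - a) / 2 ^ n + (d - c) / 2 ^ n) ^ 2 <= N 0%nat / 2 / 4 ^ n)%R).
  { replace ((b - a) / 2 ^ n + (d - c) / 2 ^ n)%R with ((T - 1) * / 2 ^ n)%R by (unfold T, Rdiv; ring).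
    replace (N 0%nat / 2 / 4 ^ n)%R with (N 0%nat / 2 / T ^ 2 * (T * / 2 ^ n) ^ 2)%R.
    - apply Rmult_le_compat_l; [lra|]. apply pow_incr. split; [|nra].
      apply Rmult_le_pos; [unfold T|]; lra.
    - replace (4 ^ n)%R with (2 ^ n * 2 ^ n)%R by (rewrite <- Rpow_mult_distr; f_equal; ring).
      field. split; first [lra | apply pow_nonzero; lra]. }
  unfold Rdiv in S3, Q, Hm. nra.
Qed.

(** Near z0, G is affine up to eps |u - z0|. The affine part has the primitive
    H, so each side contributes the increment of H, and these increments cancel
    around a closed contour; only the error term is left. *)
Lemma side_estimate (G : C -> C) (g dg : R -> C) (a b : R) (z0 l : C) (eps dist K : R) :
  (a <= b)%R -> (0 <= eps)%R ->
  (forall t, (a <= t <= b)%R -> Rder g t (dg t)) ->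
  (forall t, (a <= t <= b)%R -> contC dg t) ->
  (forall t, (a <= t <= b)%R -> (Cmod (dg t) <= K)%R) ->
  (forall t, (a <= t <= b)%R -> Cdiff G (g t)) ->
  (forall t, (a <= t <= b)%R -> (Cmod (g t - z0) <= dist)%R) ->
  (forall t, (a <= t <= b)%R -> (Cmod (G (g t) - G z0 - l * (g t - z0)) <= eps * Cmod (g t - z0))%R) ->
  let H := fun u => G z0 * u + l / 2 * ((u - z0) * (u - z0)) in
  (Cmod (CI (fun t => G (g t) * dg t)%C a b - (H (g b) - H (g a))) <= (b - a) * (eps * dist * K))%R.
Proof.
  intros Hab He Hg Cg Bg HG Hd HE H.
  assert (HH : forall u, Cder H u (G z0 + l * (u - z0))).
  { intros u. unfold H. eapply Cder_eq.
    - apply Cder_plus; [apply Cder_mult; [apply Cder_const|apply Cder_id]|].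
      apply Cder_mult; [apply Cder_const|].
      apply Cder_mult; apply Cder_minus; (apply Cder_id || apply Cder_const).
    - cbv beta. field. }
  assert (Cg' : forall t, (a <= t <= b)%R -> contC g t) by (intros; eapply Rder_cont; eauto).
  assert (I1 : CIs (fun t => G (g t) * dg t) a b (CI (fun t => G (g t) * dg t) a b)).
  { apply CI_correct; auto. intros t Ht. apply contC_mult; auto.
    apply (continuous_comp g G); auto. apply Cdiff_cont; auto. }
  assert (I2 : CIs (fun t => (G z0 + l * (g t - z0)) * dg t) a b (H (g b) - H (g a))).
  { apply (CI_derive (fun t => H (g t))); auto.
    - intros t Ht. apply Rder_comp; auto.
    - intros t Ht. apply contC_mult; auto. apply contC_plus; [apply contC_const|].
      apply contC_mult; [apply contC_const|]. apply contC_minus; auto. apply contC_const. }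
  assert (I3 := is_RInt_minus (V := C_R_NormedModule) _ _ _ _ _ _ I1 I2).
  refine (CIs_bound _ a b _ _ Hab _ I3). intros t Ht.
  change (Cmod (G (g t) * dg t - (G z0 + l * (g t - z0)) * dg t) <= eps * dist * K)%R.
  replace (G (g t) * dg t - (G z0 + l * (g t - z0)) * dg t) with
    ((G (g t) - G z0 - l * (g t - z0)) * dg t) by ring.
  rewrite Cmod_mult. apply Rmult_le_compat; try apply Cmod_ge_0; auto.
  eapply Rle_trans; [apply HE; auto|]. apply Rmult_le_compat_l; auto.
Qed.

Lemma CI_Chasles (g : R -> C) (a b c : R) :
  (a <= b <= c)%R -> (forall t, (a <= t <= c)%R -> contC g t) -> CI g a c = CI g a b + CI g b c.
Proof.
  intros Hab H. symmetry. apply (RInt_Chasles (V := C_R_CompleteNormedModule)).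
  - eexists; apply CI_correct; [lra|]; intros; apply H; lra.
  - eexists; apply CI_correct; [lra|]; intros; apply H; lra.
Qed.

(** The form G(z) dz, pulled back to a rectangle by z, is closed although G' is
    not assumed continuous: its boundary integral is additive under bisection
    and, by [side_estimate], quadratically small at every point. The bound K on
    the partial derivatives converts sizes in the rectangle into sizes in the
    image. Working with a homotopy instead of rectangles in the plane gives
    circles directly. *)
Lemma goursat_homotopy (G : C -> C) (z zs zt : R -> R -> C) (a b c d K : R) :
  (a <= b)%R -> (c <= d)%R -> (0 <= K)%R ->
  (forall s t, (a <= s <= b)%R -> (c <= t <= d)%R ->
     Cdiff G (z s t) /\
     Rder (fun s' => z s' t) s (zs s t) /\ Rder (fun t' => z s t') t (zt s t) /\
     contC (fun s' => zs s' t) s /\ contC (fun t' => zt s t') t /\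
     (Cmod (zs s t) <= K)%R /\ (Cmod (zt s t) <= K)%R) ->
  CI (fun s => G (z s c) * zs s c) a b + CI (fun t => G (z b t) * zt b t) c d =
  CI (fun s => G (z s d) * zs s d) a b + CI (fun t => G (z a t) * zt a t) c d.
Proof.
  intros Hab Hcd HK HZ.
  set (A := fun s t => G (z s t) * zs s t). set (B := fun s t => G (z s t) * zt s t).
  set (mu := fun x1 x2 y1 y2 => CI (fun s => A s y1) x1 x2 + CI (B x2) y1 y2
                              - CI (fun s => A s y2) x1 x2 - CI (B x1) y1 y2).
  enough (E : mu a b c d = 0).
  { unfold mu, A, B in E. rewrite <- (Cplus_0_l (_ + CI (fun t => G (z a t) * zt a t) c d)), <- E. ring. }
  assert (CA : forall s t, (a <= s <= b)%R -> (c <= t <= d)%R -> contC (fun s' => A s' t) s).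
  { intros s t Hs Ht. destruct (HZ s t Hs Ht) as [H1 [H2 [H3 [H4 [H5 _]]]]].
    apply contC_mult; auto. apply (continuous_comp (fun s' => z s' t) G).
    - eapply Rder_cont; eauto.
    - apply Cdiff_cont; auto. }
  assert (CB : forall s t, (a <= s <= b)%R -> (c <= t <= d)%R -> contC (B s) t).
  { intros s t Hs Ht. destruct (HZ s t Hs Ht) as [H1 [H2 [H3 [H4 [H5 _]]]]].
    apply contC_mult; auto. apply (continuous_comp (fun t' => z s t') G).
    - eapply Rder_cont; eauto.
    - apply Cdiff_cont; auto. }
  apply additive_rectangle_zero; auto.
  - intros x1 xm x2 y1 y2 P1 P2 P3 P4. unfold mu.
    rewrite (CI_Chasles (fun s => A s y1) x1 xm x2), (CI_Chasles (fun s => A s y2) x1 xm x2);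
      try lra; try (intros; apply CA; lra). ring.
  - intros x1 x2 y1 ym y2 P1 P2 P3 P4. unfold mu.
    rewrite (CI_Chasles (B x1) y1 ym y2), (CI_Chasles (B x2) y1 ym y2);
      try lra; try (intros; apply CB; lra). ring.
  - intros x y eps Hx Hy He.
    destruct (HZ x y Hx Hy) as [[l Hl] _].
    (* the four sides contribute at most 2 D (e1 K D) K, D half their perimeter *)
    set (e1 := (eps / (2 * (K * K + 1)))%R).
    assert (He1 : (0 < e1)%R) by (apply Rdiv_lt_0_compat; nra).
    destruct (Hl e1 He1) as [r [Hr HG]].
    exists (r / (2 * (K + 1)))%R. split; [apply Rdiv_lt_0_compat; lra|].
    intros x1 x2 y1 y2 P1 P2 P3 P4 P5 P6.
    set (D := ((x2 - x1) + (y2 - y1))%R).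
    assert (HD : (0 <= D)%R) by (unfold D; lra).
    assert (LX : forall u v t, (a <= u)%R -> (u <= v <= b)%R -> (c <= t <= d)%R ->
      (Cmod (z v t - z u t) <= (v - u) * K)%R).
    { intros u v t U1 U2 U3. apply (Rder_lipschitz (fun s => z s t) (fun s => zs s t)); try lra;
      intros s Hs; destruct (HZ s t ltac:(lra) U3) as [? [? [? [? [? [? ?]]]]]]; auto. }
    assert (LY : forall u v s, (c <= u)%R -> (u <= v <= d)%R -> (a <= s <= b)%R ->
      (Cmod (z s v - z s u) <= (v - u) * K)%R).
    { intros u v s U1 U2 U3. apply (Rder_lipschitz (fun t => z s t) (fun t => zt s t)); try lra;
      intros t Ht; destruct (HZ s t U3 ltac:(lra)) as [? [? [? [? [? [? ?]]]]]]; auto. }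
    assert (LD : forall s t, (x1 <= s <= x2)%R -> (y1 <= t <= y2)%R -> (Cmod (z s t - z x y) <= K * D)%R).
    { intros s t Hs Ht.
      replace (z s t - z x y) with ((z s t - z x t) + (z x t - z x y)) by ring.
      eapply Rle_trans; [apply Cmod_triangle|].
      assert (Q1 : (Cmod (z s t - z x t) <= (x2 - x1) * K)%R).
      { destruct (Rle_dec x s).
        - eapply Rle_trans; [apply LX; lra|]. apply Rmult_le_compat_r; lra.
        - rewrite Cmod_sub_sym. eapply Rle_trans; [apply LX; lra|]. apply Rmult_le_compat_r; lra. }
      assert (Q2 : (Cmod (z x t - z x y) <= (y2 - y1) * K)%R).
      { destruct (Rle_dec y t).
        - eapply Rle_trans; [apply LY; lra|]. apply Rmult_le_compat_r; lra.
        - rewrite Cmod_sub_sym. eapply Rle_trans; [apply LY; lra|]. apply Rmult_le_compat_r; lra. }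
      unfold D. lra. }
    assert (Hsmall : (K * D < r)%R).
    { assert (DD : (D < r / (K + 1))%R).
      { replace (r / (K + 1))%R with (r / (2 * (K + 1)) + r / (2 * (K + 1)))%R by (field; lra). unfold D. lra. }
      apply Rle_lt_trans with ((K + 1) * D)%R; [nra|].
      apply Rmult_lt_reg_l with (/ (K + 1))%R; [apply Rinv_0_lt_compat; lra|].
      rewrite <- Rmult_assoc, Rinv_l, Rmult_1_l by lra. rewrite Rmult_comm. exact DD. }
    assert (HE : forall s t, (x1 <= s <= x2)%R -> (y1 <= t <= y2)%R ->
      (Cmod (G (z s t) - G (z x y) - l * (z s t - z x y)) <= e1 * Cmod (z s t - z x y))%R).
    { intros s t Hs Ht. apply HG. eapply Rle_lt_trans; [apply LD; auto|exact Hsmall]. }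
    set (H := fun u => G (z x y) * u + l / 2 * ((u - z x y) * (u - z x y))).
    assert (SX : forall t, (y1 <= t <= y2)%R ->
      (Cmod (CI (fun s => A s t) x1 x2 - (H (z x2 t) - H (z x1 t))) <= (x2 - x1) * (e1 * (K * D) * K))%R).
    { intros t Ht. apply (side_estimate G (fun s => z s t) (fun s => zs s t)); try lra; auto;
      intros s Hs; destruct (HZ s t ltac:(lra) ltac:(lra)) as [? [? [? [? [? [? ?]]]]]]; auto. }
    assert (SY : forall s, (x1 <= s <= x2)%R ->
      (Cmod (CI (B s) y1 y2 - (H (z s y2) - H (z s y1))) <= (y2 - y1) * (e1 * (K * D) * K))%R).
    { intros s Hs. apply (side_estimate G (fun t => z s t) (fun t => zt s t)); try lra; auto;
      intros t Ht; destruct (HZ s t ltac:(lra) ltac:(lra)) as [? [? [? [? [? [? ?]]]]]]; auto. }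
    assert (S1 := SX y1 ltac:(lra)). assert (S2 := SX y2 ltac:(lra)).
    assert (S3 := SY x1 ltac:(lra)). assert (S4 := SY x2 ltac:(lra)).
    unfold mu.
    match goal with |- (Cmod ?e <= _)%R =>
      replace e with (((CI (fun s => A s y1) x1 x2 - (H (z x2 y1) - H (z x1 y1)))
         + (CI (B x2) y1 y2 - (H (z x2 y2) - H (z x2 y1))))
         - ((CI (fun s => A s y2) x1 x2 - (H (z x2 y2) - H (z x1 y2)))
         + (CI (B x1) y1 y2 - (H (z x1 y2) - H (z x1 y1))))) by ring end.
    eapply Rle_trans; [apply Cmod_sub_le|].
    eapply Rle_trans; [apply Rplus_le_compat; apply Cmod_triangle|].
    apply Rle_trans with (2 * (D * (e1 * (K * D) * K)))%R; [unfold D in *; lra|].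
    replace (2 * (D * (e1 * (K * D) * K)))%R with ((2 * (K * K) * e1) * D ^ 2)%R by ring.
    apply Rmult_le_compat_r; [apply pow2_ge_0|].
    unfold e1. apply Rmult_le_reg_r with (K * K + 1)%R; [nra|].
    replace (2 * (K * K) * (eps / (2 * (K * K + 1))) * (K * K + 1))%R with (K * K * eps)%R by (field; nra). nra.
Qed.

(** * The complex exponential and means over circles *)

Definition Cexp (z : C) : C := ((exp (Re z) * cos (Im z))%R, (exp (Re z) * sin (Im z))%R).

Lemma Cexp_plus (a b : C) : Cexp (a + b) = Cexp a * Cexp b.
Proof.
  destruct a as [a1 a2], b as [b1 b2]. unfold Cexp, Cmult, Cplus, Re, Im; simpl.
  rewrite exp_plus, cos_plus, sin_plus. f_equal; ring.
Qed.

Lemma Cexp_0 : Cexp 0 = 1.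
Proof. unfold Cexp, Re, Im; simpl. rewrite exp_0, cos_0, sin_0. unfold RtoC. f_equal; ring. Qed.

Lemma Cexp_neq_0 (z : C) : Cexp z <> 0.
Proof.
  intros E. assert (H := Cexp_plus z (- z)). rewrite E, Cplus_opp_r, Cexp_0, Cmult_0_l in H.
  apply C1_nz, H.
Qed.

Lemma Cexp_opp (z : C) : Cexp (- z) = / Cexp z.
Proof.
  assert (N := Cexp_neq_0 z).
  replace (Cexp (- z)) with (Cexp (z + - z) / Cexp z) by (rewrite Cexp_plus; field; auto).
  rewrite Cplus_opp_r, Cexp_0. field; auto.
Qed.

Lemma Cmod_Cexp (z : C) : Cmod (Cexp z) = exp (Re z).
Proof.
  unfold Cexp, Cmod; simpl.
  replace (_ + _)%R with (exp (Re z) ^ 2 * (Rsqr (sin (Im z)) + Rsqr (cos (Im z))))%R by (unfold Rsqr; ring).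
  rewrite sin2_cos2, Rmult_1_r. apply sqrt_pow2. left; apply exp_pos.
Qed.

Lemma Cmod_le_abs (z : C) : (Cmod z <= Rabs (Re z) + Rabs (Im z))%R.
Proof.
  replace z with (RtoC (Re z) + Ci * RtoC (Im z)) at 1.
  - eapply Rle_trans; [apply Cmod_triangle|]. rewrite Cmod_mult, Cmod_Ci, !Cmod_R. lra.
  - destruct z as [x y]. unfold RtoC, Ci, Cmult, Cplus, Re, Im; simpl. f_equal; ring.
Qed.

Lemma im_le_Cmod (z : C) : (Rabs (Im z) <= Cmod z)%R.
Proof. eapply Rle_trans; [|apply Rmax_Cmod]. apply Rmax_r. Qed.

Lemma derivable_pt_lim_0_linear (f : R -> R) (l eps : R) :
  derivable_pt_lim f 0 l -> (0 < eps)%R ->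
  exists d, (0 < d)%R /\ forall h, (Rabs h < d)%R -> (Rabs (f h - f 0 - l * h) <= eps * Rabs h)%R.
Proof.
  intros H He. destruct (H eps He) as [d Hd]. exists d; split; [apply cond_pos|]. intros h Hh.
  destruct (Req_dec h 0) as [->|N].
  - replace (f 0 - f 0 - l * 0)%R with 0%R by ring. rewrite Rabs_R0. lra.
  - specialize (Hd h N Hh). rewrite Rplus_0_l in Hd.
    replace (f h - f 0 - l * h)%R with (((f h - f 0) / h - l) * h)%R by (field; auto).
    rewrite Rabs_mult. apply Rmult_le_compat_r; [apply Rabs_pos|]. left; exact Hd.
Qed.

(** The real and imaginary parts of exp(z) - 1 - z are controlled by the first
    order expansions of exp, cos and sin at 0. *)
Lemma Cder_Cexp_0 : Cder Cexp 0 1.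
Proof.
  intros eps0 He0. set (eps := (Rmin 1 (eps0 / 8))%R).
  assert (He : (0 < eps)%R) by (apply Rmin_pos; lra).
  assert (He1 : (eps <= 1)%R) by apply Rmin_l. assert (He8 : (eps <= eps0 / 8)%R) by apply Rmin_r.
  destruct (derivable_pt_lim_0_linear exp 1 eps derivable_pt_lim_exp_0 He) as [d1 [P1 H1]].
  assert (Dc : derivable_pt_lim cos 0 0).
  { generalize (derivable_pt_lim_cos 0). rewrite sin_0, Ropp_0. auto. }
  assert (Ds : derivable_pt_lim sin 0 1).
  { generalize (derivable_pt_lim_sin 0). rewrite cos_0. auto. }
  destruct (derivable_pt_lim_0_linear cos 0 eps Dc He) as [d2 [P2 H2]].
  destruct (derivable_pt_lim_0_linear sin 1 eps Ds He) as [d3 [P3 H3]].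
  exists (Rmin (Rmin d1 (eps / 2)) (Rmin d2 d3)). split; [repeat apply Rmin_pos; lra|].
  intros z Hz. replace (z - 0) with z in * by ring. rewrite Cexp_0.
  assert (Q1 := Rmin_l (Rmin d1 (eps / 2)) (Rmin d2 d3)). assert (Q2 := Rmin_r (Rmin d1 (eps / 2)) (Rmin d2 d3)).
  assert (Q3 := Rmin_l d1 (eps / 2)). assert (Q4 := Rmin_r d1 (eps / 2)).
  assert (Q5 := Rmin_l d2 d3). assert (Q6 := Rmin_r d2 d3).
  assert (Bx := re_le_Cmod z). assert (By := im_le_Cmod z).
  set (x := Re z) in *. set (y := Im z) in *.
  specialize (H1 x ltac:(lra)). specialize (H2 y ltac:(lra)). specialize (H3 y ltac:(lra)).
  rewrite exp_0 in H1. rewrite cos_0 in H2. rewrite sin_0 in H3.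
  replace (Cexp z - 1 - 1 * z) with
    (((exp x - 1 - 1 * x) + exp x * (cos y - 1 - 0 * y))%R,
     (exp x * (sin y - 0 - 1 * y) + (exp x - 1) * y)%R).
  2:{ unfold x, y, Cexp, RtoC, Cmult, Cminus, Cplus, Copp, Re, Im; simpl. f_equal; ring. }
  eapply Rle_trans; [apply Cmod_le_abs|]. unfold Re, Im; simpl.
  assert (E1 : (Rabs (exp x - 1) <= eps)%R).
  { replace (exp x - 1)%R with ((exp x - 1 - 1 * x) + x)%R by ring.
    eapply Rle_trans; [apply Rabs_triang|]. nra. }
  assert (E2 : (exp x <= 2)%R) by (generalize (Rle_abs (exp x - 1)); lra).
  assert (E3 := exp_pos x).
  eapply Rle_trans; [apply Rplus_le_compat; apply Rabs_triang|]. rewrite !Rabs_mult, (Rabs_pos_eq (exp x)) by lra.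
  assert (A1 := Rabs_pos x). assert (A2 := Rabs_pos y).
  assert (A3 : (exp x * Rabs (cos y - 1 - 0 * y) <= 2 * (eps * Rabs y))%R).
  { apply Rmult_le_compat; try lra. apply Rabs_pos. }
  assert (A4 : (exp x * Rabs (sin y - 0 - 1 * y) <= 2 * (eps * Rabs y))%R).
  { apply Rmult_le_compat; try lra. apply Rabs_pos. }
  assert (A5 : (Rabs (exp x - 1) * Rabs y <= eps * Rabs y)%R) by (apply Rmult_le_compat_r; lra).
  assert (A6 : (eps * Rabs x <= eps * Cmod z)%R) by (apply Rmult_le_compat_l; lra).
  assert (A7 : (eps * Rabs y <= eps * Cmod z)%R) by (apply Rmult_le_compat_l; lra).
  assert (A8 : (6 * (eps * Cmod z) <= eps0 * Cmod z)%R) by (generalize (Cmod_ge_0 z); nra).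
  lra.
Qed.

Lemma Cder_Cexp (z : C) : Cder Cexp z (Cexp z).
Proof.
  apply (Cder_ext_loc (fun y => Cexp z * Cexp (y - z)) Cexp z _ 1); [lra| |].
  - intros y _. rewrite <- Cexp_plus. f_equal. ring.
  - eapply Cder_eq.
    + apply Cder_mult; [apply Cder_const|]. apply (Cder_comp Cexp (fun y => y - z)).
      * apply Cder_minus; [apply Cder_id|apply Cder_const].
      * replace (z - z) with (RtoC 0) by ring. apply Cder_Cexp_0.
    + cbv beta. ring.
Qed.

Definition cis (t : R) : C := (cos t, sin t).

Lemma cis_Cexp (t : R) : cis t = Cexp (0 + RtoC t * Ci).
Proof.
  unfold cis, Cexp, RtoC, Ci, Cmult, Cplus, Re, Im; simpl.
  replace (0 + (t * 0 - 0 * 1))%R with 0%R by ring. replace (0 + (t * 1 + 0 * 0))%R with t by ring.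
  rewrite exp_0. f_equal; ring.
Qed.

Lemma Rder_cis (t : R) : Rder cis t (cis t * Ci).
Proof.
  apply (is_derive_ext (V := C_R_NormedModule) (fun s => Cexp (0 + RtoC s * Ci))).
  - intros s. symmetry. apply cis_Cexp.
  - rewrite cis_Cexp. apply (Rder_comp Cexp (fun s => 0 + RtoC s * Ci)).
    + apply Cder_Cexp.
    + apply Rder_affine.
Qed.

Lemma contC_cis (t : R) : contC cis t.
Proof. eapply Rder_cont, Rder_cis. Qed.

Lemma Cmod_cis (t : R) : Cmod (cis t) = 1%R.
Proof.
  unfold cis, Cmod; simpl. rewrite !Rmult_1_r, Rplus_comm.
  generalize (sin2_cos2 t). unfold Rsqr. intros ->. apply sqrt_1.
Qed.

Lemma cis_conj (t : R) : cis t * Cconj (cis t) = 1.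
Proof. rewrite <- Cmod2_conj, Cmod_cis. f_equal. ring. Qed.

Lemma cis_neq_0 (t : R) : cis t <> 0.
Proof. intros E. generalize (Cmod_cis t). rewrite E, Cmod_0. lra. Qed.

Lemma cis_conj_inv (t : R) : Cconj (cis t) = / cis t.
Proof.
  assert (N := cis_neq_0 t).
  replace (/ cis t) with (cis t * Cconj (cis t) / cis t) by (rewrite cis_conj; field; auto).
  field; auto.
Qed.

Definition mean (g : R -> C) : C := RtoC (/ (2 * PI)) * CI g 0 (2 * PI).

Lemma two_PI_pos : (0 < 2 * PI)%R.
Proof. generalize PI_RGT_0; lra. Qed.

Lemma mean_of_CIs (g : R -> C) (v : C) :
  CIs g 0 (2 * PI) v -> mean g = RtoC (/ (2 * PI)) * v.
Proof. intros H. unfold mean. rewrite (CI_unique _ _ _ _ H). reflexivity. Qed.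

Lemma CIs_mean (g : R -> C) : (forall t, contC g t) -> CIs g 0 (2 * PI) (RtoC (2 * PI) * mean g).
Proof.
  intros H. assert (P := two_PI_pos). unfold mean.
  rewrite Cmult_assoc, <- RtoC_mult, Rinv_r, Cmult_1_l by lra. apply CI_correct; auto. lra.
Qed.

Lemma mean_intro (g : R -> C) (v : C) : CIs g 0 (2 * PI) (RtoC (2 * PI) * v) -> mean g = v.
Proof.
  intros H. assert (P := two_PI_pos). rewrite (mean_of_CIs _ _ H).
  rewrite Cmult_assoc, <- RtoC_mult, Rinv_l, Cmult_1_l by lra. reflexivity.
Qed.

Lemma mean_ext (f g : R -> C) : (forall t, f t = g t) -> mean f = mean g.
Proof.
  intros H. unfold mean. f_equal. apply (RInt_ext (V := C_R_CompleteNormedModule)). intros; apply H.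
Qed.

Lemma mean_const (c : C) : mean (fun _ => c) = c.
Proof.
  apply mean_intro.
  assert (H := is_RInt_const (V := C_R_NormedModule) 0 (2 * PI) c).
  rewrite scal_R_Cmult, Rminus_0_r in H. exact H.
Qed.

Lemma mean_plus (f g : R -> C) : (forall t, contC f t) -> (forall t, contC g t) ->
  mean (fun t => f t + g t) = mean f + mean g.
Proof.
  intros Hf Hg. apply mean_intro. rewrite Cmult_plus_distr_l.
  exact (is_RInt_plus (V := C_R_NormedModule) _ _ _ _ _ _ (CIs_mean f Hf) (CIs_mean g Hg)).
Qed.

Lemma mean_mult (c : C) (g : R -> C) : (forall t, contC g t) -> mean (fun t => c * g t) = c * mean g.
Proof.
  intros Hg. apply mean_intro. replace (RtoC (2 * PI) * (c * mean g)) with (c * (RtoC (2 * PI) * mean g)) by ring.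
  apply CIs_mult, CIs_mean, Hg.
Qed.

Lemma mean_minus (f g : R -> C) : (forall t, contC f t) -> (forall t, contC g t) ->
  mean (fun t => f t - g t) = mean f - mean g.
Proof.
  intros Hf Hg. rewrite (mean_ext _ (fun t => f t + (-(1)) * g t)) by (intros; ring).
  rewrite mean_plus, mean_mult; auto; [ring|].
  intros t. apply contC_mult; auto. apply contC_const.
Qed.

Lemma mean_conj (g : R -> C) : (forall t, contC g t) -> mean (fun t => Cconj (g t)) = Cconj (mean g).
Proof.
  intros Hg. apply mean_intro.
  replace (RtoC (2 * PI) * Cconj (mean g)) with (Cconj (RtoC (2 * PI) * mean g)).
  - apply CIs_conj, CIs_mean, Hg.
  - rewrite Cmult_conj. f_equal. unfold Cconj, RtoC; simpl. f_equal. ring.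
Qed.

Lemma mean_bound (g : R -> C) (B : R) : (forall t, contC g t) ->
  (forall t, (0 <= t <= 2 * PI)%R -> (Cmod (g t) <= B)%R) -> (Cmod (mean g) <= B)%R.
Proof.
  intros Hc Hg. assert (P := two_PI_pos).
  assert (H := CIs_bound g 0 (2 * PI) B _ ltac:(lra) Hg (CIs_mean g Hc)).
  rewrite Cmod_mult, Cmod_R, Rabs_pos_eq, Rminus_0_r in H by lra.
  apply Rmult_le_reg_l with (2 * PI)%R; auto.
Qed.

Lemma mean_Re_nonneg (g : R -> C) : (forall t, contC g t) ->
  (forall t, (0 <= Re (g t))%R) -> (0 <= Re (mean g))%R.
Proof.
  intros Hc Hg. assert (P := two_PI_pos).
  assert (H := is_RInt_fct_extend_fst (U := R_NormedModule) (V := R_NormedModule) g _ _ _ (CIs_mean g Hc)).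
  assert (H0 : (0 <= fst (RtoC (2 * PI) * mean g)%C)%R).
  { refine (is_RInt_le (fun _ => 0%R) (fun t => fst (g t)) 0 (2 * PI) 0 _ ltac:(lra) _ H _).
    - assert (H1 := is_RInt_const (V := R_NormedModule) 0 (2 * PI) 0%R).
      refine (eq_rect _ (fun v => is_RInt (fun _ => 0%R) 0 (2 * PI) v) H1 _ _). apply Rmult_0_r.
    - intros t _. apply Hg. }
  change (0 <= Re (RtoC (2 * PI) * mean g))%R in H0.
  rewrite re_scal_l in H0. nra.
Qed.

Lemma contC_circle (f : C -> C) (r : R) : (0 < r)%R ->
  (forall u, (Cmod u <= r)%R -> Cdiff f u) -> forall t, contC (fun t => f (RtoC r * cis t)) t.
Proof.
  intros Hr Hf t. apply (continuous_comp (fun t => RtoC r * cis t) f).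
  - apply contC_mult; [apply contC_const|apply contC_cis].
  - apply Cdiff_cont, Hf. rewrite Cmod_mult, Cmod_cis, Cmod_R, Rabs_pos_eq; lra.
Qed.

Lemma Cmod_circle (r t : R) : (0 < r)%R -> Cmod (RtoC r * cis t) = r.
Proof. intros Hr. rewrite Cmod_mult, Cmod_cis, Cmod_R, Rabs_pos_eq; lra. Qed.

Lemma contC_w (r : R) (t : R) : contC (fun t => RtoC r * cis t) t.
Proof. apply contC_mult; [apply contC_const|apply contC_cis]. Qed.

Lemma circle_sub_ge (r t : R) (z : C) : (Cmod z < r)%R -> (r - Cmod z <= Cmod (RtoC r * cis t - z))%R.
Proof.
  intros Hz. assert (Hr : (0 < r)%R) by (generalize (Cmod_ge_0 z); lra).
  generalize (Cmod_sub_ge (RtoC r * cis t) z). rewrite Cmod_circle by auto. lra.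
Qed.

Lemma circle_sub_neq_0 (r t : R) (z : C) : (Cmod z < r)%R -> RtoC r * cis t - z <> 0.
Proof.
  intros Hz E. generalize (circle_sub_ge r t z Hz). rewrite E, Cmod_0. lra.
Qed.

Lemma Cplus_cancel_l (a b c : C) : a + b = a + c -> b = c.
Proof. intros E. replace b with (a + b - a) by ring. rewrite E. ring. Qed.

(** The circle is contracted towards z. The form f(u) du / (u - z) is holomorphic
    along the way because e > 0 keeps the homotopy off z, and the sides at the
    angles 0 and 2 PI of the parameter rectangle cancel. Along
    u = z + s (w - z) the factor s of du cancels the one in u - z, so the kernel
    w / (w - z) does not depend on s. *)
Lemma cauchy_homotopy (f : C -> C) (r e : R) (z : C) :
  (Cmod z < r)%R -> (0 < e <= 1)%R ->
  (forall u, (Cmod u <= r)%R -> Cdiff f u) ->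
  mean (fun t => f (z + RtoC 1 * (RtoC r * cis t - z)) * (RtoC r * cis t / (RtoC r * cis t - z))) =
  mean (fun t => f (z + RtoC e * (RtoC r * cis t - z)) * (RtoC r * cis t / (RtoC r * cis t - z))).
Proof.
  intros Hz He Hf. assert (Hr : (0 < r)%R) by (generalize (Cmod_ge_0 z); lra).
  set (w := fun t => RtoC r * cis t).
  assert (Hw : forall t, Cmod (w t) = r) by (intros; apply Cmod_circle; auto).
  assert (Hn : forall t, w t - z <> 0) by (intros; apply circle_sub_neq_0; auto).
  set (G := fun u => f u / (u - z)).
  set (p := fun s t => z + RtoC s * (w t - z)).
  assert (Dw : forall t, Rder w t (w t * Ci)).
  { intros t. unfold w. replace (RtoC r * cis t * Ci) with (RtoC r * (cis t * Ci)) by ring.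
    apply (Rder_comp (fun u => RtoC r * u) cis); [|apply Rder_cis].
    eapply Cder_eq; [apply Cder_mult; [apply Cder_const|apply Cder_id]|cbv beta; ring]. }
  assert (Cw : forall t, contC w t) by (intros t; eapply Rder_cont, Dw).
  assert (HG : forall s t, (e <= s <= 1)%R -> Cdiff G (p s t)).
  { intros s t Hs. unfold G, p. apply Cdiff_div.
    - replace (z + s * (w t - z) - z) with (RtoC s * (w t - z)) by ring.
      apply Cmult_neq_0; auto. intros Q; apply RtoC_inj in Q; lra.
    - apply Hf. replace (z + s * (w t - z)) with (RtoC (1 - s) * z + RtoC s * w t) by (rewrite RtoC_minus; ring).
      eapply Rle_trans; [apply Cmod_triangle|]. rewrite !Cmod_mult, !Cmod_R, Hw, !Rabs_pos_eq by lra. nra.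
    - apply Cdiff_minus; [apply Cdiff_id|apply Cdiff_const]. }
  assert (GH := goursat_homotopy G p (fun s t => w t - z) (fun s t => RtoC s * (w t * Ci))
     e 1 0 (2 * PI) (2 * r)).
  lapply GH; [clear GH; intros GH|lra].
  lapply GH; [clear GH; intros GH|generalize two_PI_pos; lra].
  lapply GH; [clear GH; intros GH|lra].
  lapply GH; [clear GH; intros GH|].
  - assert (E2 : w (2 * PI)%R = w 0%R).
    { unfold w, cis. rewrite cos_2PI, sin_2PI, cos_0, sin_0. reflexivity. }
    unfold p in GH. rewrite E2 in GH.
    match type of GH with ?a + ?b = ?a + ?c =>
      assert (E := Cplus_cancel_l a b c GH) end.
    fold p in E. clear GH.
    assert (X : forall s, (e <= s <= 1)%R ->
      mean (fun t => f (z + RtoC s * (RtoC r * cis t - z)) * (RtoC r * cis t / (RtoC r * cis t - z))) =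
      RtoC (/ (2 * PI)) * (/ Ci * CI (fun t => G (z + RtoC s * (w t - z)) * (RtoC s * (w t * Ci)))%C 0 (2 * PI))).
    { intros s Hs. apply mean_of_CIs.
      apply (is_RInt_ext (V := C_R_NormedModule)
        (fun t => / Ci * (G (z + RtoC s * (w t - z)) * (RtoC s * (w t * Ci))))).
      - intros t _. unfold G. fold (w t).
        assert (Hs0 : RtoC s <> 0) by (intros Q; apply RtoC_inj in Q; lra).
        match goal with |- ?a = ?b => change (@eq C a b) end.
        field. repeat split; auto; try apply Ci_nz.
        replace (z + s * (w t - z) - z) with (RtoC s * (w t - z)) by ring. apply Cmult_neq_0; auto.
      - apply CIs_mult, CI_correct; [generalize two_PI_pos; lra|]. intros t _.
        assert (Cp : contC (fun t => z + RtoC s * (w t - z)) t).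
        { apply contC_plus; [apply contC_const|]. apply contC_mult; [apply contC_const|].
          apply contC_minus; [apply Cw|apply contC_const]. }
        apply contC_mult.
        + apply (continuous_comp (fun t => z + RtoC s * (w t - z)) G); auto.
          apply Cdiff_cont, (HG s t Hs).
        + apply contC_mult; [apply contC_const|]. apply contC_mult; [apply Cw|apply contC_const]. }
    rewrite (X 1%R), (X e) by lra. do 2 f_equal. exact E.
  - intros s t Hs Ht.
    assert (Bz : (Cmod (w t - z) <= 2 * r)%R).
    { eapply Rle_trans; [apply Cmod_sub_le|]. rewrite Hw. lra. }
    split; [|split; [|split; [|split; [|split; [|split]]]]].
    + apply HG, Hs.
    + apply Rder_affine.
    + unfold p. apply (Rder_comp (fun u => z + RtoC s * (u - z)) w); auto.
      eapply Cder_eq.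
      * apply Cder_plus; [apply Cder_const|]. apply Cder_mult; [apply Cder_const|].
        apply Cder_minus; [apply Cder_id|apply Cder_const].
      * cbv beta. ring.
    + apply contC_const.
    + apply contC_mult; [apply contC_const|]. apply contC_mult; [apply Cw|apply contC_const].
    + exact Bz.
    + rewrite !Cmod_mult, Hw, Cmod_Ci, Cmod_R, Rabs_pos_eq by lra. nra.
Qed.

(** * Cauchy's formula and Cauchy integrals *)

Lemma Cmod_eps_0 (a : C) (B : R) : (forall eps, (0 < eps)%R -> (Cmod a <= eps * B)%R) -> a = 0.
Proof.
  intros H. apply Cmod_eq_0. apply Rle_antisym; [|apply Cmod_ge_0].
  destruct (Rle_dec B 0) as [HB|HB].
  - specialize (H 1%R Rlt_0_1). lra.
  - apply le_epsilon. intros e He. specialize (H (e / B)%R ltac:(apply Rdiv_lt_0_compat; lra)).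
    replace (e / B * B)%R with e in H by (field; lra). lra.
Qed.

Lemma contC_kernel (r : R) (z : C) : (Cmod z < r)%R ->
  forall t, contC (fun t => RtoC r * cis t / (RtoC r * cis t - z)) t.
Proof.
  intros Hz t. apply contC_div; [apply circle_sub_neq_0; auto|apply contC_w|].
  apply contC_minus; [apply contC_w|apply contC_const].
Qed.

Lemma Cmod_kernel (r t : R) (z : C) : (Cmod z < r)%R ->
  (Cmod (RtoC r * cis t / (RtoC r * cis t - z)) <= r / (r - Cmod z))%R.
Proof.
  intros Hz. assert (Hr : (0 < r)%R) by (generalize (Cmod_ge_0 z); lra).
  rewrite Cmod_div by (apply circle_sub_neq_0; auto). rewrite Cmod_circle by auto.
  apply Rmult_le_compat_l; [lra|]. apply Rinv_le_contravar; [lra|]. apply circle_sub_ge; auto.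
Qed.

(** Letting the contracted circle shrink to z in [cauchy_homotopy] replaces f
    by its value at z. *)
Lemma cauchy_factor (f : C -> C) (r : R) (z : C) :
  (Cmod z < r)%R -> (forall u, (Cmod u <= r)%R -> Cdiff f u) ->
  mean (fun t => f (RtoC r * cis t) * (RtoC r * cis t / (RtoC r * cis t - z))) =
  f z * mean (fun t => RtoC r * cis t / (RtoC r * cis t - z)).
Proof.
  intros Hz Hf. assert (Hr : (0 < r)%R) by (generalize (Cmod_ge_0 z); lra).
  set (K := fun t => RtoC r * cis t / (RtoC r * cis t - z)).
  assert (CK : forall t, contC K t) by (apply contC_kernel; auto).
  apply Ceq_minus. apply (Cmod_eps_0 _ (r / (r - Cmod z))). intros eps He.
  destruct (proj1 (contC_at _ _) (Cdiff_cont f z (Hf z (Rlt_le _ _ Hz))) eps He) as [d [Hd Hy]].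
  (* the contracted circle lies within 2 e r of z *)
  set (e := Rmin 1 (d / (4 * r))).
  assert (He1 : (0 < e <= 1)%R).
  { split; [apply Rmin_pos; [lra|apply Rdiv_lt_0_compat; lra]|apply Rmin_l]. }
  assert (He2 : (e * (2 * r) < d)%R).
  { apply Rle_lt_trans with (d / (4 * r) * (2 * r))%R.
    - apply Rmult_le_compat_r; [lra|apply Rmin_r].
    - replace (d / (4 * r) * (2 * r))%R with (d / 2)%R by (field; lra). lra. }
  rewrite (mean_ext _ (fun t => f (z + RtoC 1 * (RtoC r * cis t - z)) * K t)).
  2:{ intros t. unfold K. f_equal. f_equal. ring. }
  unfold K at 1. rewrite (cauchy_homotopy f r e z Hz He1 Hf). fold K.
  assert (Cp : forall t, contC (fun t => f (z + RtoC e * (RtoC r * cis t - z))) t).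
  { intros t. apply (continuous_comp (fun t => z + RtoC e * (RtoC r * cis t - z)) f).
    - apply contC_plus; [apply contC_const|]. apply contC_mult; [apply contC_const|].
      apply contC_minus; [apply contC_w|apply contC_const].
    - apply Cdiff_cont, Hf.
      replace (z + e * (r * cis t - z)) with (RtoC (1 - e) * z + RtoC e * (RtoC r * cis t)) by (rewrite RtoC_minus; ring).
      eapply Rle_trans; [apply Cmod_triangle|].
      rewrite (Cmod_mult (RtoC e)), Cmod_circle, Cmod_mult, !Cmod_R, !Rabs_pos_eq by lra. nra. }
  rewrite <- mean_mult by auto. rewrite <- mean_minus.
  - rewrite (mean_ext _ (fun t => (f (z + RtoC e * (RtoC r * cis t - z)) - f z) * K t)) by (intros; unfold K; ring).
    apply mean_bound.
    + intros t. apply contC_mult; auto. apply contC_minus; auto. apply contC_const.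
    + intros t _. rewrite Cmod_mult. apply Rmult_le_compat; try apply Cmod_ge_0; [|apply Cmod_kernel; auto].
      left; apply Hy.
      replace (z + e * (r * cis t - z) - z) with (RtoC e * (RtoC r * cis t - z)) by ring.
      rewrite Cmod_mult, Cmod_R, Rabs_pos_eq by lra. eapply Rle_lt_trans; [|apply He2].
      apply Rmult_le_compat_l; [lra|]. eapply Rle_trans; [apply Cmod_sub_le|].
      rewrite Cmod_circle by auto. lra.
  - intros t. apply contC_mult; auto.
  - intros t. apply contC_mult; auto. apply contC_const.
Qed.

Lemma mean_value (f : C -> C) (r : R) : (0 < r)%R ->
  (forall u, (Cmod u <= r)%R -> Cdiff f u) -> mean (fun t => f (RtoC r * cis t)) = f 0.
Proof.
  intros Hr Hf. assert (H := cauchy_factor f r 0 ltac:(rewrite Cmod_0; auto) Hf).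
  assert (E : forall t, RtoC r * cis t / (RtoC r * cis t - 0) = 1).
  { intros t. field. split; [apply cis_neq_0|]. intros Q; apply RtoC_inj in Q; lra. }
  rewrite (mean_ext _ (fun t => f (RtoC r * cis t))) in H by (intros; rewrite E; ring).
  rewrite H, (mean_ext _ (fun _ => RtoC 1)) by (intros; apply E). rewrite mean_const. ring.
Qed.

(** On the circle w conj(w) = r^2, so w / (w - z) is the conjugate of
    1 / (1 - conj(z) w / r^2). That function is holomorphic on the closed disc,
    and its mean is its value 1 at the center. *)
Lemma mean_kernel (r : R) (z : C) : (Cmod z < r)%R ->
  mean (fun t => RtoC r * cis t / (RtoC r * cis t - z)) = 1.
Proof.
  intros Hz. assert (Hr : (0 < r)%R) by (generalize (Cmod_ge_0 z); lra).
  set (h := fun u => 1 / (1 - Cconj z * u / RtoC (r * r))).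
  assert (Hrr : RtoC (r * r) <> 0) by (intros Q; apply RtoC_inj in Q; nra).
  assert (Hn : forall u, (Cmod u <= r)%R -> 1 - Cconj z * u / RtoC (r * r) <> 0).
  { intros u Hu E. assert (E1 : Cconj z * u = RtoC (r * r)).
    { replace (RtoC (r * r)) with (RtoC (r * r) * (1 - (1 - Cconj z * u / RtoC (r * r)))) at 1.
      - field; auto.
      - rewrite E. ring. }
    apply (f_equal Cmod) in E1. rewrite Cmod_mult, Cmod_conj, Cmod_R, Rabs_pos_eq in E1 by nra.
    generalize (Cmod_ge_0 z) (Cmod_ge_0 u). nra. }
  assert (H := mean_value h r Hr).
  lapply H; [clear H; intros H|].
  - rewrite (mean_ext _ (fun t => Cconj (h (RtoC r * cis t)))).
    + rewrite mean_conj, H.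
      * unfold h. replace (Cconj z * 0 / RtoC (r * r)) with (RtoC 0) by (field; auto).
        replace (1 / (1 - 0)) with (RtoC 1) by (field; intros Q; apply RtoC_inj in Q; lra).
        unfold Cconj, RtoC; simpl. f_equal. ring.
      * apply contC_circle; auto. intros u Hu. unfold h. apply Cdiff_div; auto.
        -- apply Cdiff_const.
        -- apply Cdiff_minus; [apply Cdiff_const|]. apply Cdiff_mult; [|apply Cdiff_const].
           apply Cdiff_mult; [apply Cdiff_const|apply Cdiff_id].
    + intros t. unfold h.
      assert (Hc := Hn (RtoC r * cis t) ltac:(rewrite Cmod_circle; lra)).
      rewrite Cdiv_conj, Cminus_conj by auto. rewrite Cdiv_conj, !Cmult_conj, Cconj_conj by auto.
      rewrite !Cconj_RtoC, cis_conj_inv, RtoC_mult.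
      assert (Hw := circle_sub_neq_0 r t z Hz).
      assert (R0 : RtoC r <> 0) by (apply RtoC_neq_0; lra).
      field. split; [apply cis_neq_0|split; auto]. rewrite (Cmult_comm (cis t)); auto.
  - intros u Hu. unfold h. apply Cdiff_div; auto.
    + apply Cdiff_const.
    + apply Cdiff_minus; [apply Cdiff_const|]. apply Cdiff_mult; [|apply Cdiff_const].
      apply Cdiff_mult; [apply Cdiff_const|apply Cdiff_id].
Qed.

Lemma cauchy_formula (f : C -> C) (r : R) (z : C) :
  (Cmod z < r)%R -> (forall u, (Cmod u <= r)%R -> Cdiff f u) ->
  f z = mean (fun t => f (RtoC r * cis t) * (RtoC r * cis t / (RtoC r * cis t - z))).
Proof.
  intros Hz Hf. rewrite cauchy_factor, mean_kernel by auto. ring.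
Qed.

Definition cauchy_int (phi : R -> C) (r : R) (k : nat) (z : C) : C :=
  mean (fun t => phi t / (RtoC r * cis t - z) ^ k).

Lemma Cder_quadratic (f : C -> C) (z l : C) (K d : R) : (0 < d)%R ->
  (forall y, (Cmod (y - z) < d)%R -> (Cmod (f y - f z - l * (y - z)) <= K * Cmod (y - z) ^ 2)%R) ->
  Cder f z l.
Proof.
  intros Hd H eps He.
  exists (Rmin d (eps / (Rabs K + 1))). assert (HK := Rabs_pos K).
  split; [apply Rmin_pos; auto; apply Rdiv_lt_0_compat; lra|].
  intros y Hy. eapply Rle_trans; [apply H; eapply Rlt_le_trans; [apply Hy|apply Rmin_l]|].
  assert (H1 : (Cmod (y - z) < eps / (Rabs K + 1))%R) by (eapply Rlt_le_trans; [apply Hy|apply Rmin_r]).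
  replace (K * Cmod (y - z) ^ 2)%R with (K * Cmod (y - z) * Cmod (y - z))%R by ring.
  apply Rmult_le_compat_r; [apply Cmod_ge_0|].
  assert (H2 : ((Rabs K + 1) * Cmod (y - z) < eps)%R).
  { apply Rmult_lt_reg_l with (/ (Rabs K + 1))%R; [apply Rinv_0_lt_compat; lra|].
    rewrite <- Rmult_assoc, Rinv_l, Rmult_1_l by lra. rewrite Rmult_comm. exact H1. }
  generalize (Cmod_ge_0 (y - z)) (Rle_abs K). nra.
Qed.

Lemma contC_cauchy (phi : R -> C) (r : R) (z : C) (k : nat) : (Cmod z < r)%R ->
  (forall t, contC phi t) -> forall t, contC (fun t => phi t / (RtoC r * cis t - z) ^ k) t.
Proof.
  intros Hz Hp t. apply contC_div; auto.
  - apply Cpow_nz, circle_sub_neq_0; auto.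
  - apply (contC_pow (fun t => RtoC r * cis t - z)). apply contC_minus; [apply contC_w|apply contC_const].
Qed.

(** With a = w - z and h = y - z, 1/(a-h) - 1/a - h/a^2 = h^2 / (a^2 (a-h)), and
    the denominators stay away from 0 while y is at distance d from the circle. *)
Lemma cauchy_int_derive1 (phi : R -> C) (r B : R) (z : C) : (Cmod z < r)%R ->
  (forall t, contC phi t) -> (forall t, (0 <= t <= 2 * PI)%R -> (Cmod (phi t) <= B)%R) ->
  Cder (cauchy_int phi r 1) z (cauchy_int phi r 2 z).
Proof.
  intros Hz Hc HB. set (d := ((r - Cmod z) / 2)%R). assert (Hd : (0 < d)%R) by (unfold d; lra).
  apply (Cder_quadratic _ _ _ (B / d ^ 3) d Hd). intros y Hy.
  assert (Hyr : (Cmod y < r - d)%R).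
  { replace y with ((y - z) + z) by ring. eapply Rle_lt_trans; [apply Cmod_triangle|]. unfold d in *; lra. }
  assert (Hyr' : (Cmod y < r)%R) by lra.
  unfold cauchy_int.
  assert (C1 := contC_cauchy phi r y 1 Hyr' Hc). assert (C2 := contC_cauchy phi r z 1 Hz Hc).
  assert (C3 := contC_cauchy phi r z 2 Hz Hc).
  rewrite (Cmult_comm (mean _)), <- mean_mult, <- !mean_minus; auto.
  2:{ intros t; apply contC_minus; auto. }
  2:{ intros t; apply contC_mult; auto. apply contC_const. }
  rewrite (mean_ext _ (fun t => (y - z) ^ 2 * (phi t / ((RtoC r * cis t - y) * (RtoC r * cis t - z) ^ 2)))).
  2:{ intros t. assert (N1 := circle_sub_neq_0 r t z Hz). assert (N2 := circle_sub_neq_0 r t y Hyr').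
      simpl Cpow. field. auto. }
  apply mean_bound.
  { intros t. apply contC_mult; [apply contC_const|]. apply contC_div; auto.
    - apply Cmult_neq_0; [apply circle_sub_neq_0; auto|apply Cpow_nz, circle_sub_neq_0; auto].
    - apply contC_mult; [|apply (contC_pow (fun t => RtoC r * cis t - z))];
      (apply contC_minus; [apply contC_w|apply contC_const]). }
  intros t Ht. rewrite Cmod_mult, Cmod_pow, Rmult_comm. apply Rmult_le_compat_r; [apply pow2_ge_0|].
  assert (N1 := circle_sub_neq_0 r t z Hz). assert (N2 := circle_sub_neq_0 r t y Hyr').
  assert (B1 := circle_sub_ge r t z Hz). assert (B2 := circle_sub_ge r t y Hyr').
  rewrite Cmod_div by (apply Cmult_neq_0; auto; apply Cpow_nz; auto).
  rewrite Cmod_mult, Cmod_pow.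
  apply Rmult_le_compat; auto; [apply Cmod_ge_0| |].
  { left; apply Rinv_0_lt_compat, Rmult_lt_0_compat; [lra|]. apply pow_lt. lra. }
  apply Rinv_le_contravar; [apply pow_lt; auto|].
  replace (d ^ 3)%R with (d * d ^ 2)%R by ring. apply Rmult_le_compat; [lra|apply pow2_ge_0|lra|].
  apply pow_incr. unfold d in *; lra.
Qed.

Lemma cauchy_int_derive2 (phi : R -> C) (r B : R) (z : C) : (Cmod z < r)%R ->
  (forall t, contC phi t) -> (forall t, (0 <= t <= 2 * PI)%R -> (Cmod (phi t) <= B)%R) ->
  Cder (cauchy_int phi r 2) z (2 * cauchy_int phi r 3 z).
Proof.
  intros Hz Hc HB. set (d := ((r - Cmod z) / 2)%R). assert (Hd : (0 < d)%R) by (unfold d; lra).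
  apply (Cder_quadratic _ _ _ (B * (3 / d ^ 4 + 2 * d / d ^ 5)) d Hd). intros y Hy.
  assert (Hyr : (Cmod y < r - d)%R).
  { replace y with ((y - z) + z) by ring. eapply Rle_lt_trans; [apply Cmod_triangle|]. unfold d in *; lra. }
  assert (Hyr' : (Cmod y < r)%R) by lra.
  unfold cauchy_int.
  assert (C1 := contC_cauchy phi r y 2 Hyr' Hc). assert (C2 := contC_cauchy phi r z 2 Hz Hc).
  assert (C3 := contC_cauchy phi r z 3 Hz Hc).
  replace (2 * mean (fun t => phi t / (r * cis t - z) ^ 3) * (y - z)) with
    ((2 * (y - z)) * mean (fun t => phi t / (r * cis t - z) ^ 3)) by ring.
  rewrite <- mean_mult, <- !mean_minus; auto.
  2:{ intros t; apply contC_minus; auto. }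
  2:{ intros t; apply contC_mult; auto. apply contC_const. }
  (* with a = w - z and h = y - z: 1/(a-h)^2 - 1/a^2 - 2h/a^3 = h^2 (3/(a^2 (a-h)^2) - 2h/(a^3 (a-h)^2)) *)
  rewrite (mean_ext _ (fun t => (y - z) ^ 2 * (phi t * (3 / ((RtoC r * cis t - y) ^ 2 * (RtoC r * cis t - z) ^ 2)
     - 2 * (y - z) / ((RtoC r * cis t - y) ^ 2 * (RtoC r * cis t - z) ^ 3))))).
  2:{ intros t. assert (N1 := circle_sub_neq_0 r t z Hz). assert (N2 := circle_sub_neq_0 r t y Hyr').
      simpl Cpow. field. auto. }
  assert (Cp : forall k m t, contC (fun t => (RtoC r * cis t - y) ^ k * (RtoC r * cis t - z) ^ m) t).
  { intros k m t. apply contC_mult.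
    - apply (contC_pow (fun t => RtoC r * cis t - y)). apply contC_minus; [apply contC_w|apply contC_const].
    - apply (contC_pow (fun t => RtoC r * cis t - z)). apply contC_minus; [apply contC_w|apply contC_const]. }
  assert (Np : forall k m t, (RtoC r * cis t - y) ^ k * (RtoC r * cis t - z) ^ m <> 0).
  { intros k m t. apply Cmult_neq_0; apply Cpow_nz, circle_sub_neq_0; auto. }
  assert (Bp : forall k m t, (/ Cmod ((RtoC r * cis t - y) ^ k * (RtoC r * cis t - z) ^ m) <= / d ^ (k + m))%R).
  { intros k m t. apply Rinv_le_contravar; [apply pow_lt; auto|].
    rewrite Cmod_mult, !Cmod_pow, pow_add.
    assert (B1 := circle_sub_ge r t z Hz). assert (B2 := circle_sub_ge r t y Hyr').
    apply Rmult_le_compat; try (left; apply pow_lt; lra); apply pow_incr; unfold d in *; lra. }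
  apply mean_bound.
  { intros t. apply contC_mult; [apply contC_const|]. apply contC_mult; auto.
    apply contC_minus; apply contC_div; auto; apply contC_const. }
  intros t Ht. rewrite Cmod_mult, Cmod_pow, Rmult_comm. apply Rmult_le_compat_r; [apply pow2_ge_0|].
  rewrite Cmod_mult. apply Rmult_le_compat; auto; try apply Cmod_ge_0.
  eapply Rle_trans; [apply Cmod_sub_le|]. rewrite !Cmod_div by apply Np.
  rewrite (Cmod_mult 2), !Cmod_R, !Rabs_pos_eq by lra.
  apply Rplus_le_compat; apply Rmult_le_compat; try lra; try apply (Bp 2%nat 2%nat); try apply (Bp 2%nat 3%nat);
    try (left; apply Rinv_0_lt_compat, Cmod_gt_0, Np).
  all: generalize (Cmod_ge_0 (y - z)); lra.
Qed.

(** * Holomorphic functions on a disc *)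

Lemma contC_bounded (g : R -> C) (a b : R) : (a <= b)%R -> (forall t, contC g t) ->
  exists B, forall t, (a <= t <= b)%R -> (Cmod (g t) <= B)%R.
Proof.
  intros Hab Hg.
  destruct (continuity_ab_maj (fun t => Cmod (g t)) a b Hab) as [m [Hm _]].
  - intros t _. apply continuity_pt_filterlim. apply filterlim_locally. intros eps.
    destruct (proj1 (contC_R g t) (Hg t) eps (cond_pos eps)) as [d [Hd H]].
    exists (mkposreal d Hd). intros s Hs. specialize (H s Hs).
    apply Rabs_def1; unfold minus, plus, opp; simpl.
    + generalize (Cmod_sub_ge (g s) (g t)). lra.
    + generalize (Cmod_sub_ge (g t) (g s)). rewrite (Cmod_sub_sym (g t)). lra.
  - exists (Cmod (g m)). exact Hm.
Qed.

Definition Hol (rho : R) (f : C -> C) : Prop := forall z, (Cmod z < rho)%R -> Cdiff f z.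

Lemma Hol_closed (rho r : R) (f : C -> C) : (r < rho)%R -> Hol rho f ->
  forall u, (Cmod u <= r)%R -> Cdiff f u.
Proof. intros Hr Hf u Hu. apply Hf. lra. Qed.

Lemma near_lt (r : R) (z y : C) : (Cmod (y - z) < r - Cmod z)%R -> (Cmod y < r)%R.
Proof.
  intros H. replace y with ((y - z) + z) by ring. eapply Rle_lt_trans; [apply Cmod_triangle|]. lra.
Qed.

(** f is the Cauchy integral with exponent 1 of its values on a circle, so f'
    is the one with exponent 2, which is differentiable in turn. *)
Lemma Hol_derive (rho : R) (f : C -> C) : Hol rho f -> Hol rho (C_derive f).
Proof.
  intros Hf z Hz. set (r := ((Cmod z + rho) / 2)%R).
  assert (Hr : (Cmod z < r < rho)%R) by (unfold r; lra).
  assert (Hr0 : (0 < r)%R) by (generalize (Cmod_ge_0 z); lra).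
  assert (Hc := Hol_closed rho r f (proj2 Hr) Hf).
  set (phi := fun t => f (RtoC r * cis t) * (RtoC r * cis t)).
  assert (Cp : forall t, contC phi t).
  { intros t. apply contC_mult; [apply contC_circle; auto|apply contC_w]. }
  destruct (contC_bounded phi 0 (2 * PI) ltac:(generalize two_PI_pos; lra) Cp) as [B HB].
  assert (E : forall y, (Cmod y < r)%R -> cauchy_int phi r 1 y = f y).
  { intros y Hy. rewrite (cauchy_formula f r y Hy Hc). apply mean_ext. intros t.
    unfold phi. rewrite Cpow_1_r. field. apply circle_sub_neq_0; auto. }
  apply (Cdiff_ext_loc (cauchy_int phi r 2) _ z (r - Cmod z)); [lra| |].
  - intros y Hy. assert (Hyr := near_lt _ _ _ Hy). symmetry. apply Cder_C_derive.
    apply (Cder_ext_loc (cauchy_int phi r 1) _ y _ (r - Cmod y)); [lra| |].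
    + intros u Hu. apply E. apply near_lt with y. exact Hu.
    + apply cauchy_int_derive1 with B; auto.
  - eexists. apply cauchy_int_derive2 with B; auto; lra.
Qed.

(** The value at 0 fills the removable singularity. Iterating this operator
    produces Taylor expansions whose remainders are again holomorphic on the
    whole disc. *)
Definition slope_at_0 (f : C -> C) (z : C) : C :=
  if Ceq_dec z 0 then C_derive f 0 else (f z - f 0) / z.

Lemma slope_at_0_eq (f : C -> C) (z : C) : f z = f 0 + z * slope_at_0 f z.
Proof.
  unfold slope_at_0. destruct (Ceq_dec z 0) as [->|N]; [ring|]. field; auto.
Qed.

Lemma slope_at_0_0 (f : C -> C) : slope_at_0 f 0 = C_derive f 0.
Proof. unfold slope_at_0. destruct (Ceq_dec 0 0); tauto. Qed.

(** Subtracting the mean value f(0) from Cauchy's formula turns the kernel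
    w / (w - z) into z / (w - z). So near 0 the slope is a Cauchy integral with
    exponent 1. *)
Lemma Hol_slope_at_0 (rho : R) (f : C -> C) : Hol rho f -> Hol rho (slope_at_0 f).
Proof.
  intros Hf z Hz. assert (Hm := Cmod_ge_0 z).
  destruct (Ceq_dec z 0) as [->|N].
  - rewrite Cmod_0 in Hz. set (r := (rho / 2)%R). assert (Hr : (0 < r < rho)%R) by (unfold r; lra).
    assert (Hc := Hol_closed rho r f (proj2 Hr) Hf).
    set (phi := fun t => f (RtoC r * cis t)).
    assert (Cp : forall t, contC phi t) by (apply contC_circle; tauto).
    destruct (contC_bounded phi 0 (2 * PI) ltac:(generalize two_PI_pos; lra) Cp) as [B HB].
    assert (H0 : (Cmod 0 < r)%R) by (rewrite Cmod_0; tauto).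
    assert (D1 := cauchy_int_derive1 phi r B 0 H0 Cp HB).
    assert (E : forall y, (Cmod y < r)%R -> f y = f 0 + y * cauchy_int phi r 1 y).
    { intros y Hy. rewrite <- (mean_value f r) by tauto. rewrite (cauchy_formula f r y Hy Hc).
      unfold cauchy_int. fold phi.
      assert (C1 := contC_cauchy phi r y 1 Hy Cp).
      rewrite <- mean_mult, <- mean_plus; auto.
      - apply mean_ext. intros t. unfold phi. rewrite Cpow_1_r. field. apply circle_sub_neq_0; auto.
      - intros t. apply contC_mult; auto. apply contC_const. }
    assert (E0 : C_derive f 0 = cauchy_int phi r 1 0).
    { apply Cder_C_derive. apply (Cder_ext_loc (fun y => f 0 + y * cauchy_int phi r 1 y) _ _ _ r); [tauto| |].
      - intros y Hy. symmetry. apply E. replace y with (y - 0) by ring. exact Hy.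
      - eapply Cder_eq.
        + apply Cder_plus; [apply Cder_const|]. apply Cder_mult; [apply Cder_id|apply D1].
        + cbv beta. ring. }
    apply (Cdiff_ext_loc (cauchy_int phi r 1) _ 0 r); [tauto| |eexists; apply D1].
    intros y Hy. replace (y - 0) with y in Hy by ring. unfold slope_at_0.
    destruct (Ceq_dec y 0) as [->|N]; [symmetry; exact E0|]. rewrite (E y Hy). field; auto.
  - apply (Cdiff_ext_loc (fun y => (f y - f 0) / y) _ z (Cmod z)).
    + apply Cmod_gt_0; auto.
    + intros y Hy. unfold slope_at_0. destruct (Ceq_dec y 0) as [->|N']; auto.
      exfalso. replace (0 - z) with (- z) in Hy by ring. rewrite Cmod_opp in Hy. lra.
    + apply Cdiff_div; auto; [|apply Cdiff_id]. apply Cdiff_minus; [apply Hf; auto|apply Cdiff_const].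
Qed.

Lemma is_series_eps (a : nat -> C) (l : C) :
  is_series a l <-> forall eps, (0 < eps)%R -> exists N, forall n, (N <= n)%nat -> (Cmod (sum_n a n - l) < eps)%R.
Proof.
  unfold is_series. apply (filterlim_C_Cmod eventually).
Qed.

Lemma is_series_geom_bound (a : nat -> C) (l : C) (B q : R) : (0 <= q < 1)%R ->
  (forall n, (Cmod (sum_n a n - l) <= B * q ^ n)%R) -> is_series a l.
Proof.
  intros Hq H. apply is_series_eps. intros eps He.
  assert (HB := Rabs_pos B).
  destruct (pow_lt_1_zero q ltac:(rewrite Rabs_pos_eq; lra) (eps / (Rabs B + 1))%R) as [N HN].
  { apply Rdiv_lt_0_compat; lra. }
  exists N. intros n Hn. specialize (HN n Hn). rewrite Rabs_pos_eq in HN by (apply pow_le; lra).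
  eapply Rle_lt_trans; [apply H|].
  assert (H2 : ((Rabs B + 1) * q ^ n < eps)%R).
  { apply Rmult_lt_reg_l with (/ (Rabs B + 1))%R; [apply Rinv_0_lt_compat; lra|].
    rewrite <- Rmult_assoc, Rinv_l, Rmult_1_l by lra. rewrite Rmult_comm. exact HN. }
  assert (Hp : (0 <= q ^ n)%R) by (apply pow_le; lra).
  generalize (Rle_abs B). nra.
Qed.

Definition taylor_coeff (f : C -> C) (r : R) (n : nat) : C :=
  mean (fun t => f (RtoC r * cis t) / (RtoC r * cis t) ^ n).

(** Expanding the kernel w / (w - z) into a finite geometric sum leaves the mean
    of f(w) (z/w)^(n+1) w / (w - z), of size (|z| / r)^(n+1). *)
Lemma taylor_series (f : C -> C) (rho r : R) (z : C) :
  (r < rho)%R -> Hol rho f -> (Cmod z < r)%R ->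
  is_series (fun n => taylor_coeff f r n * z ^ n) (f z).
Proof.
  intros Hr Hf Hz. assert (Hm := Cmod_ge_0 z). assert (Hr0 : (0 < r)%R) by lra.
  assert (Hc := Hol_closed rho r f Hr Hf).
  set (w := fun t => RtoC r * cis t).
  assert (Nw : forall t, w t <> 0).
  { intros t E. generalize (Cmod_circle r t Hr0). fold (w t). rewrite E, Cmod_0. lra. }
  assert (Nz : forall t, w t - z <> 0) by (intros; apply circle_sub_neq_0; auto).
  assert (Cp : forall t, contC (fun t => f (w t)) t) by (apply contC_circle; auto).
  assert (Cw : forall t, contC w t) by (intros; apply contC_w).
  assert (Cn : forall n t, contC (fun t => f (w t) / w t ^ n) t).
  { intros n t. apply contC_div; auto; [apply Cpow_nz; auto|]. apply (contC_pow w); auto. }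
  destruct (contC_bounded _ 0 (2 * PI) ltac:(generalize two_PI_pos; lra) Cp) as [B HB].
  assert (S : forall n, f z - sum_n (fun n => taylor_coeff f r n * z ^ n) n =
     mean (fun t => f (w t) * (z / w t) ^ (S n) * (w t / (w t - z)))).
  { assert (CK : forall n t, contC (fun t => f (w t) * (z / w t) ^ n * (w t / (w t - z))) t).
    { intros n t. apply contC_mult; [|apply contC_kernel; auto]. apply contC_mult; auto.
      apply (contC_pow (fun t => z / w t)). apply contC_div; auto. apply contC_const. }
    assert (Step : forall n, mean (fun t => f (w t) * (z / w t) ^ n * (w t / (w t - z))) - taylor_coeff f r n * z ^ n
      = mean (fun t => f (w t) * (z / w t) ^ (S n) * (w t / (w t - z)))).
    { intros n. unfold taylor_coeff. fold w. rewrite (Cmult_comm _ (z ^ n)), <- mean_mult, <- mean_minus; auto.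
      - apply mean_ext. intros t. fold (w t). rewrite Cpow_S. unfold Cdiv. rewrite !Cpow_mult_l, Cpow_inv by auto.
        field. repeat split; auto. apply Cpow_nz; auto.
      - intros t. apply contC_mult; auto. apply contC_const. }
    induction n as [|n IH].
    - rewrite sum_O. rewrite <- Step. f_equal. rewrite (cauchy_formula f r z Hz Hc).
      apply mean_ext. intros t. fold (w t). simpl Cpow. ring.
    - rewrite sum_Sn. rewrite <- Step, <- IH.
      match goal with |- _ - plus ?a ?b = _ => change (plus a b) with (a + b) end. ring. }
  apply is_series_geom_bound with (B * (r / (r - Cmod z)))%R (Cmod z / r)%R.
  - split; [apply Rdiv_le_0_compat; lra|]. apply Rmult_lt_reg_r with r; auto.
    unfold Rdiv. rewrite Rmult_assoc, Rinv_l by lra. lra.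
  - intros n. rewrite Cmod_sub_sym, S.
    assert (q0 : (0 <= Cmod z / r)%R) by (apply Rdiv_le_0_compat; lra).
    assert (q1 : (Cmod z / r <= 1)%R).
    { apply Rmult_le_reg_r with r; auto. unfold Rdiv. rewrite Rmult_assoc, Rinv_l by lra. lra. }
    apply mean_bound.
    + intros t. apply contC_mult; [|apply contC_kernel; auto]. apply contC_mult; auto.
      apply (contC_pow (fun t => z / w t)). apply contC_div; auto. apply contC_const.
    + intros t Ht. rewrite !Cmod_mult, Cmod_pow, (Cmod_div z) by auto.
      unfold w at 2. rewrite Cmod_circle by auto.
      replace (B * (r / (r - Cmod z)) * (Cmod z / r) ^ n)%R with (B * (Cmod z / r) ^ n * (r / (r - Cmod z)))%R by ring.
      assert (P := pow_le _ n q0).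
      apply Rmult_le_compat; [|apply Cmod_ge_0| |apply Cmod_kernel; auto].
      * apply Rmult_le_pos; [apply Cmod_ge_0|apply pow_le; auto].
      * apply Rmult_le_compat; auto; [apply Cmod_ge_0|apply pow_le; auto|]. simpl. nra.
Qed.

(** * Functions with positive real part *)

(** The right-hand side is the mean of Re p |Q|^2 over the circle of radius r,
    for Q = x0 + x1 e + x2 e^2 on the unit circle. In p |Q|^2 the negative
    frequencies come from the first terms of p only, since z^3 p3 outweighs the
    factor e^-2. So p |Q|^2 = H + conj(K) with H and K holomorphic, and its mean
    is H(0) + conj(K(0)). *)
Lemma caratheodory_form_r (p1 p2 : C) (p3 : C -> C) (r : R) (x0 x1 x2 : C) :
  (0 < r < 1)%R -> Hol 1 p3 ->
  (forall z, (Cmod z < 1)%R -> (0 <= Re (1 + p1 * z + p2 * (z * z) + z * z * z * p3 z))%R) ->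
  (0 <= Re (x0 * Cconj x0 + x1 * Cconj x1 + x2 * Cconj x2
            + RtoC r * (p1 * (Cconj x1 * x0 + Cconj x2 * x1)) + RtoC (r * r) * (p2 * (Cconj x2 * x0))))%R.
Proof.
  intros Hr H3 Hp.
  assert (R0 : RtoC r <> 0) by (apply RtoC_neq_0; lra).
  set (p := fun z => 1 + p1 * z + p2 * (z * z) + z * z * z * p3 z).
  set (Q := fun e => x0 + x1 * e + x2 * (e * e)).
  set (s0 := x0 * Cconj x0 + x1 * Cconj x1 + x2 * Cconj x2).
  set (s1 := x1 * Cconj x0 + x2 * Cconj x1). set (s2 := x2 * Cconj x0).
  set (t1 := Cconj x1 * x0 + Cconj x2 * x1). set (t2 := Cconj x2 * x0).
  (* H collects the frequencies e^k with k >= 0 of p |Q|^2, K the conjugates of the others *)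
  set (H := fun z => p z * (s0 + s1 * (z / RtoC r) + s2 * ((z / RtoC r) * (z / RtoC r)))
       + t1 * (p1 * RtoC r + p2 * RtoC r * z + RtoC r * (z * z) * p3 z)
       + t2 * (p2 * (RtoC r * RtoC r) + RtoC r * RtoC r * z * p3 z)).
  set (K := fun z => s1 * (z / RtoC r) + s2 * ((z / RtoC r) * (z / RtoC r)) + s2 * Cconj p1 * z).
  assert (Dl : forall z, Cdiff (fun z => z / RtoC r) z).
  { intros z. apply Cdiff_div; auto; [apply Cdiff_id|apply Cdiff_const]. }
  assert (Dp : Hol 1 p).
  { intros z Hz. unfold p. repeat first [apply Cdiff_plus|apply Cdiff_mult|apply Cdiff_const|apply Cdiff_id|apply H3; auto]. }
  assert (DH : Hol 1 H).
  { intros z Hz. unfold H.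
    repeat first [apply Dl|apply Dp; auto|apply Cdiff_plus|apply Cdiff_mult|apply Cdiff_const|apply Cdiff_id|apply H3; auto]. }
  assert (DK : Hol 1 K).
  { intros z Hz. unfold K.
    repeat first [apply Dl|apply Cdiff_plus|apply Cdiff_mult|apply Cdiff_const|apply Cdiff_id]. }
  assert (CH : forall t, contC (fun t => H (RtoC r * cis t)) t).
  { apply contC_circle; [lra|]. apply (Hol_closed 1); auto; lra. }
  assert (CK : forall t, contC (fun t => K (RtoC r * cis t)) t).
  { apply contC_circle; [lra|]. apply (Hol_closed 1); auto; lra. }
  assert (E : forall t, p (RtoC r * cis t) * (Q (cis t) * Cconj (Q (cis t))) =
     H (RtoC r * cis t) + Cconj (K (RtoC r * cis t))).
  { intros t. assert (N := cis_neq_0 t). unfold K, H, Q, s0, s1, s2, t1, t2.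
    rewrite !Cplus_conj, !Cmult_conj, !Cdiv_conj, !Cplus_conj, !Cmult_conj, !Cconj_RtoC, !Cconj_conj, cis_conj_inv by auto.
    unfold p. field. auto. }
  assert (M : mean (fun t => p (RtoC r * cis t) * (Q (cis t) * Cconj (Q (cis t)))) = H 0 + Cconj (K 0)).
  { rewrite (mean_ext _ _ E), mean_plus, mean_conj; auto.
    - rewrite (mean_value H r), (mean_value K r); auto; try lra; apply (Hol_closed 1); auto; lra.
    - intros t. apply contC_conj; auto. }
  assert (P : (0 <= Re (mean (fun t => p (RtoC r * cis t) * (Q (cis t) * Cconj (Q (cis t))))%C))%R).
  { apply mean_Re_nonneg.
    - intros t. apply (continuous_ext (U := C_UniformSpace)
        (fun t => H (RtoC r * cis t) + Cconj (K (RtoC r * cis t)))).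
      + intros s; symmetry; apply E.
      + apply contC_plus; auto. apply contC_conj; auto.
    - intros t. rewrite <- Cmod2_conj, re_scal_r. apply Rmult_le_pos; [|apply pow2_ge_0].
      apply Hp. rewrite Cmod_circle; lra. }
  rewrite M in P. unfold K, H, p in P.
  replace (_ + _) with (s0 + RtoC r * (p1 * t1) + RtoC (r * r) * (p2 * t2)) in P; [exact P|].
  rewrite RtoC_mult.
  replace (s1 * (0 / r) + s2 * (0 / r * (0 / r)) + s2 * Cconj p1 * 0) with (RtoC 0) by (field; auto).
  rewrite Cconj_RtoC. field. auto.
Qed.

Lemma quadratic_limit_nonneg (a b c : R) :
  (forall r, (0 < r < 1)%R -> (0 <= a + r * b + r * r * c)%R) -> (0 <= a + b + c)%R.
Proof.
  intros H. apply Rnot_lt_le. intros N.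
  set (m := (Rabs b + 2 * Rabs c + 1)%R).
  assert (B := Rabs_pos b). assert (Cc := Rabs_pos c).
  set (e := Rmin (1 / 2) (- (a + b + c) / (2 * m))).
  assert (Hm : (0 < m)%R) by (unfold m; lra).
  assert (He : (0 < e <= 1 / 2)%R).
  { split; [apply Rmin_pos; [lra|apply Rdiv_lt_0_compat; lra]|apply Rmin_l]. }
  assert (He2 : (e * m <= - (a + b + c) / 2)%R).
  { apply Rle_trans with (- (a + b + c) / (2 * m) * m)%R; [apply Rmult_le_compat_r; [lra|apply Rmin_r]|].
    right. field. lra. }
  specialize (H (1 - e)%R ltac:(lra)).
  replace (a + (1 - e) * b + (1 - e) * (1 - e) * c)%R with (a + b + c - e * b - e * (2 - e) * c)%R in H by ring.
  assert (X1 : (- (e * b) <= e * Rabs b)%R) by (generalize (Rle_abs (- b)); rewrite Rabs_Ropp; nra).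
  assert (X2 : (- (e * (2 - e) * c) <= e * 2 * Rabs c)%R).
  { assert ((- c <= Rabs c)%R) by (generalize (Rle_abs (- c)); rewrite Rabs_Ropp; lra).
    assert ((0 <= e * (2 - e))%R) by nra. assert (e * (2 - e) <= e * 2)%R by nra. nra. }
  unfold m in He2. nra.
Qed.

(** Positivity of the Toeplitz form of p, obtained as r tends to 1. *)
Lemma caratheodory_form (p1 p2 : C) (p3 : C -> C) (x0 x1 x2 : C) :
  Hol 1 p3 ->
  (forall z, (Cmod z < 1)%R -> (0 <= Re (1 + p1 * z + p2 * (z * z) + z * z * z * p3 z))%R) ->
  (0 <= Re (x0 * Cconj x0 + x1 * Cconj x1 + x2 * Cconj x2
            + p1 * (Cconj x1 * x0 + Cconj x2 * x1) + p2 * (Cconj x2 * x0)))%R.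
Proof.
  intros H3 Hp. rewrite (re_plus (_ + _) (p2 * _)), (re_plus (_ + _ + _) (p1 * _)).
  apply quadratic_limit_nonneg. intros r Hr.
  assert (P := caratheodory_form_r p1 p2 p3 r x0 x1 x2 Hr H3 Hp).
  rewrite (re_plus (_ + _) (RtoC (r * r) * _)), (re_plus (_ + _ + _) (RtoC r * _)), !re_scal_l in P.
  exact P.
Qed.

(** The classical inequality |p2 - p1^2/2| <= 2 - |p1|^2/2, for p1 = 2c and
    p2 = 2b. Minimizing the Toeplitz form over x1 leaves
    (1 - |c|^2)(|x0|^2 + |x2|^2) + 2 Re((b - c^2) x0 conj(x2)), and it remains
    to take x0 = 1 and x2 opposite to the direction of b - c^2. *)
Lemma caratheodory_second (c b : C) (p3 : C -> C) :
  Hol 1 p3 ->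
  (forall z, (Cmod z < 1)%R -> (0 <= Re (1 + 2 * c * z + 2 * b * (z * z) + z * z * z * p3 z))%R) ->
  (Cmod (b - c * c) <= 1 - Cmod c ^ 2)%R.
Proof.
  intros H3 Hp. set (v := b - c * c).
  (* x1 = - (c x0 + conj(c) x2) minimizes the form, here with x0 = 1 *)
  assert (F : forall x2, (0 <= (1 - Cmod c ^ 2) * (1 + Cmod x2 ^ 2) + 2 * Re (v * Cconj x2))%R).
  { intros x2. refine (Rle_trans _ _ _ (caratheodory_form _ _ p3 1 (- (c + Cconj c * x2)) x2 H3 Hp) _).
    right. unfold v. rewrite !Cmod2_alt.
    destruct c as [c1 c2], b as [b1 b2], x2 as [u1 u2].
    unfold Re, Im, RtoC, Cconj, Cmult, Cplus, Copp, Cminus; simpl. ring. }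
  destruct (Ceq_dec v 0) as [E|N].
  - rewrite E, Cmod_0. generalize (F 0). rewrite Cmod_0.
    replace (v * Cconj 0) with (RtoC 0) by (rewrite Cconj_RtoC; ring). rewrite re_RtoC. lra.
  - assert (Hv := proj1 (Cmod_gt_0 _) N).
    specialize (F (- (v / RtoC (Cmod v)))).
    assert (R0 : RtoC (Cmod v) <> 0) by (apply RtoC_neq_0; lra).
    rewrite Cmod_opp, Cmod_div, Cmod_R, Rabs_pos_eq in F by (auto; lra).
    replace (Cmod v / Cmod v)%R with 1%R in F by (field; lra).
    rewrite Copp_conj, Cdiv_conj, Cconj_RtoC in F by auto.
    replace (v * - (Cconj v / RtoC (Cmod v))) with (RtoC (- Cmod v)) in F.
    + rewrite re_RtoC in F. lra.
    + rewrite RtoC_opp. replace (v * - (Cconj v / RtoC (Cmod v))) with (- (v * Cconj v / RtoC (Cmod v))) by (field; auto).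
      rewrite <- Cmod2_conj. rewrite RtoC_pow. simpl Cpow. field; auto.
Qed.

Lemma toeplitz_real_bound (t : R) : (0 <= t <= 1)%R -> (t / 16 + (t / 48 + (1 - t) / 6) ^ 2 <= 145 / 2304)%R.
Proof. intros Ht. nra. Qed.

(** The two squares are those of Gamma_1 and Gamma_2, expressed in c = 2 a2 and
    b = 3 a3. *)
Lemma toeplitz_bound (c b : C) : (Cmod (b - c * c) <= 1 - Cmod c ^ 2)%R ->
  (Cmod ((- (c / 4)) ^ 2 - (c * c / 48 - (b - c * c) / 6) ^ 2) <= 145 / 2304)%R.
Proof.
  intros H. set (v := b - c * c) in *. set (t := (Cmod c ^ 2)%R) in *.
  assert (Ht : (0 <= t <= 1)%R).
  { split; [apply pow2_ge_0|]. generalize (Cmod_ge_0 v); lra. }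
  eapply Rle_trans; [apply Cmod_sub_le|]. eapply Rle_trans; [|apply (toeplitz_real_bound t Ht)].
  assert (N : forall x : R, x <> 0%R -> RtoC x <> 0) by apply RtoC_neq_0.
  rewrite !Cmod_pow, Cmod_opp, Cmod_div, Cmod_R, Rabs_pos_eq by (try apply N; lra).
  apply Rplus_le_compat; [right; unfold t; field|].
  apply pow_incr. split; [apply Cmod_ge_0|].
  eapply Rle_trans; [apply Cmod_sub_le|].
  rewrite !Cmod_div, !Cmod_R, !Rabs_pos_eq, Cmod_mult by (try apply N; lra).
  unfold t in *. simpl pow in *. lra.
Qed.

(** * Functions convex with respect to symmetric points *)

Lemma Cdiv_0_r (x : C) : x / 0 = 0.
Proof.
  unfold Cdiv. replace (/ 0) with (RtoC 0); [ring|].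
  unfold Cinv, RtoC; simpl. unfold Rdiv. rewrite Ropp_0, !Rmult_0_l. reflexivity.
Qed.

(** With f' = 1 + 2 a2 z + 3 a3 z^2 + z^3 m, the quotient
    p = 2 (z f')' / (f(z) - f(-z))' begins with 1 + 4 a2 z + 6 a3 z^2. The
    remainder p3 below is what is left after division by z^3; it is holomorphic
    because m and m' are and the denominator has no zero. So
    [caratheodory_second] applies with c = 2 a2 and b = 3 a3. *)
Lemma class_KS_expansion (f : C -> C) : class_KS f ->
  exists (a2 a3 : C) (k : C -> C), Hol 1 k /\
    (forall z, f z = z + a2 * (z * z) + a3 * (z * z * z) + z * z * z * z * k z) /\
    (Cmod (3 * a3 - 2 * a2 * (2 * a2)) <= 1 - Cmod (2 * a2) ^ 2)%R.
Proof.
  intros [[Hd [H0 H1]] HRe].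
  assert (Hf : Hol 1 f) by (intros z Hz; apply Cdiff_ex_derive, Hd, Hz).
  set (q1 := slope_at_0 f). set (q2 := slope_at_0 q1). set (q3 := slope_at_0 q2). set (k := slope_at_0 q3).
  assert (Hk : Hol 1 k) by (repeat apply Hol_slope_at_0; exact Hf).
  exists (q2 0), (q3 0), k.
  assert (Ef : forall z, f z = z + q2 0 * (z * z) + q3 0 * (z * z * z) + z * z * z * z * k z).
  { intros z. rewrite (slope_at_0_eq f z), H0. fold q1. rewrite (slope_at_0_eq q1 z). fold q2.
    rewrite (slope_at_0_eq q2 z). fold q3. rewrite (slope_at_0_eq q3 z). fold k.
    unfold q1 at 1. rewrite slope_at_0_0, H1. ring. }
  split; [exact Hk|]. split; [exact Ef|].
  generalize dependent (q2 0). generalize dependent (q3 0). clearbody k. clear q1 q2 q3.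
  intros a3 a2 Ef.
  assert (Hk' := Hol_derive 1 k Hk).
  set (m := fun z => 4 * k z + z * C_derive k z).
  assert (Hm : Hol 1 m).
  { intros z Hz. unfold m. apply Cdiff_plus; apply Cdiff_mult; auto using Cdiff_const, Cdiff_id. }
  assert (Hm' := Hol_derive 1 m Hm).
  set (g := fun z => 1 + 2 * a2 * z + 3 * a3 * (z * z) + z * z * z * m z).
  assert (D1 : forall z, (Cmod z < 1)%R -> Cder f z (g z)).
  { intros z Hz. apply (Cder_ext_loc (fun z => z + a2 * (z * z) + a3 * (z * z * z) + z * z * z * z * k z) _ z _ 1);
      [lra|intros; symmetry; apply Ef|].
    eapply Cder_eq.
    - repeat first [apply Cder_plus|apply Cder_mult|apply Cder_const|apply Cder_id|apply Cdiff_Cder, Hk; auto].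
    - cbv beta. unfold g, m. ring. }
  set (g' := fun z => 2 * a2 + 6 * a3 * z + 3 * (z * z) * m z + z * z * z * C_derive m z).
  assert (D2 : forall z, (Cmod z < 1)%R -> Cder (C_derive f) z (g' z)).
  { intros z Hz. apply (Cder_ext_loc g _ z _ (1 - Cmod z)); [lra| |].
    - intros y Hy. symmetry. apply Cder_C_derive, D1, near_lt with z, Hy.
    - eapply Cder_eq.
      + repeat first [apply (Cdiff_Cder m), Hm; auto|apply Cder_plus|apply Cder_mult|apply Cder_const|apply Cder_id].
      + cbv beta. unfold g'. ring. }
  set (N := fun z => g z + z * g' z). set (D := fun z => g z + g (- z)).
  assert (EN : forall z, (Cmod z < 1)%R -> C_derive (fun u => u * C_derive f u) z = N z).
  { intros z Hz. apply Cder_C_derive. eapply Cder_eq.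
    - apply Cder_mult; [apply Cder_id|apply D2; auto].
    - cbv beta. rewrite (Cder_C_derive _ _ _ (D1 z Hz)). unfold N. ring. }
  assert (ED : forall z, (Cmod z < 1)%R -> C_derive (fun u => f u - f (- u)) z = D z).
  { intros z Hz. apply Cder_C_derive. eapply Cder_eq.
    - apply Cder_minus; [apply D1; auto|]. apply (Cder_comp f (fun u => - u)).
      + apply Cder_opp, Cder_id.
      + apply D1. rewrite Cmod_opp. exact Hz.
    - unfold D. ring. }
  assert (HP : forall z, (Cmod z < 1)%R -> (0 < Re (N z / D z))%R).
  { intros z Hz. rewrite <- EN, <- ED by auto. apply HRe, Hz. }
  assert (HD : forall z, (Cmod z < 1)%R -> D z <> 0).
  { intros z Hz E. specialize (HP z Hz). rewrite E, Cdiv_0_r, re_RtoC in HP. lra. }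
  set (p3 := fun z => (2 * (4 * m z + z * C_derive m z)
       - (m z - m (- z)) * (1 + 4 * a2 * z + 6 * a3 * (z * z)) - 24 * (a2 * a3) - 36 * (a3 * a3) * z) / D z).
  assert (Hm_ : forall z, (Cmod z < 1)%R -> Cdiff (fun z => m (- z)) z).
  { intros z Hz. apply (Cdiff_comp m (fun z => - z)); [apply Cdiff_opp, Cdiff_id|].
    apply Hm. rewrite Cmod_opp; auto. }
  assert (Hp3 : Hol 1 p3).
  { intros z Hz. unfold p3. apply Cdiff_div; auto.
    - repeat first [apply Hm; solve [auto]|apply Hm'; solve [auto]|apply Hm_; solve [auto]
        |apply Cdiff_minus|apply Cdiff_plus|apply Cdiff_mult|apply Cdiff_const|apply Cdiff_id].
    - unfold D, g.
      repeat first [apply Hm; solve [auto]|apply Hm_; solve [auto]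
        |apply Cdiff_plus|apply Cdiff_mult|apply Cdiff_const|apply Cdiff_id|apply Cdiff_opp]. }
  apply (caratheodory_second (2 * a2) (3 * a3) p3 Hp3). intros z Hz.
  replace (1 + 2 * (2 * a2) * z + 2 * (3 * a3) * (z * z) + z * z * z * p3 z) with (RtoC 2 * (N z / D z)).
  - rewrite re_scal_l. generalize (HP z Hz). lra.
  - assert (ND := HD z Hz).
    assert (EQ : 2 * N z = (1 + 2 * (2 * a2) * z + 2 * (3 * a3) * (z * z)) * D z
       + z * z * z * (p3 z * D z)).
    { unfold p3. unfold Cdiv. rewrite <- (Cmult_assoc _ (/ D z)), Cinv_l, Cmult_1_r by auto.
      unfold N, D, g, g'. ring. }
    replace (2 * (N z / D z)) with (2 * N z / D z) by (field; auto). rewrite EQ. field; auto.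
Qed.

(** * The principal logarithm *)

Lemma re_div_Cmod_bounds (u : C) : u <> 0 -> (-1 <= Re u / Cmod u <= 1)%R.
Proof.
  intros N. assert (H := proj1 (Cmod_gt_0 _) N). assert (B := re_le_Cmod u).
  apply Rabs_le_between. unfold Rdiv. rewrite Rabs_mult, (Rabs_pos_eq (/ _)) by (left; apply Rinv_0_lt_compat; auto).
  apply Rmult_le_reg_r with (Cmod u); auto. rewrite Rmult_assoc, Rinv_l by lra. lra.
Qed.

Lemma Cexp_Clog (u : C) : u <> 0 -> Cexp (Clog u) = u.
Proof.
  intros N. assert (H := proj1 (Cmod_gt_0 _) N). assert (B := re_div_Cmod_bounds u N).
  assert (Sq : sqrt (1 - (Re u / Cmod u)²) = (Rabs (Im u) / Cmod u)%R).
  { replace (1 - (Re u / Cmod u)²)%R with ((Rabs (Im u) / Cmod u) ^ 2)%R.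
    - apply sqrt_pow2. apply Rdiv_le_0_compat; auto. apply Rabs_pos.
    - generalize (Cmod2_alt u). intros E.
      replace ((Rabs (Im u) / Cmod u) ^ 2)%R with (Rabs (Im u) ^ 2 / Cmod u ^ 2)%R by (field; lra).
      rewrite pow2_abs. replace (Im u ^ 2)%R with (Cmod u ^ 2 - Re u ^ 2)%R by lra.
      unfold Rsqr. field. lra. }
  assert (E : forall th, Cexp (ln (Cmod u), th) = ((Cmod u * cos th)%R, (Cmod u * sin th)%R)).
  { intros th. unfold Cexp, Re, Im; simpl. rewrite exp_ln by auto. reflexivity. }
  unfold Clog, Carg. rewrite E. clear E.
  destruct (Rle_dec 0 (Im u)) as [Hi|Hi].
  - rewrite cos_acos, sin_acos, Sq, Rabs_pos_eq by auto.
    destruct u as [x y]; unfold Re, Im in *; simpl in *. f_equal; field; lra.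
  - rewrite cos_neg, sin_neg, cos_acos, sin_acos, Sq, Rabs_left by (auto; lra).
    destruct u as [x y]; unfold Re, Im in *; simpl in *. f_equal; field; lra.
Qed.

Lemma Clog_Cexp (s : C) : (- PI < Im s < PI)%R -> Clog (Cexp s) = s.
Proof.
  intros Hs. unfold Clog, Carg. rewrite Cmod_Cexp, ln_exp.
  destruct s as [x y]. unfold Cexp, Re, Im in *; simpl in *.
  assert (E := exp_pos x). f_equal.
  replace (exp x * cos y / exp x)%R with (cos y) by (field; lra).
  destruct (Rle_dec 0 (exp x * sin y)) as [H|H].
  - apply acos_cos. split; [|lra]. apply Rnot_lt_le. intros Hy.
    apply (Rle_not_lt _ _ H). assert (sin y < 0)%R by (apply sin_lt_0_var; lra). nra.
  - rewrite <- cos_neg, acos_cos; [lra|]. split; [|lra].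
    destruct (Rle_dec y 0) as [|Hy]; [lra|]. exfalso. apply H.
    apply Rmult_le_pos; [lra|]. apply sin_ge_0; lra.
Qed.

Lemma Im_Clog (u : C) : (0 < Re u)%R -> (- (PI / 2) < Im (Clog u) < PI / 2)%R.
Proof.
  intros H. assert (N : u <> 0) by (intros E; rewrite E, re_RtoC in H; lra).
  assert (Hm := proj1 (Cmod_gt_0 _) N). assert (B := re_div_Cmod_bounds u N).
  assert (A := acos_bound (Re u / Cmod u)).
  assert (A2 : (acos (Re u / Cmod u) < PI / 2)%R).
  { apply Rnot_le_lt. intros Q. assert (cos (acos (Re u / Cmod u)) <= 0)%R by (apply cos_le_0; lra).
    rewrite cos_acos in H0 by auto. assert (0 < Re u / Cmod u)%R by (apply Rdiv_lt_0_compat; auto). lra. }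
  change (Im (Clog u)) with (Carg u). unfold Carg. destruct (Rle_dec 0 (Im u)); generalize PI_RGT_0; lra.
Qed.

Lemma Clog_1 : Clog 1 = 0.
Proof. rewrite <- Cexp_0. apply Clog_Cexp. rewrite im_RtoC. generalize PI_RGT_0; lra. Qed.

Lemma Clog_mult (u v : C) : (0 < Re u)%R -> (0 < Re v)%R -> Clog (u * v) = Clog u + Clog v.
Proof.
  intros Hu Hv.
  assert (Nu : u <> 0) by (intros E; rewrite E, re_RtoC in Hu; lra).
  assert (Nv : v <> 0) by (intros E; rewrite E, re_RtoC in Hv; lra).
  rewrite <- (Cexp_Clog u) at 1 by auto. rewrite <- (Cexp_Clog v) at 1 by auto.
  rewrite <- Cexp_plus. apply Clog_Cexp. rewrite im_plus.
  generalize (Im_Clog u Hu) (Im_Clog v Hv). lra.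
Qed.

Lemma Re_near_1 (u : C) (d : R) : (Cmod (u - 1) < d)%R -> (1 - d < Re u)%R.
Proof.
  intros H. assert (B := re_le_Cmod (u - 1)).
  replace (Re (u - 1)) with (Re u - 1)%R in B by (destruct u; unfold Re, RtoC, Cminus, Cplus, Copp; simpl; ring).
  assert (- Rabs (Re u - 1) <= Re u - 1)%R by (generalize (Rle_abs (- (Re u - 1))); rewrite Rabs_Ropp; lra). lra.
Qed.

Lemma Clog_right_half (u : C) : (0 < Re u)%R -> Clog u = (ln (Cmod u), atan (Im u / Re u)).
Proof.
  intros H. assert (N : u <> 0) by (intros E; rewrite E, re_RtoC in H; lra).
  assert (Hm := proj1 (Cmod_gt_0 _) N).
  set (s := (ln (Cmod u), atan (Im u / Re u)) : C).
  assert (B := atan_bound (Im u / Re u)).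
  replace u with (Cexp s) at 1.
  { apply Clog_Cexp. change (Im s) with (atan (Im u / Re u)). generalize PI_RGT_0; lra. }
  change (Cexp s) with ((exp (ln (Cmod u)) * cos (atan (Im u / Re u)))%R,
    (exp (ln (Cmod u)) * sin (atan (Im u / Re u)))%R).
  rewrite exp_ln, cos_atan, sin_atan by auto.
  assert (Sq : sqrt (1 + (Im u / Re u)²) = (Cmod u / Re u)%R).
  { replace (1 + (Im u / Re u)²)%R with ((Cmod u / Re u) ^ 2)%R.
    - apply sqrt_pow2. apply Rdiv_le_0_compat; auto; lra.
    - replace ((Cmod u / Re u) ^ 2)%R with (Cmod u ^ 2 / Re u ^ 2)%R by (field; lra).
      rewrite Cmod2_alt. unfold Rsqr. field. lra. }
  rewrite Sq. destruct u as [x y]; unfold Re, Im in *; simpl in *. f_equal; field; lra.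
Qed.

Lemma continuity_pt_eps (f : R -> R) (x eps : R) : continuity_pt f x -> (0 < eps)%R ->
  exists d, (0 < d)%R /\ forall y, (Rabs (y - x) < d)%R -> (Rabs (f y - f x) < eps)%R.
Proof.
  intros H He. apply continuity_pt_filterlim in H.
  destruct (proj1 (filterlim_locally _ _) H (mkposreal eps He)) as [d Hd].
  exists d; split; [apply cond_pos|]. exact Hd.
Qed.

Lemma contC_Clog_1 : contC Clog (RtoC 1).
Proof.
  apply contC_at. intros eps He. rewrite Clog_1.
  assert (E2 : (0 < eps / 2)%R) by lra.
  destruct (continuity_pt_eps ln 1 _ (derivable_continuous_pt ln 1 (exist _ _ (derivable_pt_lim_ln 1 Rlt_0_1))) E2) as [d1 [P1 H1]].
  destruct (continuity_pt_eps atan 0 _ (derivable_continuous_pt atan 0 (derivable_pt_atan 0)) E2) as [d2 [P2 H2]].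
  exists (Rmin (1 / 2) (Rmin d1 (d2 / 2))). split; [repeat apply Rmin_pos; lra|].
  intros y Hy.
  assert (Q1 := Rmin_l (1 / 2) (Rmin d1 (d2 / 2))). assert (Q2 := Rmin_r (1 / 2) (Rmin d1 (d2 / 2))).
  assert (Q3 := Rmin_l d1 (d2 / 2)). assert (Q4 := Rmin_r d1 (d2 / 2)).
  assert (Hre := Re_near_1 y (1 / 2) ltac:(lra)).
  rewrite Clog_right_half by lra. replace (_ - 0) with ((ln (Cmod y), atan (Im y / Re y)) : C) by
    (unfold Cminus, Cplus, Copp, RtoC; simpl; f_equal; ring).
  eapply Rle_lt_trans; [apply Cmod_le_abs|]. unfold Re at 1, Im at 1; simpl.
  assert (A1 : (Rabs (ln (Cmod y)) < eps / 2)%R).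
  { replace (ln (Cmod y)) with (ln (Cmod y) - ln 1)%R by (rewrite ln_1; ring). apply H1.
    apply Rabs_def1.
    - generalize (Cmod_sub_ge y 1). rewrite Cmod_1. lra.
    - generalize (Cmod_sub_ge 1 y). rewrite Cmod_1, (Cmod_sub_sym 1). lra. }
  assert (A2 : (Rabs (atan (Im y / Re y)) < eps / 2)%R).
  { replace (atan (Im y / Re y)) with (atan (Im y / Re y) - atan 0)%R by (rewrite atan_0; ring). apply H2.
    rewrite Rminus_0_r. unfold Rdiv. rewrite Rabs_mult, (Rabs_pos_eq (/ _)) by (left; apply Rinv_0_lt_compat; lra).
    assert (B := im_le_Cmod (y - 1)).
    replace (Im (y - 1)) with (Im y) in B by (destruct y; unfold Im, RtoC, Cminus, Cplus, Copp; simpl; ring).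
    apply Rmult_lt_reg_r with (Re y); [lra|]. rewrite Rmult_assoc, Rinv_l by lra.
    generalize (Rabs_pos (Im y)). nra. }
  lra.
Qed.

(** Write exp s = 1 + q(s) s with q continuous and q(0) = 1. For s = log y this
    gives log y = (y - 1) / q(log y). *)
Lemma Cder_Clog_1 : Cder Clog 1 1.
Proof.
  destruct (proj1 (Cder_factor _ _ _) Cder_Cexp_0) as [q [Hq [Eq Ef]]].
  assert (CQ : contC (fun y => / q (Clog y)) (RtoC 1)).
  { apply contC_inv; [rewrite Clog_1, Eq; apply C1_nz|].
    apply (continuous_comp Clog q); [apply contC_Clog_1|]. rewrite Clog_1. exact Hq. }
  assert (Cq : contC (fun y => q (Clog y)) (RtoC 1)).
  { apply (continuous_comp Clog q); [apply contC_Clog_1|]. rewrite Clog_1. exact Hq. }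
  destruct (proj1 (contC_at _ _) Cq 1%R Rlt_0_1) as [d [Hd Hy]].
  cbv beta in Hy. rewrite Clog_1, Eq in Hy.
  apply (Cder_ext_loc (fun y => / q (Clog y) * (y - 1)) _ 1 _ (Rmin 1 d)).
  - apply Rmin_pos; lra.
  - intros y Hyd. assert (Y1 := Rmin_l 1 d). assert (Y2 := Rmin_r 1 d).
    assert (N : q (Clog y) <> 0).
    { intros E. specialize (Hy y ltac:(lra)). rewrite E in Hy.
      replace (0 - 1) with (- (1)) in Hy by ring. rewrite Cmod_m1 in Hy. lra. }
    assert (Hre := Re_near_1 y 1 ltac:(lra)).
    assert (Ny : y <> 0) by (intros E; rewrite E, re_RtoC in Hre; lra).
    assert (E := Ef (Clog y)). rewrite Cexp_Clog, Cexp_0 in E by auto. rewrite E at 2. field; auto.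
  - apply Cder_factor. exists (fun y => / q (Clog y)). split; [exact CQ|]. split.
    + rewrite Clog_1, Eq. rewrite <- (Cmult_1_l (/ 1)). apply Cinv_r, C1_nz.
    + intros y. rewrite Clog_1. ring.
Qed.

(** Transported from the point 1 by log y = log u + log(y / u), which holds as
    long as the arguments of u and y / u both stay within (-PI/2, PI/2). *)
Lemma Cder_Clog (u : C) : (0 < Re u)%R -> Cder Clog u (/ u).
Proof.
  intros Hu. assert (N : u <> 0) by (intros E; rewrite E, re_RtoC in Hu; lra).
  assert (Hm := proj1 (Cmod_gt_0 _) N).
  apply (Cder_ext_loc (fun y => Clog u + Clog (y / u)) _ u _ (Cmod u)); auto.
  - intros y Hy. replace y with (u * (y / u)) at 2 by (field; auto). symmetry. apply Clog_mult; auto.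
    replace 0%R with (1 - 1)%R by ring. apply Re_near_1.
    replace (y / u - 1) with ((y - u) / u) by (field; auto). rewrite Cmod_div by auto.
    apply Rmult_lt_reg_r with (Cmod u); auto. unfold Rdiv. rewrite Rmult_assoc, Rinv_l by lra. lra.
  - eapply Cder_eq.
    + apply Cder_plus; [apply Cder_const|]. apply (Cder_comp Clog (fun y => y / u)).
      * apply Cder_mult; [apply Cder_id|apply Cder_const].
      * replace (u / u) with (RtoC 1) by (field; auto). apply Cder_Clog_1.
    + cbv beta. field. auto.
Qed.

(** * Logarithmic coefficients of a local inverse *)

Definition bounded_at_0 (h : C -> C) : Prop :=
  exists M d : R, (0 < d)%R /\ forall s, (Cmod s < d)%R -> (Cmod (h s) <= M)%R.

(** The point 0 is left out because the remainders below are quotients by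
    powers of w. *)
Definition bounded_off_0 (h : C -> C) : Prop :=
  exists M d : R, (0 < d)%R /\ forall w : C, w <> 0 -> (Cmod w < d)%R -> (Cmod (h w) <= M)%R.

Lemma bounded_off_0_const (c : C) : bounded_off_0 (fun _ => c).
Proof. exists (Cmod c), 1%R. split; [lra|]. intros; lra. Qed.

Lemma bounded_off_0_id : bounded_off_0 (fun w => w).
Proof. exists 1%R, 1%R. split; [lra|]. intros; lra. Qed.

Lemma bounded_off_0_plus (g h : C -> C) : bounded_off_0 g -> bounded_off_0 h -> bounded_off_0 (fun w => g w + h w).
Proof.
  intros [M [d [Hd H]]] [M' [d' [Hd' H']]]. exists (M + M')%R, (Rmin d d').
  split; [apply Rmin_pos; auto|]. intros w N Hw.
  eapply Rle_trans; [apply Cmod_triangle|]. apply Rplus_le_compat; [apply H|apply H']; auto.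
  - eapply Rlt_le_trans; [apply Hw|apply Rmin_l].
  - eapply Rlt_le_trans; [apply Hw|apply Rmin_r].
Qed.

Lemma bounded_off_0_mult (g h : C -> C) : bounded_off_0 g -> bounded_off_0 h -> bounded_off_0 (fun w => g w * h w).
Proof.
  intros [M [d [Hd H]]] [M' [d' [Hd' H']]]. exists (M * M')%R, (Rmin d d').
  split; [apply Rmin_pos; auto|]. intros w N Hw.
  rewrite Cmod_mult. apply Rmult_le_compat; try apply Cmod_ge_0; [apply H|apply H']; auto.
  - eapply Rlt_le_trans; [apply Hw|apply Rmin_l].
  - eapply Rlt_le_trans; [apply Hw|apply Rmin_r].
Qed.

Lemma bounded_off_0_comp (k U : C -> C) :
  bounded_at_0 k ->
  bounded_off_0 U -> bounded_off_0 (fun w => k (w * U w)).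
Proof.
  intros [M [d [Hd H]]] [M' [d' [Hd' H']]].
  assert (P := Rabs_pos M').
  exists M, (Rmin d' (d / (Rabs M' + 1))). split; [apply Rmin_pos; auto; apply Rdiv_lt_0_compat; lra|].
  intros w N Hw. apply H. rewrite Cmod_mult.
  assert (H1 : (Cmod w < d')%R) by (eapply Rlt_le_trans; [apply Hw|apply Rmin_l]).
  assert (H2 : (Cmod w < d / (Rabs M' + 1))%R) by (eapply Rlt_le_trans; [apply Hw|apply Rmin_r]).
  assert (H3 : (Cmod w * (Rabs M' + 1) < d)%R).
  { apply Rmult_lt_reg_r with (/ (Rabs M' + 1))%R; [apply Rinv_0_lt_compat; lra|].
    rewrite Rmult_assoc, Rinv_r by lra. rewrite Rmult_1_r. exact H2. }
  specialize (H' w N H1). generalize (Rle_abs M') (Cmod_ge_0 w) (Cmod_ge_0 (U w)). nra.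
Qed.

Ltac bounded_off := repeat first [assumption | apply bounded_off_0_const | apply bounded_off_0_id | apply bounded_off_0_plus | apply bounded_off_0_mult].

Lemma bounded_off_0_first_coeff (A : C) (h : C -> C) (d : R) : bounded_off_0 h -> (0 < d)%R ->
  (forall w : C, w <> 0 -> (Cmod w < d)%R -> A + w * h w = 0) -> A = 0.
Proof.
  intros [M [d' [Hd' H']]] Hd H. apply (Cmod_eps_0 A (Rabs M)). intros eps He.
  set (e := Rmin eps (Rmin d d' / 2)).
  assert (P : (0 < Rmin d d')%R) by (apply Rmin_pos; auto).
  assert (He1 : (0 < e)%R) by (apply Rmin_pos; lra).
  assert (B1 := Rmin_l eps (Rmin d d' / 2)). assert (B2 := Rmin_r eps (Rmin d d' / 2)). fold e in B1, B2.
  assert (B3 := Rmin_l d d'). assert (B4 := Rmin_r d d').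
  assert (N : RtoC e <> 0) by (apply RtoC_neq_0; lra).
  assert (Ce : Cmod (RtoC e) = e) by (rewrite Cmod_R, Rabs_pos_eq; lra).
  assert (E := H (RtoC e) N ltac:(rewrite Ce; lra)).
  assert (F := H' (RtoC e) N ltac:(rewrite Ce; lra)).
  replace A with (- (RtoC e * h (RtoC e))).
  - rewrite Cmod_opp, Cmod_mult, Ce. apply Rmult_le_compat; try apply Cmod_ge_0; try lra.
    generalize (Rle_abs M); lra.
  - replace A with (A + RtoC e * h (RtoC e) - RtoC e * h (RtoC e)) by ring. rewrite E. ring.
Qed.

Lemma bounded_off_0_two_coeffs (A B : C) (h : C -> C) (d : R) : bounded_off_0 h -> (0 < d)%R ->
  (forall w : C, w <> 0 -> (Cmod w < d)%R -> w * (A + w * (B + w * h w)) = 0) -> A = 0 /\ B = 0.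
Proof.
  intros Hh Hd H.
  assert (H1 : forall w : C, w <> 0 -> (Cmod w < d)%R -> A + w * (B + w * h w) = 0).
  { intros w N Hw. replace (A + w * (B + w * h w)) with (w * (A + w * (B + w * h w)) / w) by (field; auto).
    rewrite H by auto. field; auto. }
  assert (EA : A = 0) by (apply (bounded_off_0_first_coeff A (fun w => B + w * h w) d); [bounded_off|auto|auto]).
  split; auto.
  apply (bounded_off_0_first_coeff B h d); auto. intros w N Hw. specialize (H1 w N Hw).
  rewrite EA in H1. replace (B + w * h w) with ((0 + w * (B + w * h w)) / w) by (field; auto).
  rewrite H1. field; auto.
Qed.

Lemma Cdiff_bounded_at_0 (k : C -> C) : Cdiff k 0 ->
  bounded_at_0 k.
Proof.
  intros H. destruct (proj1 (contC_at _ _) (Cdiff_cont k 0 H) 1%R Rlt_0_1) as [d [Hd Hy]].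
  exists (Cmod (k 0) + 1)%R, d. split; auto. intros s Hs.
  specialize (Hy s). replace (s - 0) with s in Hy by ring. specialize (Hy Hs).
  generalize (Cmod_sub_ge (k s) (k 0)). lra.
Qed.

(** The coefficient 1/2 comes from comparing the terms of first order in
    exp' = exp. *)
Lemma Cexp_expansion : exists k : C -> C,
  bounded_at_0 k /\
  forall s, Cexp s = 1 + s + s * s / 2 + s * s * s * k s.
Proof.
  assert (H : Hol 1 Cexp) by (intros z _; eexists; apply Cder_Cexp).
  set (q1 := slope_at_0 Cexp). set (q2 := slope_at_0 q1). set (k := slope_at_0 q2).
  assert (Hk : Hol 1 k) by (repeat apply Hol_slope_at_0; exact H).
  assert (E : forall s, Cexp s = 1 + s + q2 0 * (s * s) + s * s * s * k s).
  { intros s. rewrite (slope_at_0_eq Cexp s), Cexp_0. fold q1. rewrite (slope_at_0_eq q1 s). fold q2.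
    rewrite (slope_at_0_eq q2 s). fold k. unfold q1 at 1. rewrite slope_at_0_0, (Cder_C_derive _ _ _ (Cder_Cexp 0)), Cexp_0. ring. }
  assert (Dk : forall z, (Cmod z < 1)%R -> Cder k z (C_derive k z)) by (intros; apply Cdiff_Cder, Hk; auto).
  assert (Dk' : forall z, (Cmod z < 1)%R -> Cder (C_derive k) z (C_derive (C_derive k) z)).
  { intros; apply Cdiff_Cder, (Hol_derive 1 k Hk); auto. }
  assert (Hc : q2 0 = / 2).
  { set (c := q2 0) in *.
    assert (D : forall z, (Cmod z < 1)%R -> Cexp z = 1 + 2 * c * z + z * z * (3 * k z + z * C_derive k z)).
    { intros z Hz. apply (Cder_unique Cexp z); [apply Cder_Cexp|].
      apply (Cder_ext_loc (fun s => 1 + s + c * (s * s) + s * s * s * k s) _ z _ 1); [lra|intros; symmetry; apply E|].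
      eapply Cder_eq.
      - repeat first [apply Dk; assumption|apply Cder_plus|apply Cder_mult|apply Cder_const|apply Cder_id].
      - cbv beta. ring. }
    assert (H0 : (Cmod 0 < 1)%R) by (rewrite Cmod_0; lra).
    assert (D0 : Cder Cexp 0 (2 * c)).
    { apply (Cder_ext_loc (fun z => 1 + 2 * c * z + z * z * (3 * k z + z * C_derive k z)) _ 0 _ 1); [lra| |].
      - intros y Hy. symmetry. apply D. replace y with (y - 0) by ring. exact Hy.
      - eapply Cder_eq.
        + repeat first [apply Dk; assumption|apply Dk'; assumption
           |apply Cder_plus|apply Cder_mult|apply Cder_const|apply Cder_id].
        + cbv beta. ring. }
    assert (E2 := Cder_unique _ _ _ _ D0 (Cder_Cexp 0)). rewrite Cexp_0 in E2.
    replace c with (2 * c / 2) by (field; apply RtoC_neq_0; lra). rewrite E2. field. }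
  exists k. split.
  - apply Cdiff_bounded_at_0, Hk. rewrite Cmod_0. lra.
  - intros s. rewrite (E s), Hc. field.
Qed.

Lemma eventually_bounded (u : nat -> R) (N : nat) (B : R) :
  (forall n, (N <= n)%nat -> (u n <= B)%R) -> exists B', forall n, (u n <= B')%R.
Proof.
  revert B. induction N as [|N IH]; intros B H.
  - exists B. intros n. apply H. lia.
  - apply (IH (Rmax B (u N))). intros n Hn. destruct (Nat.eq_dec n N) as [->|].
    + apply Rmax_r.
    + eapply Rle_trans; [apply H; lia|apply Rmax_l].
Qed.

Lemma is_series_terms_bounded (a : nat -> C) (l : C) : is_series a l -> exists B, forall n, (Cmod (a n) <= B)%R.
Proof.
  intros H. destruct (proj1 (is_series_eps a l) H 1%R Rlt_0_1) as [N HN].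
  apply (eventually_bounded _ (S N) 2). intros n Hn. destruct n as [|n]; [lia|].
  assert (H1 := HN n ltac:(lia)). assert (H2 := HN (S n) ltac:(lia)).
  rewrite sum_Sn in H2. change (plus (sum_n a n) (a (S n))) with (sum_n a n + a (S n)) in H2.
  replace (a (S n)) with ((sum_n a n + a (S n) - l) - (sum_n a n - l)) by ring.
  eapply Rle_trans; [apply Cmod_sub_le|]. lra.
Qed.

(** Geometric majorant; the ratio is at most 1/2, whence the factor 2. The
    convergence is used at the single point z, with sum l. *)
Lemma power_series_remainder (a : nat -> C) (rho B : R) (z l : C) (N : nat) :
  (0 < rho)%R -> (forall n, (Cmod (a n) * rho ^ n <= B)%R) -> (Cmod z <= rho / 2)%R ->
  is_series (fun n => a n * z ^ n) l ->
  (Cmod (l - sum_n (fun n => a n * z ^ n)%C N) <= 2 * B / rho ^ (S N) * Cmod z ^ (S N))%R.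
Proof.
  intros Hr HB Hz Hs. set (q := (Cmod z / rho)%R).
  assert (Hq : (0 <= q <= 1 / 2)%R).
  { unfold q. split; [apply Rdiv_le_0_compat; auto; apply Cmod_ge_0|].
    apply Rmult_le_reg_r with rho; auto. unfold Rdiv at 1. rewrite Rmult_assoc, Rinv_l by lra. lra. }
  assert (Ez : Cmod z = (q * rho)%R) by (unfold q; field; lra).
  assert (HB0 : (0 <= B)%R).
  { eapply Rle_trans; [|apply (HB 0%nat)]. apply Rmult_le_pos; [apply Cmod_ge_0|apply pow_le; lra]. }
  assert (T : forall n, (Cmod (a n * z ^ n) <= B * q ^ n)%R).
  { intros n. rewrite Cmod_mult, Cmod_pow, Ez, Rpow_mult_distr.
    replace (Cmod (a n) * (q ^ n * rho ^ n))%R with (Cmod (a n) * rho ^ n * q ^ n)%R by ring.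
    apply Rmult_le_compat_r; auto. apply pow_le; lra. }
  set (s := sum_n (fun n => a n * z ^ n)) in *.
  assert (P : (0 <= q ^ S N)%R) by (apply pow_le; lra).
  assert (Hj : forall j, (Cmod (s (j + N)%nat - s N) <= B * q ^ S N * (2 - 2 * (1 / 2) ^ j))%R).
  { induction j as [|j IH].
    - change (0 + N)%nat with N. replace (s N - s N) with (RtoC 0) by ring. rewrite Cmod_0. simpl. nra.
    - change (S j + N)%nat with (S (j + N)). unfold s at 1. rewrite sum_Sn.
      fold s. match goal with |- (Cmod (?p - ?r) <= _)%R =>
        replace (p - r) with ((s (j + N)%nat - s N) + a (S (j + N)) * z ^ S (j + N))
          by (unfold plus; simpl; ring) end.
      eapply Rle_trans; [apply Cmod_triangle|].
      assert (X := T (S (j + N))).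
      assert (Y : (B * q ^ S (j + N) <= B * q ^ S N * (1 / 2) ^ j)%R).
      { replace (S (j + N)) with (S N + j)%nat by lia. rewrite pow_add, <- Rmult_assoc.
        apply Rmult_le_compat_l; [apply Rmult_le_pos; auto|]. apply pow_incr; lra. }
      replace (2 - 2 * (1 / 2) ^ S j)%R with ((2 - 2 * (1 / 2) ^ j) + (1 / 2) ^ j)%R by (simpl; field).
      lra. }
  replace (2 * B / rho ^ S N * Cmod z ^ S N)%R with (B * q ^ S N * 2)%R.
  2:{ rewrite Ez, Rpow_mult_distr. field. first [lra | apply pow_nonzero; lra | split; first [lra | apply pow_nonzero; lra]]. }
  apply le_epsilon. intros eps He.
  destruct (proj1 (is_series_eps _ _) Hs eps He) as [M HM].
  specialize (HM (M + N)%nat ltac:(lia)). fold s in HM. specialize (Hj M).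
  replace (l - s N) with ((l - s (M + N)%nat) + (s (M + N)%nat - s N)) by ring.
  eapply Rle_trans; [apply Cmod_triangle|]. rewrite Cmod_sub_sym.
  assert (0 <= (1 / 2) ^ M)%R by (apply pow_le; lra).
  assert (0 <= B * q ^ S N)%R by (apply Rmult_le_pos; auto). nra.
Qed.

Lemma power_series_coeff_bound (a : nat -> C) (z l : C) (r : R) : Cmod z = r ->
  is_series (fun n => a n * z ^ n) l -> exists B, forall n, (Cmod (a n) * r ^ n <= B)%R.
Proof.
  intros Hz Hs. destruct (is_series_terms_bounded _ _ Hs) as [B HB]. exists B.
  intros n. rewrite <- Hz, <- Cmod_pow, <- Cmod_mult. apply HB.
Qed.

(** Write F(w) = w E(w) with E = exp(2 Gamma_1 w + 2 Gamma_2 w^2 + ...). Then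
    f(F(w)) = w becomes E + a2 w E^2 + a3 w^2 E^3 + ... = 1, and the terms of
    order w and w^2 determine Gamma_1 and Gamma_2. All remainders are kept as
    explicit functions bounded off 0, so the coefficients can be compared by
    [bounded_off_0_two_coeffs]. *)
Lemma local_inverse_log_coeffs (f : C -> C) (Gamma : nat -> C) (a2 a3 : C) (k : C -> C) (r0 : R) :
  (0 < r0)%R ->
  bounded_at_0 k ->
  (forall z, (Cmod z < r0)%R -> f z = z + a2 * (z * z) + a3 * (z * z * z) + z * z * z * z * k z) ->
  inverse_log_coeffs f Gamma ->
  Gamma 1%nat = - (a2 / 2) /\ Gamma 2%nat = 3 / 4 * (a2 * a2) - a3 / 2.
Proof.
  intros Hr0 Hk Ef [F [[HF0 [r1 [Hr1 HF]]] [r2 [Hr2 HL]]]].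
  assert (Hf0 : f 0 = 0) by (rewrite (Ef 0) by (rewrite Cmod_0; auto); ring).
  set (a := fun n => match n with O => RtoC 0 | S _ => 2 * Gamma n end).
  set (S := fun w => Clog (F w / w)).
  assert (HS : forall w : C, w <> 0 -> (Cmod w < r2)%R -> is_series (fun n => a n * w ^ n) (S w)).
  { intros w N Hw. specialize (HL w N Hw).
    apply (is_series_decr_1 (fun n => a n * w ^ n)).
    match goal with |- is_series _ ?v => replace v with (S w) end.
    - eapply is_series_ext; [|exact HL]. intros n. unfold a. cbv beta.
      match goal with |- ?x = ?y => change (@eq C x y) end. ring.
    - unfold a, plus, opp; simpl. ring. }
  set (rho := (r2 / 2)%R).
  assert (Nrho : RtoC rho <> 0) by (apply RtoC_neq_0; unfold rho; lra).
  assert (Crho : Cmod (RtoC rho) = rho) by (rewrite Cmod_R, Rabs_pos_eq; unfold rho; lra).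
  destruct (power_series_coeff_bound a (RtoC rho) _ rho Crho (HS _ Nrho ltac:(rewrite Crho; unfold rho; lra))) as [B HB].
  set (al := 2 * Gamma 1%nat). set (be := 2 * Gamma 2%nat).
  set (R3 := fun w => (S w - (al * w + be * (w * w))) / (w * w * w)).
  assert (BR : bounded_off_0 R3).
  { exists (2 * B / rho ^ 3)%R, (rho / 2)%R. split; [unfold rho; lra|]. intros w N Hw.
    assert (P := power_series_remainder a rho B w (S w) 2 ltac:(unfold rho; lra) HB ltac:(lra)
       (HS w N ltac:(unfold rho in *; lra))).
    unfold R3. rewrite Cmod_div by (repeat apply Cmult_neq_0; auto). rewrite !Cmod_mult.
    assert (Hw0 := proj1 (Cmod_gt_0 _) N).
    replace (sum_n _ 2) with (al * w + be * (w * w)) in P.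
    - apply Rmult_le_reg_r with (Cmod w * Cmod w * Cmod w)%R; [repeat apply Rmult_lt_0_compat; auto|].
      unfold Rdiv at 1. rewrite Rmult_assoc, Rinv_l by (apply Rgt_not_eq; repeat apply Rmult_lt_0_compat; auto).
      rewrite Rmult_1_r. eapply Rle_trans; [apply P|]. right. ring.
    - rewrite !sum_Sn, sum_O. unfold a, plus; simpl. unfold al, be. ring. }
  destruct Cexp_expansion as [kx [Hkx Ex]].
  (* S = w U, exp S = 1 + w T = E: each function is one order of w further expanded *)
  set (U := fun w => al + w * (be + w * R3 w)).
  assert (BU : bounded_off_0 U) by (unfold U; bounded_off).
  assert (ES : forall w : C, w <> 0 -> S w = w * U w).
  { intros w N. unfold U, R3. field; auto. }
  set (kS := fun w => kx (w * U w)).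
  assert (BkS : bounded_off_0 kS) by (apply bounded_off_0_comp; auto).
  set (Rest := fun w => R3 w + (al * (be + w * R3 w) + w * ((be + w * R3 w) * (be + w * R3 w)) * / 2)
                        + U w * U w * U w * kS w).
  assert (BRest : bounded_off_0 Rest) by (unfold Rest; bounded_off).
  set (be' := be + al * al / 2).
  set (T := fun w => al + w * (be' + w * Rest w)).
  assert (BT : bounded_off_0 T) by (unfold T; bounded_off).
  set (E := fun w => 1 + w * T w).
  assert (BE : bounded_off_0 E) by (unfold E; bounded_off).
  assert (N2 : RtoC 2 <> 0) by (apply RtoC_neq_0; lra).
  assert (EE : forall w : C, w <> 0 -> Cexp (S w) = E w).
  { intros w N. rewrite (ES w N), Ex. fold (kS w). unfold E, T, Rest, be', U. field; auto. }
  set (kF := fun w => k (w * E w)).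
  assert (BkF : bounded_off_0 kF) by (apply bounded_off_0_comp; auto).
  assert (EF : forall w : C, w <> 0 -> (Cmod w < r1)%R -> F w = w * E w).
  { intros w N Hw. destruct (HF w Hw) as [_ Hw2].
    assert (NF : F w <> 0).
    { intros Q. rewrite Q, Hf0 in Hw2. auto. }
    rewrite <- EE by auto. unfold S. rewrite Cexp_Clog; [field; auto|].
    unfold Cdiv. apply Cmult_neq_0; auto. intros Q. apply C1_nz. rewrite <- (Cinv_r w), Q by auto. ring. }
  assert (Hsm : exists d, (0 < d)%R /\ forall w : C, w <> 0 -> (Cmod w < d)%R -> (Cmod w < r1)%R /\ (Cmod (w * E w) < r0)%R).
  { destruct BE as [M [d [Hd HM]]]. assert (P := Rabs_pos M).
    exists (Rmin (Rmin r1 d) (r0 / (Rabs M + 1))). split.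
    - repeat apply Rmin_pos; auto. apply Rdiv_lt_0_compat; lra.
    - intros w N Hw. assert (Q1 := Rmin_l (Rmin r1 d) (r0 / (Rabs M + 1))).
      assert (Q2 := Rmin_r (Rmin r1 d) (r0 / (Rabs M + 1))).
      assert (Q3 := Rmin_l r1 d). assert (Q4 := Rmin_r r1 d).
      split; [lra|]. rewrite Cmod_mult. specialize (HM w N ltac:(lra)).
      assert (H3 : (Cmod w * (Rabs M + 1) < r0)%R).
      { apply Rmult_lt_reg_r with (/ (Rabs M + 1))%R; [apply Rinv_0_lt_compat; lra|].
        rewrite Rmult_assoc, Rinv_r by lra. rewrite Rmult_1_r. unfold Rdiv in *; lra. }
      generalize (Rle_abs M) (Cmod_ge_0 w) (Cmod_ge_0 (E w)). nra. }
  destruct Hsm as [d [Hd Hsm]].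
  (* h is the remainder of (E + a2 w E^2 + a3 w^2 E^3 + w^3 E^4 k(w E) - 1) / w at order w^2 *)
  set (h := fun w => Rest w + 2 * a2 * (be' + w * Rest w) + a2 * (T w * T w)
     + a3 * (3 * T w + 3 * w * (T w * T w) + w * w * (T w * T w * T w)) + E w * E w * E w * E w * kF w).
  assert (Bh : bounded_off_0 h) by (unfold h; bounded_off).
  destruct (bounded_off_0_two_coeffs (al + a2) (be' + 2 * a2 * al + a3) h d Bh Hd) as [C1 C2].
  { intros w N Hw. destruct (Hsm w N Hw) as [W1 W2].
    destruct (HF w W1) as [_ Hw2]. rewrite (EF w N W1), (Ef _ W2) in Hw2. fold (kF w) in Hw2.
    assert (Q : w * (w * E w + a2 * (w * E w * (w * E w)) + a3 * (w * E w * (w * E w) * (w * E w)) +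
      w * E w * (w * E w) * (w * E w) * (w * E w) * kF w - w) = 0) by (rewrite Hw2; ring).
    replace (w * (al + a2 + w * (be' + 2 * a2 * al + a3 + w * h w))) with
      ((w * E w + a2 * (w * E w * (w * E w)) + a3 * (w * E w * (w * E w) * (w * E w)) +
      w * E w * (w * E w) * (w * E w) * (w * E w) * kF w - w) / w).
    - rewrite Hw2. field; auto.
    - unfold h, E, T. field; auto. }
  assert (E1 : al = - a2) by (replace al with (al + a2 - a2) by ring; rewrite C1; ring).
  assert (E2 : be = a2 * a2 - a2 * a2 / 2 + a2 * a2 - a3).
  { replace be with (be' + 2 * a2 * al + a3 - (al * al / 2 + 2 * a2 * al + a3)) by (unfold be'; ring).
    rewrite C2, E1. field; auto. }
  assert (N4 : RtoC 4 <> 0) by (apply RtoC_neq_0; lra).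
  split.
  - replace (Gamma 1%nat) with (al / 2) by (unfold al; field; auto). rewrite E1. field; auto.
  - replace (Gamma 2%nat) with (be / 2) by (unfold be; field; auto). rewrite E2. field; auto.
Qed.

Lemma toeplitz2_bound (f : C -> C) (Gamma : nat -> C) :
  class_KS f -> inverse_log_coeffs f Gamma -> (Cmod (toeplitz2 Gamma) <= 145 / 2304)%R.
Proof.
  intros Hf HG. destruct (class_KS_expansion f Hf) as [a2 [a3 [k [Hk [Ef Hb]]]]].
  destruct (local_inverse_log_coeffs f Gamma a2 a3 k 1) as [G1 G2]; auto; [lra| |].
  { apply Cdiff_bounded_at_0, Hk. rewrite Cmod_0; lra. }
  generalize (toeplitz_bound (2 * a2) (3 * a3) Hb). unfold toeplitz2. rewrite G1, G2.
  replace (- (2 * a2 / 4)) with (- (a2 / 2)) by field.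
  replace (2 * a2 * (2 * a2) / 48 - (3 * a3 - 2 * a2 * (2 * a2)) / 6) with (3 / 4 * (a2 * a2) - a3 / 2) by field.
  auto.
Qed.

(** * The logarithmic series and the extremal function *)

(** F(w)/w extends holomorphically with the value 1 at 0, so its logarithm is
    holomorphic near 0 and has a Taylor series without constant term. *)
Lemma log_coeffs_exist (F : C -> C) (rho : R) : (0 < rho)%R -> Hol rho F -> F 0 = 0 -> C_derive F 0 = 1 ->
  exists Gamma, log_coeffs F Gamma.
Proof.
  intros Hr HF H0 H1. assert (Hq := Hol_slope_at_0 rho F HF).
  assert (Hz : (Cmod 0 < rho)%R) by (rewrite Cmod_0; auto).
  destruct (proj1 (contC_at _ _) (Cdiff_cont _ 0 (Hq 0 Hz)) 1%R Rlt_0_1) as [d [Hd Hy]].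
  rewrite slope_at_0_0, H1 in Hy. set (e := Rmin d rho).
  assert (He : (0 < e)%R) by (apply Rmin_pos; auto).
  assert (E1 := Rmin_l d rho). assert (E2 := Rmin_r d rho). fold e in E1, E2.
  assert (HG : Hol e (fun w => Clog (slope_at_0 F w))).
  { intros w Hw. apply Cdiff_comp; [apply Hq; lra|]. eexists. apply Cder_Clog.
    replace 0%R with (1 - 1)%R by ring. apply Re_near_1, Hy. replace (w - 0) with w by ring. lra. }
  set (r := (e / 2)%R). set (c := taylor_coeff (fun w => Clog (slope_at_0 F w)) r).
  exists (fun n => c n / 2), r. split; [unfold r; lra|]. intros w N Hw.
  assert (T := taylor_series (fun w => Clog (slope_at_0 F w)) e r w ltac:(unfold r; lra) HG Hw). fold c in T.
  assert (EF : F w / w = slope_at_0 F w).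
  { rewrite (slope_at_0_eq F w), H0 at 1. field; auto. }
  rewrite EF.
  assert (C0 : c 0%nat = 0).
  { unfold c, taylor_coeff.
    rewrite (mean_ext _ (fun t => (fun w => Clog (slope_at_0 F w)) (RtoC r * cis t))).
    - rewrite (mean_value (fun w => Clog (slope_at_0 F w)) r).
      + rewrite slope_at_0_0, H1. apply Clog_1.
      + unfold r; lra.
      + apply (Hol_closed e); auto. unfold r; lra.
    - intros t. simpl. field. }
  assert (T' := is_series_incr_1 (fun n => c n * w ^ n)).
  eapply is_series_ext; [|apply T'].
  - intros n. cbv beta. match goal with |- ?x = ?y => change (@eq C x y) end. field.
  - match goal with |- is_series _ ?v => replace v with (Clog (slope_at_0 F w)) end; [exact T|].
    rewrite C0. unfold plus; simpl. ring.
Qed.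

Definition log_coeff (n : nat) : C := match n with O => RtoC 0 | S _ => / RtoC (INR n) end.

Lemma Re_one_minus_pos (u : C) : (Cmod u < 1)%R -> (0 < Re (1 - u))%R.
Proof.
  intros Hu. replace 0%R with (1 - 1)%R by ring. apply Re_near_1.
  replace (1 - u - 1) with (- u) by ring. rewrite Cmod_opp. exact Hu.
Qed.

Lemma Re_pos_neq_0 (u : C) : (0 < Re u)%R -> u <> 0.
Proof. intros H E. rewrite E, re_RtoC in H. lra. Qed.

Lemma Cder_pow (n : nat) (v : C) : Cder (fun v => v ^ S n) v (RtoC (INR (S n)) * v ^ n).
Proof.
  induction n as [|n IH].
  - apply (Cder_ext_loc (fun v => v) _ _ _ 1); [lra|intros; symmetry; apply Cpow_1_r|].
    eapply Cder_eq; [apply Cder_id|]. simpl. ring.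
  - apply (Cder_ext_loc (fun v => v * v ^ S n) _ _ _ 1); [lra|intros; reflexivity|].
    eapply Cder_eq; [apply Cder_mult; [apply Cder_id|apply IH]|]. cbv beta.
    rewrite (S_INR (S n)), RtoC_plus, (Cpow_S v n). ring.
Qed.

(** The partial sum P of the series has derivative (1 - v^n) / (1 - v), so
    P + log(1 - v) has derivative - v^n / (1 - v), which is integrated along the
    segment from 0 to u. *)
Lemma log_series (u : C) : (Cmod u < 1)%R -> is_series (fun n => log_coeff n * u ^ n) (- Clog (1 - u)).
Proof.
  intros Hu. assert (H0 := Cmod_ge_0 u).
  apply is_series_geom_bound with (/ (1 - Cmod u))%R (Cmod u); [lra|]. intros n.
  set (P := fun v => sum_n (fun n => log_coeff n * v ^ n) n).
  assert (DP : forall v, (Cmod v < 1)%R -> Cder P v ((1 - v ^ n) / (1 - v))).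
  { intros v Hv. assert (N := Re_pos_neq_0 _ (Re_one_minus_pos v Hv)). unfold P. clear P.
    induction n as [|n IH].
    - apply (Cder_ext_loc (fun _ => log_coeff 0) _ _ _ 1); [lra| |].
      + intros y _. rewrite sum_O. simpl. ring.
      + eapply Cder_eq; [apply Cder_const|]. simpl. field; auto.
    - apply (Cder_ext_loc (fun v => sum_n (fun n => log_coeff n * v ^ n) n + log_coeff (S n) * v ^ S n) _ _ _ 1); [lra| |].
      + intros y _. rewrite sum_Sn. reflexivity.
      + eapply Cder_eq.
        * apply Cder_plus; [apply IH|]. apply Cder_mult; [apply Cder_const|apply Cder_pow].
        * cbv beta. unfold log_coeff. rewrite Cpow_S. field. split; auto.
          apply RtoC_neq_0, not_0_INR. lia. }
  set (g := fun v => P v + Clog (1 - v)).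
  assert (Dg : forall v, (Cmod v < 1)%R -> Cder g v (- (v ^ n / (1 - v)))).
  { intros v Hv. assert (Rv := Re_one_minus_pos v Hv). assert (N := Re_pos_neq_0 _ Rv).
    eapply Cder_eq.
    - apply Cder_plus; [apply DP; auto|]. apply (Cder_comp Clog (fun v => 1 - v)).
      + apply Cder_minus; [apply Cder_const|apply Cder_id].
      + apply Cder_Clog, Rv.
    - cbv beta. field; auto. }
  assert (Ct : forall t, (0 <= t <= 1)%R -> (Cmod (0 + RtoC t * u) <= Cmod u)%R).
  { intros t Ht. rewrite Cplus_0_l, Cmod_mult, Cmod_R, Rabs_pos_eq by lra. nra. }
  assert (L := Rder_lipschitz (fun t => g (0 + RtoC t * u))
     (fun t => - ((0 + RtoC t * u) ^ n / (1 - (0 + RtoC t * u))) * u) 0 1 (/ (1 - Cmod u) * Cmod u ^ n)%R Rle_0_1).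
  lapply L; [clear L; intros L|].
  2:{ intros t Ht. apply (Rder_comp g (fun t => 0 + RtoC t * u)); [|apply Rder_affine].
      apply Dg. specialize (Ct t Ht). lra. }
  lapply L; [clear L; intros L|].
  2:{ intros t Ht. assert (Rv := Re_one_minus_pos (0 + RtoC t * u) ltac:(specialize (Ct t Ht); lra)).
      assert (Ca : contC (fun t => 0 + RtoC t * u) t) by (eapply Rder_cont, Rder_affine).
      apply contC_mult; [|apply contC_const]. apply contC_opp. apply contC_div.
      - apply Re_pos_neq_0, Rv.
      - apply (contC_pow (fun t => 0 + RtoC t * u)), Ca.
      - apply contC_minus; [apply contC_const|apply Ca]. }
  lapply L; [clear L; intros L|].
  - cbv beta in L. replace (0 + RtoC 1 * u) with u in L by ring. replace (0 + RtoC 0 * u) with (RtoC 0) in L by ring.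
    assert (G0 : g 0 = 0).
    { unfold g. replace (1 - 0) with (RtoC 1) by ring. rewrite Clog_1, Cplus_0_r. unfold P. clear.
      induction n as [|n IH]; [rewrite sum_O; simpl; ring|]. rewrite sum_Sn, IH. unfold plus; simpl. ring. }
    rewrite G0 in L. unfold g, P in L.
    replace (sum_n (fun n => log_coeff n * u ^ n) n + Clog (1 - u) - 0) with
      (sum_n (fun n => log_coeff n * u ^ n) n - - Clog (1 - u)) in L by ring. lra.
  - intros t Ht. specialize (Ct t Ht). set (v := 0 + RtoC t * u) in *.
    assert (Rv := Re_one_minus_pos v ltac:(lra)). assert (N := Re_pos_neq_0 _ Rv).
    rewrite Cmod_mult, Cmod_opp, Cmod_div, Cmod_pow by auto.
    assert (B : (1 - Cmod u <= Cmod (1 - v))%R).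
    { generalize (Cmod_sub_ge 1 v). rewrite Cmod_1. lra. }
    assert (B2 : (Cmod v ^ n <= Cmod u ^ n)%R) by (apply pow_incr; split; [apply Cmod_ge_0|auto]).
    assert (B3 : (/ Cmod (1 - v) <= / (1 - Cmod u))%R) by (apply Rinv_le_contravar; lra).
    assert (B4 : (0 <= Cmod v ^ n)%R) by (apply pow_le, Cmod_ge_0).
    assert (B5 : (0 < / Cmod (1 - v))%R) by (apply Rinv_0_lt_compat; lra).
    assert (B6 : (Cmod v ^ n * / Cmod (1 - v) <= Cmod u ^ n * / (1 - Cmod u))%R) by (apply Rmult_le_compat; lra).
    assert (B7 : (0 <= Cmod v ^ n * / Cmod (1 - v))%R) by (apply Rmult_le_pos; lra).
    unfold Rdiv. nra.
Qed.

Lemma series_expansion3 (f : C -> C) (a : nat -> C) (r : R) : (0 < r)%R ->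
  (forall z, (Cmod z < r)%R -> is_series (fun n => a n * z ^ n) (f z)) ->
  a 0%nat = 0 -> a 1%nat = 1 ->
  exists k : C -> C, 
  bounded_at_0 k /\
  (forall z, (Cmod z < r / 4)%R ->
     f z = z + a 2%nat * (z * z) + a 3%nat * (z * z * z) + z * z * z * z * k z).
Proof.
  intros Hr Hs A0 A1.
  set (p := fun z => z + a 2%nat * (z * z) + a 3%nat * (z * z * z)).
  set (rho := (r / 2)%R).
  assert (Crho : Cmod (RtoC rho) = rho) by (rewrite Cmod_R, Rabs_pos_eq; unfold rho; lra).
  destruct (power_series_coeff_bound a (RtoC rho) _ rho Crho (Hs _ ltac:(rewrite Crho; unfold rho; lra))) as [B HB].
  assert (P : forall z, (Cmod z < r / 4)%R -> (Cmod (f z - p z) <= 2 * B / rho ^ 4 * Cmod z ^ 4)%R).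
  { intros z Hz.
    assert (Q := power_series_remainder a rho B z (f z) 3 ltac:(unfold rho; lra) HB ltac:(unfold rho; lra)
       (Hs z ltac:(lra))).
    replace (sum_n _ 3) with (p z) in Q; [exact Q|].
    rewrite !sum_Sn, sum_O, A0, A1. unfold plus, p; simpl. ring. }
  assert (HB0 : (0 <= 2 * B / rho ^ 4)%R).
  { apply Rdiv_le_0_compat; [|apply pow_lt; unfold rho; lra].
    generalize (HB 0%nat) (Cmod_ge_0 (a 0%nat)). simpl. lra. }
  exists (fun z => if Ceq_dec z 0 then RtoC 0 else (f z - p z) / (z * z * z * z)). split.
  - exists (2 * B / rho ^ 4)%R, (r / 4)%R. split; [lra|]. intros s Hs'.
    destruct (Ceq_dec s 0) as [E|N]; [rewrite Cmod_0; exact HB0|].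
    assert (N4 : s * s * s * s <> 0) by (repeat apply Cmult_neq_0; auto).
    rewrite Cmod_div by auto. assert (M := proj1 (Cmod_gt_0 _) N4).
    apply Rmult_le_reg_r with (Cmod (s * s * s * s)); auto.
    unfold Rdiv at 1. rewrite Rmult_assoc, Rinv_l, Rmult_1_r by lra.
    eapply Rle_trans; [apply P; auto|]. rewrite !Cmod_mult. right. ring.
  - intros z Hz. destruct (Ceq_dec z 0) as [E|N].
    + specialize (P z Hz). rewrite E, Cmod_0 in P.
      assert (Z : f 0 - p 0 = 0).
      { apply Cmod_eq_0, Rle_antisym; [|apply Cmod_ge_0]. eapply Rle_trans; [apply P|]. simpl. lra. }
      rewrite E. replace (f 0) with (f 0 - p 0 + p 0) by ring. rewrite Z. unfold p. ring.
    + unfold p. field; auto.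
Qed.

(** The member of the class with (z f')' / (f(z) - f(-z))' equal to
    (1 + i z) / (2 (1 - i z)); its derivative is 1 / (1 - i z). *)
Definition f_ext (z : C) : C := Ci * Clog (1 - Ci * z).

Lemma Ci2 : Ci * Ci = - (1).
Proof. unfold Ci, RtoC, Cmult, Copp; simpl. f_equal; ring. Qed.

Lemma Cmod_Ci_mult (z : C) : Cmod (Ci * z) = Cmod z.
Proof. rewrite Cmod_mult, Cmod_Ci. ring. Qed.

Lemma f_ext_neq (z : C) : (Cmod z < 1)%R -> 1 - Ci * z <> 0.
Proof. intros Hz. apply Re_pos_neq_0, Re_one_minus_pos. rewrite Cmod_Ci_mult. exact Hz. Qed.

Lemma Cder_f_ext (z : C) : (Cmod z < 1)%R -> Cder f_ext z (/ (1 - Ci * z)).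
Proof.
  intros Hz. assert (N := f_ext_neq z Hz). unfold f_ext. eapply Cder_eq.
  - apply Cder_mult; [apply Cder_const|]. apply (Cder_comp Clog (fun z => 1 - Ci * z)).
    + apply Cder_minus; [apply Cder_const|]. apply Cder_mult; [apply Cder_const|apply Cder_id].
    + apply Cder_Clog, Re_one_minus_pos. rewrite Cmod_Ci_mult. exact Hz.
  - cbv beta. replace (0 - (0 * z + Ci * 1)) with (- Ci) by ring.
    replace (0 * Clog (1 - Ci * z) + Ci * (/ (1 - Ci * z) * - Ci)) with (- (Ci * Ci) * / (1 - Ci * z)) by ring.
    rewrite Ci2. ring.
Qed.

(** Here (z f')' = 1 / (1 - i z)^2 and (f(z) - f(-z))' = 2 / (1 + z^2). *)
Lemma f_ext_class_KS : class_KS f_ext.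
Proof.
  assert (Z0 : (Cmod 0 < 1)%R) by (rewrite Cmod_0; lra).
  split; [split; [|split]|].
  - intros z Hz. apply Cdiff_ex_derive. eexists. apply Cder_f_ext, Hz.
  - unfold f_ext. replace (1 - Ci * 0) with (RtoC 1) by ring. rewrite Clog_1. ring.
  - rewrite (Cder_C_derive _ _ _ (Cder_f_ext 0 Z0)). replace (1 - Ci * 0) with (RtoC 1) by ring.
    rewrite <- (Cmult_1_l (/ 1)). apply Cinv_r, C1_nz.
  - intros z Hz. assert (N := f_ext_neq z Hz).
    assert (Hmz : (Cmod (- z) < 1)%R) by (rewrite Cmod_opp; exact Hz).
    assert (Nm := f_ext_neq (- z) Hmz).
    replace (1 - Ci * - z) with (1 + Ci * z) in Nm by ring.
    assert (E1 : C_derive (fun u => u * C_derive f_ext u) z = / ((1 - Ci * z) * (1 - Ci * z))).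
    { apply Cder_C_derive. apply (Cder_ext_loc (fun u => u * / (1 - Ci * u)) _ _ _ (1 - Cmod z)); [lra| |].
      - intros y Hy. rewrite (Cder_C_derive _ _ _ (Cder_f_ext y (near_lt _ _ _ Hy))). reflexivity.
      - eapply Cder_eq.
        + apply Cder_mult; [apply Cder_id|]. apply Cder_inv; [exact N|].
          apply Cder_minus; [apply Cder_const|]. apply Cder_mult; [apply Cder_const|apply Cder_id].
        + cbv beta. field. auto. }
    assert (E2 : C_derive (fun u => f_ext u - f_ext (- u)) z = 2 / ((1 - Ci * z) * (1 + Ci * z))).
    { apply Cder_C_derive. eapply Cder_eq.
      - apply Cder_minus; [apply Cder_f_ext; auto|]. apply (Cder_comp f_ext (fun u => - u)).
        + apply Cder_opp, Cder_id.
        + apply Cder_f_ext; auto.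
      - cbv beta. replace (1 - Ci * - z) with (1 + Ci * z) by ring. field. auto. }
    rewrite E1, E2. set (u := Ci * z) in *.
    assert (Hu : (Cmod u < 1)%R) by (unfold u; rewrite Cmod_Ci_mult; exact Hz).
    set (d := 1 - u) in *.
    assert (Nc : Cconj d <> 0).
    { intros Q. apply N. rewrite <- (Cconj_conj d), Q. apply Cconj_RtoC. }
    (* the quotient is (1+u)/(2(1-u)), with real part (1-|u|^2)/(2|1-u|^2) *)
    replace (/ (d * d) / (2 / (d * (1 + u)))) with (RtoC (/ (2 * Cmod d ^ 2)) * ((1 + u) * Cconj d)).
    + rewrite re_scal_l. apply Rmult_lt_0_compat.
      * apply Rinv_0_lt_compat. apply Rmult_lt_0_compat; [lra|]. apply pow_lt, Cmod_gt_0, N.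
      * assert (E := Cmod2_alt u). assert (Hsq : (Cmod u ^ 2 < 1)%R) by (generalize (Cmod_ge_0 u); nra).
        rewrite E in Hsq. unfold d. destruct u as [x y]. unfold Re, Im, RtoC, Cconj, Cmult, Cminus, Cplus, Copp in *; simpl in *. lra.
    + assert (Hd : (0 < Cmod d)%R) by (apply Cmod_gt_0, N).
      rewrite RtoC_inv, RtoC_mult, Cmod2_conj by nra. field. auto.
Qed.

Lemma f_ext_series (z : C) : (Cmod z < 1)%R ->
  is_series (fun n => (- Ci * (log_coeff n * Ci ^ n)) * z ^ n) (f_ext z).
Proof.
  intros Hz. assert (H := log_series (Ci * z) ltac:(rewrite Cmod_Ci_mult; exact Hz)).
  apply (is_series_scal (- Ci)) in H. unfold f_ext.
  match type of H with is_series _ ?v => replace v with (Ci * Clog (1 - Ci * z)) in H end.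
  - eapply is_series_ext; [|exact H]. intros n. cbv beta. rewrite Cpow_mult_l.
    match goal with |- ?x = ?y => change (@eq C x y) end. unfold scal; simpl. unfold mult; simpl. ring.
  - unfold scal; simpl. unfold mult; simpl. ring.
Qed.

Definition f_ext_inv (w : C) : C := Ci * (Cexp (- (Ci * w)) - 1).

Lemma f_ext_local_inverse : local_inverse f_ext f_ext_inv.
Proof.
  split.
  - unfold f_ext_inv. replace (- (Ci * 0)) with (RtoC 0) by ring. rewrite Cexp_0. ring.
  - exists 1%R. split; [lra|]. intros z Hz. split.
    + unfold f_ext_inv, f_ext. replace (- (Ci * (Ci * Clog (1 - Ci * z)))) with (- (Ci * Ci) * Clog (1 - Ci * z)) by ring.
      rewrite Ci2. replace (- - (1) * Clog (1 - Ci * z)) with (Clog (1 - Ci * z)) by ring.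
      rewrite Cexp_Clog by (apply f_ext_neq, Hz).
      replace (Ci * (1 - Ci * z - 1)) with (- (Ci * Ci) * z) by ring. rewrite Ci2. ring.
    + unfold f_ext_inv, f_ext.
      replace (1 - Ci * (Ci * (Cexp (- (Ci * z)) - 1))) with (1 - (Ci * Ci) * (Cexp (- (Ci * z)) - 1)) by ring.
      rewrite Ci2. replace (1 - - (1) * (Cexp (- (Ci * z)) - 1)) with (Cexp (- (Ci * z))) by ring.
      rewrite Clog_Cexp.
      * replace (Ci * - (Ci * z)) with (- (Ci * Ci) * z) by ring. rewrite Ci2. ring.
      * assert (B := im_le_Cmod (- (Ci * z))). rewrite Cmod_opp, Cmod_Ci_mult in B.
        assert (P := PI2_1).
        assert (B2 : (Rabs (Im (- (Ci * z))) < PI)%R) by lra. apply Rabs_def2 in B2. lra.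
Qed.

Lemma f_ext_inv_Cder (w : C) : Cder f_ext_inv w (Cexp (- (Ci * w))).
Proof.
  unfold f_ext_inv. eapply Cder_eq.
  - apply Cder_mult; [apply Cder_const|]. apply Cder_minus; [|apply Cder_const].
    apply (Cder_comp Cexp (fun w => - (Ci * w))); [|apply Cder_Cexp].
    apply Cder_opp, Cder_mult; [apply Cder_const|apply Cder_id].
  - cbv beta. replace (0 * (Cexp (- (Ci * w)) - 1) + Ci * (Cexp (- (Ci * w)) * - (0 * w + Ci * 1) - 0))
      with (- (Ci * Ci) * Cexp (- (Ci * w))) by ring. rewrite Ci2. ring.
Qed.

(** The coefficients are a2 = i/2 and a3 = -1/3. Hence Gamma_1^2 = -1/16 and
    Gamma_2^2 = 1/2304, and the two terms of the determinant add up. *)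
Lemma f_ext_sharp : exists (f : C -> C) (Gamma : nat -> C),
  class_KS f /\ inverse_log_coeffs f Gamma /\ Cmod (toeplitz2 Gamma) = (145 / 2304)%R.
Proof.
  destruct (log_coeffs_exist f_ext_inv 1) as [Gamma HG]; [lra| | | |].
  { intros w _. eexists. apply f_ext_inv_Cder. }
  { apply f_ext_local_inverse. }
  { rewrite (Cder_C_derive _ _ _ (f_ext_inv_Cder 0)). replace (- (Ci * 0)) with (RtoC 0) by ring. apply Cexp_0. }
  assert (HI : inverse_log_coeffs f_ext Gamma) by (exists f_ext_inv; split; [apply f_ext_local_inverse|exact HG]).
  exists f_ext, Gamma. split; [apply f_ext_class_KS|]. split; [exact HI|].
  destruct (series_expansion3 f_ext _ 1 Rlt_0_1 f_ext_series) as [k [Hk Ek]].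
  { simpl. ring. }
  { simpl. replace (- Ci * (/ 1 * (Ci * 1))) with (- (Ci * Ci) * / 1) by ring. rewrite Ci2. field. }
  destruct (local_inverse_log_coeffs f_ext Gamma _ _ k (1 / 4) ltac:(lra) Hk Ek HI) as [G1 G2].
  assert (E2 : - Ci * (log_coeff 2 * Ci ^ 2) = Ci / 2).
  { unfold log_coeff. replace (INR 2) with 2%R by (simpl; ring). simpl Cpow.
    replace (- Ci * (/ 2 * (Ci * (Ci * 1)))) with (- (Ci * Ci) * Ci / 2) by field. rewrite Ci2. field. }
  assert (E3 : - Ci * (log_coeff 3 * Ci ^ 3) = - (1 / 3)).
  { unfold log_coeff. replace (INR 3) with 3%R by (simpl; ring). simpl Cpow.
    replace (- Ci * (/ 3 * (Ci * (Ci * (Ci * 1))))) with (- ((Ci * Ci) * (Ci * Ci)) / 3) by field. rewrite Ci2. field. }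
  rewrite E2 in G1, G2. rewrite E3 in G2. unfold toeplitz2. rewrite G1, G2.
  replace ((- (Ci / 2 / 2)) ^ 2 - (3 / 4 * (Ci / 2 * (Ci / 2)) - - (1 / 3) / 2) ^ 2) with (RtoC (- (145 / 2304))).
  - rewrite Cmod_R, Rabs_Ropp, Rabs_pos_eq; lra.
  - replace (3 / 4 * (Ci / 2 * (Ci / 2)) - - (1 / 3) / 2) with (3 * (Ci * Ci) / 16 + 1 / 6) by field.
    simpl Cpow. replace (- (Ci / 2 / 2) * (- (Ci / 2 / 2) * 1)) with (Ci * Ci / 16) by field. rewrite Ci2.
    rewrite RtoC_opp, RtoC_div by lra. field.
Qed.

(** * The germ h7 *)

Definition h7_const : R := (sqrt (3 * sqrt 145) / (2 * sqrt 6))%R.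

Lemma h7_const_pos : (0 < h7_const)%R.
Proof.
  unfold h7_const. assert (0 < sqrt 145)%R by (apply sqrt_lt_R0; lra).
  assert (0 < sqrt 6)%R by (apply sqrt_lt_R0; lra).
  assert (0 < sqrt (3 * sqrt 145))%R by (apply sqrt_lt_R0; lra).
  apply Rdiv_lt_0_compat; lra.
Qed.

Lemma h7_const_sq : (h7_const * h7_const = sqrt 145 / 8)%R.
Proof.
  unfold h7_const. assert (0 < sqrt 145)%R by (apply sqrt_lt_R0; lra).
  assert (0 < sqrt 6)%R by (apply sqrt_lt_R0; lra).
  assert (E1 := sqrt_sqrt (3 * sqrt 145) ltac:(lra)). assert (E2 := sqrt_sqrt 6 ltac:(lra)).
  replace (sqrt (3 * sqrt 145) / (2 * sqrt 6) * (sqrt (3 * sqrt 145) / (2 * sqrt 6)))%R with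
    ((sqrt (3 * sqrt 145) * sqrt (3 * sqrt 145)) / (4 * (sqrt 6 * sqrt 6)))%R by (field; lra).
  rewrite E1, E2. field.
Qed.

(** The two constants in h7 are c and 1 / (2 c), so h7(z) = artanh(c z) / c. *)
Lemma h7_eq (z : C) : h7 z = RtoC (/ (2 * h7_const)) * Clog ((1 + RtoC h7_const * z) / (1 - RtoC h7_const * z)).
Proof.
  unfold h7. fold h7_const. f_equal. f_equal. unfold h7_const.
  assert (0 < sqrt 145)%R by (apply sqrt_lt_R0; lra).
  assert (0 < sqrt 6)%R by (apply sqrt_lt_R0; lra).
  assert (0 < sqrt (3 * sqrt 145))%R by (apply sqrt_lt_R0; lra). field. lra.
Qed.

Lemma Clog_inv (u : C) : (0 < Re u)%R -> Clog (/ u) = - Clog u.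
Proof.
  intros Hu. assert (N := Re_pos_neq_0 u Hu).
  rewrite <- (Cexp_Clog u) at 1 by auto. rewrite <- Cexp_opp. apply Clog_Cexp.
  rewrite im_opp. generalize (Im_Clog u Hu) PI_RGT_0. lra.
Qed.

Lemma Re_inv_pos (u : C) : (0 < Re u)%R -> (0 < Re (/ u))%R.
Proof.
  intros Hu. destruct u as [x y]. unfold Re, Cinv in *; simpl in *.
  apply Rdiv_lt_0_compat; auto. nra.
Qed.

Definition h7_coeff (n : nat) : C :=
  RtoC (/ (2 * h7_const)) * (log_coeff n * (RtoC h7_const ^ n - (- RtoC h7_const) ^ n)).

Lemma h7_series (z : C) : (Cmod z < / h7_const)%R ->
  is_series (fun n => h7_coeff n * z ^ n) (h7 z).
Proof.
  intros Hz. assert (Hc := h7_const_pos). set (c := h7_const) in *.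
  assert (Hcz : (Cmod (RtoC c * z) < 1)%R).
  { rewrite Cmod_mult, Cmod_R, Rabs_pos_eq by lra.
    apply Rmult_lt_reg_l with (/ c)%R; [apply Rinv_0_lt_compat; auto|].
    rewrite <- Rmult_assoc, Rinv_l by lra. lra. }
  assert (Hcm : (Cmod (- (RtoC c * z)) < 1)%R) by (rewrite Cmod_opp; exact Hcz).
  assert (S1 := log_series _ Hcz). assert (S2 := log_series _ Hcm).
  assert (R1 := Re_one_minus_pos _ Hcz). assert (R2 := Re_one_minus_pos _ Hcm).
  replace (1 - - (RtoC c * z)) with (1 + RtoC c * z) in R2, S2 by ring.
  assert (S3 := is_series_scal (RtoC (/ (2 * c))) _ _ (is_series_minus _ _ _ _ S1 S2)).
  rewrite h7_eq. fold c. unfold Cdiv at 1. rewrite Clog_mult, Clog_inv by (auto using Re_inv_pos).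
  match type of S3 with is_series _ ?v => replace v with
    (RtoC (/ (2 * c)) * (Clog (1 + RtoC c * z) + - Clog (1 - RtoC c * z))) in S3 end.
  - eapply is_series_ext; [|exact S3]. intros n. cbv beta. unfold h7_coeff. fold c.
    match goal with |- ?x = ?y => change (@eq C x y) end.
    replace (- (RtoC c * z)) with (- RtoC c * z) by ring. rewrite !Cpow_mult_l.
    unfold scal, plus, opp, mult; simpl. unfold mult; simpl. ring.
  - unfold scal, plus, opp; simpl. unfold mult; simpl. ring.
Qed.

Lemma INR_C (n : nat) (x : R) : INR n = x -> RtoC (INR n) = RtoC x.
Proof. intros ->. reflexivity. Qed.

Lemma h7_coeffs : h7_coeff 0 = 0 /\ h7_coeff 1 = 1 /\ h7_coeff 2 = 0 /\
  h7_coeff 3 = RtoC (sqrt 145 / 24) /\ h7_coeff 4 = 0 /\ h7_coeff 5 = RtoC (29 / 64).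
Proof.
  assert (Hc := h7_const_pos). assert (Hs := h7_const_sq). unfold h7_coeff.
  set (c := h7_const) in *.
  assert (N : RtoC c <> 0) by (apply RtoC_neq_0; lra).
  assert (N5 : RtoC 5 <> 0) by (apply RtoC_neq_0; lra).
  assert (N3 : RtoC 3 <> 0) by (apply RtoC_neq_0; lra).
  rewrite RtoC_inv, RtoC_mult by lra. unfold log_coeff.
  rewrite (INR_C 1 1), (INR_C 2 2), (INR_C 3 3), (INR_C 4 4), (INR_C 5 5) by (simpl; ring).
  repeat split.
  - ring.
  - simpl Cpow. field. auto.
  - simpl Cpow. ring.
  - replace (sqrt 145 / 24)%R with (c * c / 3)%R by (rewrite Hs; field).
    rewrite RtoC_div, RtoC_mult by lra. simpl Cpow. field. auto.
  - simpl Cpow. ring.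
  - replace (29 / 64)%R with ((c * c) * (c * c) / 5)%R.
    + rewrite RtoC_div, !RtoC_mult by lra. simpl Cpow. field. auto.
    + rewrite Hs. assert (E := sqrt_sqrt 145 ltac:(lra)).
      replace (sqrt 145 / 8 * (sqrt 145 / 8) / 5)%R with (sqrt 145 * sqrt 145 / 320)%R by field. rewrite E. field.
Qed.

(** This is tanh(c w) / c, written with exp(2 c w). *)
Definition h7_inv (w : C) : C :=
  / RtoC h7_const * ((Cexp (2 * RtoC h7_const * w) - 1) / (Cexp (2 * RtoC h7_const * w) + 1)).

Lemma Cexp_plus_1_neq_0 (s : C) : (Cmod s < 1)%R -> Cexp s + 1 <> 0.
Proof.
  intros Hs. apply Re_pos_neq_0. rewrite re_plus, re_RtoC.
  assert (B := im_le_Cmod s). assert (B2 : (Rabs (Im s) < 1)%R) by lra. apply Rabs_def2 in B2.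
  assert (P := PI2_1). unfold Cexp, Re at 1; simpl.
  assert (0 < cos (Im s))%R by (apply cos_gt_0; lra).
  assert (E := exp_pos (Re s)). nra.
Qed.

Lemma h7_inv_small (w : C) : (Cmod w < / (2 * h7_const))%R -> (Cmod (2 * RtoC h7_const * w) < 1)%R.
Proof.
  intros Hw. assert (Hc := h7_const_pos). rewrite <- RtoC_mult, Cmod_mult, Cmod_R, Rabs_pos_eq by lra.
  apply Rmult_lt_reg_l with (/ (2 * h7_const))%R; [apply Rinv_0_lt_compat; lra|].
  rewrite <- Rmult_assoc, Rinv_l by lra. lra.
Qed.

Lemma h7_inv_0 : h7_inv 0 = 0.
Proof.
  unfold h7_inv. replace (2 * RtoC h7_const * 0) with (RtoC 0) by ring. rewrite Cexp_0.
  replace (1 - 1) with (RtoC 0) by ring. unfold Cdiv. ring.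
Qed.

Lemma h7_local_inverse : local_inverse h7 h7_inv.
Proof.
  assert (Hc := h7_const_pos). split; [apply h7_inv_0|].
  exists (/ (2 * h7_const))%R. split; [apply Rinv_0_lt_compat; lra|].
  intros z Hz. assert (Hs := h7_inv_small z Hz). assert (Nc : RtoC h7_const <> 0) by (apply RtoC_neq_0; lra).
  set (c := h7_const) in *.
  assert (Ek : RtoC (/ (2 * c)) = / (2 * RtoC c)) by (rewrite RtoC_inv, RtoC_mult by lra; reflexivity).
  split.
  - assert (Hcz : (Cmod (RtoC c * z) < 1)%R).
    { replace (2 * RtoC c * z) with (RtoC 2 * (RtoC c * z)) in Hs by ring. rewrite Cmod_mult, Cmod_R, Rabs_pos_eq in Hs by lra.
      generalize (Cmod_ge_0 (RtoC c * z)). lra. }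
    assert (N1 := Re_pos_neq_0 _ (Re_one_minus_pos _ Hcz)).
    assert (N2 := Re_pos_neq_0 _ (Re_one_minus_pos (- (RtoC c * z)) ltac:(rewrite Cmod_opp; exact Hcz))).
    replace (1 - - (RtoC c * z)) with (1 + RtoC c * z) in N2 by ring.
    unfold h7_inv. fold c. rewrite h7_eq. fold c. rewrite Ek.
    replace (2 * RtoC c * (/ (2 * RtoC c) * Clog ((1 + RtoC c * z) / (1 - RtoC c * z)))) with
      (Clog ((1 + RtoC c * z) / (1 - RtoC c * z))) by (field; auto).
    rewrite Cexp_Clog.
    + field. split; [exact N1|split; [|exact Nc]]. cbv beta.
      replace (1 + RtoC c * z + (1 - RtoC c * z)) with (RtoC 2) by ring. apply RtoC_neq_0; lra.
    + unfold Cdiv. apply Cmult_neq_0; auto. intros Q. apply C1_nz.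
      rewrite <- (Cinv_r (1 - RtoC c * z)), Q by auto. ring.
  - assert (Ne := Cexp_plus_1_neq_0 _ Hs). rewrite h7_eq. unfold h7_inv. fold c.
    set (e := Cexp (2 * RtoC c * z)) in *.
    replace ((1 + RtoC c * (/ RtoC c * ((e - 1) / (e + 1)))) / (1 - RtoC c * (/ RtoC c * ((e - 1) / (e + 1))))) with e.
    + unfold e. rewrite Clog_Cexp.
      * rewrite Ek. field. auto.
      * assert (B := im_le_Cmod (2 * RtoC c * z)).
        assert (B2 : (Rabs (Im (2 * RtoC c * z)) < 1)%R) by lra. apply Rabs_def2 in B2.
        assert (P := PI2_1). lra.
    + field. split; [|split]; auto.
      replace (e + 1 - (e - 1)) with (RtoC 2) by ring. apply RtoC_neq_0; lra.
Qed.

Lemma h7_inv_Cder (w : C) : (Cmod w < / (2 * h7_const))%R ->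
  Cder h7_inv w (4 * Cexp (2 * RtoC h7_const * w)
             / ((Cexp (2 * RtoC h7_const * w) + 1) * (Cexp (2 * RtoC h7_const * w) + 1))).
Proof.
  intros Hw. assert (Hc := h7_const_pos). assert (Nc : RtoC h7_const <> 0) by (apply RtoC_neq_0; lra).
  assert (Ne := Cexp_plus_1_neq_0 _ (h7_inv_small w Hw)). unfold h7_inv.
  set (c := RtoC h7_const) in *.
  assert (De : Cder (fun w => Cexp (2 * c * w)) w (Cexp (2 * c * w) * (2 * c))).
  { apply (Cder_comp Cexp (fun w => 2 * c * w)); [|apply Cder_Cexp].
    eapply Cder_eq; [apply Cder_mult; [apply Cder_const|apply Cder_id]|]. cbv beta. ring. }
  eapply Cder_eq.
  - apply Cder_mult; [apply Cder_const|].
    apply (Cder_mult (fun w => Cexp (2 * c * w) - 1) (fun w => / (Cexp (2 * c * w) + 1))).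
    + apply Cder_minus; [apply De|apply Cder_const].
    + apply Cder_inv; [exact Ne|]. apply Cder_plus; [apply De|apply Cder_const].
  - cbv beta. field. auto.
Qed.

(** Here a2 = 0 and a3 = sqrt 145 / 24, so Gamma_1 = 0 and
    Gamma_2 = - sqrt 145 / 48. *)
Lemma h7_sharp : exists Gamma : nat -> C,
  inverse_log_coeffs h7 Gamma /\ Cmod (toeplitz2 Gamma) = (145 / 2304)%R.
Proof.
  assert (Hc := h7_const_pos). assert (Hr : (0 < / (2 * h7_const))%R) by (apply Rinv_0_lt_compat; lra).
  destruct (log_coeffs_exist h7_inv _ Hr) as [Gamma HG].
  { intros w Hw. eexists. apply h7_inv_Cder, Hw. }
  { apply h7_inv_0. }
  { rewrite (Cder_C_derive _ _ _ (h7_inv_Cder 0 ltac:(rewrite Cmod_0; auto))).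
    replace (2 * RtoC h7_const * 0) with (RtoC 0) by ring. rewrite Cexp_0.
    replace (1 + 1) with (RtoC 2) by (rewrite <- RtoC_plus; f_equal; ring). field. }
  assert (HI : inverse_log_coeffs h7 Gamma) by (exists h7_inv; split; [apply h7_local_inverse|exact HG]).
  exists Gamma. split; [exact HI|].
  destruct h7_coeffs as [C0 [C1 [C2 [C3 _]]]].
  assert (Hr' : (0 < / h7_const)%R) by (apply Rinv_0_lt_compat; lra).
  destruct (series_expansion3 h7 h7_coeff _ Hr' h7_series C0 C1) as [k [Hk Ek]].
  destruct (local_inverse_log_coeffs h7 Gamma _ _ k (/ h7_const / 4) ltac:(lra) Hk Ek HI) as [G1 G2].
  rewrite C2 in G1, G2. rewrite C3 in G2. unfold toeplitz2. rewrite G1, G2.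
  replace ((- (0 / 2)) ^ 2 - (3 / 4 * (0 * 0) - RtoC (sqrt 145 / 24) / 2) ^ 2) with (RtoC (- (145 / 2304))).
  - rewrite Cmod_R, Rabs_Ropp, Rabs_pos_eq; lra.
  - replace (145 / 2304)%R with (sqrt 145 * sqrt 145 / 2304)%R by (rewrite sqrt_sqrt by lra; reflexivity).
    rewrite RtoC_opp, !RtoC_div, RtoC_mult by lra. simpl Cpow. field.
Qed.

Theorem theorem2p4 :
  (forall (f : C -> C) (Gamma : nat -> C),
     class_KS f -> inverse_log_coeffs f Gamma ->
     (Cmod (toeplitz2 Gamma) <= 145 / 2304)%R) /\
  (exists (f : C -> C) (Gamma : nat -> C),
     class_KS f /\ inverse_log_coeffs f Gamma /\
     Cmod (toeplitz2 Gamma) = (145 / 2304)%R) /\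
  (exists (a : nat -> C) (r : R),
     (0 < r)%R /\
     (forall z : C, (Cmod z < r)%R ->
        is_series (fun n : nat => a n * z ^ n) (h7 z)) /\
     a 0%nat = 0 /\ a 1%nat = 1 /\ a 2%nat = 0 /\
     a 3%nat = RtoC (sqrt 145 / 24) /\
     a 4%nat = 0 /\ a 5%nat = RtoC (29 / 64)) /\
  (exists Gamma : nat -> C,
     inverse_log_coeffs h7 Gamma /\
     Cmod (toeplitz2 Gamma) = (145 / 2304)%R).
Proof.
  split; [exact toeplitz2_bound|]. split; [exact f_ext_sharp|]. split; [|exact h7_sharp].
  exists h7_coeff, (/ h7_const)%R.
  split; [apply Rinv_0_lt_compat, h7_const_pos|]. split; [exact h7_series|]. exact h7_coeffs.
Qed.
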